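(* Let $\kappa\in\mathbb{R}$. For every $a>0$ the following statements hold. (i) Let $Q_1,Q_2\in A^1(\mathbb{R}_+)$ be real-valued. Then $$A_{Q_1,\kappa}|_{(0,a)}=A_{Q_2,\kappa}|_{(0,a)}\iff Q_1|_{(0,a)}=Q_2|_{(0,a)}$$ (equalities a.e.). (ii) For every $1<p\le\infty$ and $M>0$ there exist $\varepsilon(\kappa,a,p)>0$ and $C_1(\kappa,a,p,M)>0$ such that for every real-valued $Q_1,Q_2\in A^1(\mathbb{R}_+)$ satisfying $$\|Q_j\|_{L^p((0,a))}<M,\ j=1,2,\qquad\int_0^a|A_{Q_1,\kappa}(t)-A_{Q_2,\kappa}(t)|\,dt<\varepsilon(\kappa,a,p),$$ one has $$\int_0^a|Q_1(t)-Q_2(t)|\,dt\le C_1(\kappa,a,p,M)\left(\int_0^a|A_{Q_1,\kappa}(t)-A_{Q_2,\kappa}(t)|\,dt\right)^{1/(p'+1)},$$ where $p'$ is the Hölder conjugate exponent of $p$.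
   Context: $\mathbb{R}_+=(0,\infty)$. $A^1(\mathbb{R}_+)$ is the set of $Q\in L^1_{\rm loc}(\mathbb{R}_+)$ with $\sup_{x\in\mathbb{R}_+}\int_x^{x+1}|Q(t)|dt<\infty$. For $s\in\mathbb{R}$, $L^1_s(\mathbb{R}_+)$ is the set of $F\in L^1_{\rm loc}(\mathbb{R}_+)$ with $\int_0^\infty|F(t)|e^{-2st}dt<\infty$. Weyl–Titchmarsh function: for $Q\in A^1(\mathbb{R}_+)$ and $z>0$ large enough, the problem $-v_z''+Qv_z=-z^2v_z$ on $\mathbb{R}_+$, $v_z(0)=1$, has a unique solution $v_z\in L^2(\mathbb{R}_+)$, and $m_Q(-z^2):=v_z'(0)$. Let $V_\kappa(t):=-\kappa e^{-2t}$, and let $u_z(t,\kappa)=J_z(\sqrt\kappa e^{-t})/J_z(\sqrt\kappa)$ for $\kappa\ne0$ ($J_z$ the Bessel function of the first kind), $u_z(t,0)=e^{-zt}$; $u_z(\cdot,\kappa)$ is the $L^2$ solution $v_z$ above for the potential $V_\kappa$. The $A_\kappa$-amplitude $A_{Q,\kappa}$ of a real-valued $Q\in A^1(\mathbb{R}_+)$ is the unique function belonging to $L^1_s(\mathbb{R}_+)$ for some $s\ge0$ and such that $$m_Q(-z^2)-m_{V_\kappa}(-z^2)=-\int_0^\infty A_{Q,\kappa}(t)u_z(t,\kappa)^2dt$$ for all sufficiently large real $z$ (existence and uniqueness are taken as known). *)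

(* Defs.v *)
From HB Require Import structures.
From mathcomp Require Import all_boot all_order all_algebra.
From mathcomp Require Import complex.
From mathcomp Require Import all_classical all_reals all_analysis.
Import Order.TTheory GRing.Theory Num.Theory.
Import numFieldNormedType.Exports.
Set Implicit Arguments.
Unset Strict Implicit.
Unset Printing Implicit Defensive.
Local Open Scope classical_set_scope.
Local Open Scope ring_scope.
Local Open Scope complex_scope.

(* Elements of L^1_loc(R_+), R_+ = (0, +oo), are represented by functions
   R -> R whose values outside (0, +oo) are never used. *)

Definition inA1 (R : realType) (Q : R -> R) : Prop :=
  locally_integrable `]0, +oo[ Q /\
  (ereal_sup [set \int[lebesgue_measure]_(t in `]x, (x + 1)%R[) `|Q t|%:E
             | x in `]0%R, +oo[ ] < +oo)%E.

Definition L1s (R : realType) (s : R) (F : R -> R) : Prop :=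
  locally_integrable `]0, +oo[ F /\
  (\int[lebesgue_measure]_(t in `]0%R, +oo[)
     ((`|F t| * expR (- (2 * s * t)))%R)%:E < +oo)%E.

(* F is locally absolutely continuous on [0, +oo), with derivative f a.e. *)
Definition loc_abs_primitive (R : realType) (F f : R -> R) : Prop :=
  forall b : R, 0 < b ->
    lebesgue_measure.-integrable `]0, b[ (EFin \o f) /\
    F b = F 0 + \int[lebesgue_measure]_(t in `]0, b[) f t.

(* - v'' + Q v = lambda v on R_+, v(0) = 1, v in L^2(R_+).  As Q is only
   locally integrable, v and v' are locally absolutely continuous and the
   equation holds a.e.; v' is the continuous representative on [0, +oo), so
   that v' 0 is the derivative of v at the end point. *)
Definition L2_solution (R : realType) (Q : R -> R) (lambda : R)
    (v v' : R -> R) : Prop :=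
  [/\ exists v'' : R -> R,
        [/\ loc_abs_primitive v v', loc_abs_primitive v' v'' &
            {ae lebesgue_measure, forall x : R, 0 < x ->
               - v'' x + Q x * v x = lambda * v x}],
      v 0 = 1 &
      (\int[lebesgue_measure]_(x in `]0%R, +oo[) ((v x ^+ 2)%R)%:E < +oo)%E].

(* m_Q(lambda) is defined and equal to m. *)
Definition weyl_titchmarsh (R : realType) (Q : R -> R) (lambda m : R) : Prop :=
  exists v v' : R -> R,
    [/\ L2_solution Q lambda v v',
        forall w w' : R -> R, L2_solution Q lambda w w' ->
          forall x, 0 <= x -> w x = v x &
        m = v' 0].

Definition Gamma (R : realType) (s : R) : R :=
  \int[lebesgue_measure]_(x in `]0, +oo[) (x `^ (s - 1) * expR (- x)).

(* Principal argument, in (-pi, pi], of w != 0. *)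
Definition carg (R : realType) (w : R[i]) : R :=
  let th := acos (complex.Re w / ComplexField.Normc.normc w) in
  if 0 <= complex.Im w then th else - th.

(* Principal branch of w ^ nu for w != 0. *)
Definition cpow (R : realType) (w : R[i]) (nu : R) : R[i] :=
  (ComplexField.Normc.normc w `^ nu)%:C *
  (cos (nu * carg w) +i* sin (nu * carg w)).

(* Bessel function of the first kind, of real order nu > -1. *)
Definition besselJ (R : realType) (nu : R) (w : R[i]) : R[i] :=
  cpow (w / 2) nu *
  limn (series (fun k : nat =>
    ((-1) ^+ k / (k`!%:R * (Gamma (k%:R + nu + 1))%:C)
     * (w / 2) ^+ (2 * k) : R[i]^o))).

Definition V (R : realType) (kappa t : R) : R := - kappa * expR (- (2 * t)).

(* For kappa < 0, sqrtC kappa is imaginary, but the quotient is still real: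
   the factors e^(i pi z / 2) of the two values of J_z cancel. *)
Definition u (R : realType) (z t kappa : R) : R :=
  if kappa == 0 then expR (- (z * t))
  else complex.Re (besselJ z (sqrtC kappa%:C * (expR (- t))%:C)
           / besselJ z (sqrtC kappa%:C)).

Definition is_amplitude (R : realType) (kappa : R) (Q A : R -> R) : Prop :=
  (exists2 s : R, 0 <= s & L1s s A) /\
  \forall z \near +oo, exists m mV : R,
    [/\ weyl_titchmarsh Q (- z ^+ 2) m,
        weyl_titchmarsh (V kappa) (- z ^+ 2) mV &
        m - mV =
        - \int[lebesgue_measure]_(t in `]0, +oo[) (A t * u z t kappa ^+ 2)].

Definition ae_eq_on (R : realType) (a : R) (f g : R -> R) : Prop :=
  {ae lebesgue_measure, forall t : R, 0 < t < a -> f t = g t}.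

Definition L1_dist (R : realType) (a : R) (f g : R -> R) : R :=
  \int[lebesgue_measure]_(t in `]0, a[) `|f t - g t|.

Definition Lp_norm (R : realType) (p : \bar R) (a : R) (f : R -> R) : \bar R :=
  Lnorm lebesgue_measure p ((EFin \o f) \_ `]0, a[).

(* Main.v *)
Require Import Defs.
From HB Require Import structures.
From mathcomp Require Import all_boot all_order all_algebra.
From mathcomp Require Import all_classical all_reals all_analysis.
From mathcomp Require Import measurable_realfun ess_sup_inf complex.
From mathcomp Require Import ring lra.
Import Order.TTheory GRing.Theory Num.Theory.
Import numFieldNormedType.Exports.
Set Implicit Arguments.
Unset Strict Implicit.
Unset Printing Implicit Defensive.
Local Open Scope classical_set_scope.
Local Open Scope ring_scope.


(** Write the decaying solution of -v'' + Qv = -z^2 v as v = e^{-zt} f. Variation of constants gives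
    f(t) = 1 + c (e^{2zt} - 1) - int_0^a Q(s) h(t,s) f(s) ds, where h ([hker]) is the Dirichlet
    Green function conjugated by e^{z(t-s)} and c measures the growing mode of v at a. Square
    integrability forces c = O(e^{-2za}) ([solution_bound], [solution_end]). Without the c-term the
    equation involves Q on (0,a) only. As h is itself a Laplace transform at 2z, the solution is
    then 1 + int e^{-2zr} k(t,r) dr with a kernel k independent of z and |k| <= 2N e^{2Nr}, where N
    bounds the L^1 norm of Q on (0,a) ([kernel_exists]). This approximates f up to O(e^{-2z(a-t)})
    ([solution_kernel]).

    For two potentials the Wronskian identity reads int_0^a (Q1 - Q2) v1 v2 = W(a) - (m1 - m2) with
    W(a) = O(z e^{-2za}), and the amplitudes give m1 - m2 = -int_0^oo (A1 - A2) u^2, whose part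
    beyond a is O(e^{-2za}). Hence int_0^a (Q1 - Q2) v1 v2 and int_0^a (A1 - A2) u^2 agree up to O(z
    e^{-2za}). Since u is the solution for the potential V_kappa ([u_L2_solution], by the Bessel
    series), v1 v2 and u^2 both have the form e^{-2zt} (1 + Laplace transform of an exponentially
    bounded kernel). So both integrals are, up to O(e^{-2za}), Laplace transforms at 2z, of (1 +
    K)(Q1 - Q2) and (1 + L)(A1 - A2) with Volterra operators K and L ([product_representation]). A
    function whose Laplace transform is O(e^{-2zb}) vanishes on (0,b) ([laplace_unique]), so (1 +
    K)(Q1 - Q2) = (1 + L)(A1 - A2) a.e. on (0,a) ([amplitude_volterra]).

    In L^1 with a weight e^{-3Ms} these Volterra operators have norm at most 1/2, so either side can
    be inverted ([volterra_gronwall]): the L^1 distances of the potentials and of the amplitudes on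
    (0,a) bound each other, with a constant depending on a and N only ([amplitude_lipschitz]). Part
    (i) is the case of distance zero. For part (ii) an L^p bound supplies N ([Lp_norm_L1]), and with
    eps = 1 the inequality x <= x^{1/(p'+1)} on [0,1) turns the linear estimate into the stated
    one. *)

(** * Real-valued integrals: domination and Fubini *)

Section Rintegral_tools.
Context {d} {T : measurableType d} {R : realType}.
Variable m : {measure set T -> \bar R}.
Implicit Types f g : T -> R.

Lemma integrable_leT f g : measurable_fun setT f -> (forall x, `|f x| <= g x) ->
  m.-integrable setT (EFin \o g) -> m.-integrable setT (EFin \o f).
Proof.
move=> mf fg; apply: le_integrable => //; first exact/measurable_EFinP.
by move=> x _ /=; rewrite lee_fin (le_trans (fg x))// ler_norm.
Qed.

Lemma integrable_boundT f (c : R) : measurable_fun setT f ->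
  (\int[m]_x `|f x|%:E <= c%:E)%E -> m.-integrable setT (EFin \o f).
Proof.
move=> mf fc; apply/integrableP; split; first exact/measurable_EFinP.
exact: (le_lt_trans fc (ltry _)).
Qed.

Lemma Rintegral_EFin f : m.-integrable setT (EFin \o f) ->
  (\int[m]_x f x)%:E = (\int[m]_x (f x)%:E)%E.
Proof. by move=> mf; rewrite /Rintegral fineK// integrable_fin_num. Qed.

Lemma Rintegral_norm_bound f (c : R) : measurable_fun setT f ->
  (\int[m]_x `|f x|%:E <= c%:E)%E -> `|\int[m]_x f x| <= c.
Proof.
move=> mf fc; have fi := integrable_boundT mf fc.
apply: (le_trans (le_normr_Rintegral _ fi)) => //.
by rewrite -lee_fin Rintegral_EFin//; exact: (integrable_norm fi).
Qed.

Lemma Rintegral_norm_le f g : measurable_fun setT f ->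
  (forall x, `|f x| <= g x) -> m.-integrable setT (EFin \o g) ->
  `|\int[m]_x f x| <= \int[m]_x g x.
Proof.
move=> mf fg ig; have fi := integrable_leT mf fg ig.
apply: (le_trans (le_normr_Rintegral _ fi)) => //.
by apply: le_Rintegral => //; exact: (integrable_norm fi).
Qed.

End Rintegral_tools.

Section Rintegral_product.
Context {d1 d2} {T1 : measurableType d1} {T2 : measurableType d2} {R : realType}.
Variables (m1 : {sigma_finite_measure set T1 -> \bar R})
  (m2 : {sigma_finite_measure set T2 -> \bar R}).

(** Covers points where the inner integral diverges: it is the difference of the integrals of the
    positive and negative parts, each measurable by Tonelli, and [fine] is measurable. *)
Lemma measurable_Rintegral2 (F : T1 * T2 -> R) : measurable_fun setT F ->
  measurable_fun setT (fun x => \int[m2]_y F (x, y)).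
Proof.
move=> mF; apply: (@measurableT_comp _ _ _ _ _ _ fine) => //.
pose E := EFin \o F.
have mE : measurable_fun setT E by exact/measurable_EFinP.
rewrite (_ : (fun x => _) = (fun x => \int[m2]_y E^\+ (x, y)
    - \int[m2]_y E^\- (x, y))%E); last first.
  apply/funext => x; rewrite [LHS]integralE.
  by congr (_ - _)%E; apply: eq_integral => y _; rewrite ?funeposE ?funenegE.

apply: emeasurable_funB.
- apply: (measurable_fun_fubini_tonelli_F E^\+%E) => //.
  exact: measurable_funepos.
- apply: (measurable_fun_fubini_tonelli_F E^\-%E) => //.
  exact: measurable_funeneg.
Qed.

Lemma ae_eq_fine_Rintegral (f : T1 -> \bar R) : m1.-integrable setT f ->
  (\int[m1]_x f x)%E = (\int[m1]_x (fine (f x))%:E)%E.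
Proof.
move=> fi; have mf := measurable_int _ fi.
apply: ae_eq_integral => //.
  by apply/measurable_EFinP; exact: measurableT_comp.
have := integrable_ae measurableT fi.
apply: filterS => x /(_ I) fx _.
by rewrite fineK.
Qed.

Lemma Rintegral_product1 (F : T1 * T2 -> R) :
  (m1 \x m2)%E.-integrable setT (EFin \o F) ->
  \int[(m1 \x m2)%E]_z F z = \int[m1]_x \int[m2]_y F (x, y).
Proof.
move=> Fi; rewrite /Rintegral -integral12_prod_meas1//; congr fine.
rewrite ae_eq_fine_Rintegral//; exact: integrable_fubini_F.
Qed.

Lemma Rintegral_fubini (F : T1 * T2 -> R) :
  (m1 \x m2)%E.-integrable setT (EFin \o F) ->
  \int[m1]_x \int[m2]_y F (x, y) = \int[m2]_y \int[m1]_x F (x, y).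
Proof.
move=> Fi; rewrite -Rintegral_product1// /Rintegral -integral21_prod_meas1//.
congr fine.
have mG := measurable_fubini_G Fi.
apply: ae_eq_integral => //.
  by apply/measurable_EFinP; exact: measurableT_comp.
have := ae_integrable2 Fi.
by apply: filterS => y Fy _; rewrite /fubini_G fineK// integrable_fin_num.
Qed.

End Rintegral_product.

(** * Neumann series in a weighted sup norm *)

Section Neumann.
Context {d} {X : measurableType d} {R : realType}.
Variable m : {sigma_finite_measure set X -> \bar R}.

(** The last hypothesis bounds the integral operator by 1/2 in the sup norm with weight [w], so [H]
    is the sum of the iterates of [g]. The bounds are pointwise, so the fixed point equation holds
    at every point and not merely almost everywhere. *)
Lemma neumann (Th : X * X -> R) (w g : X -> R) :
  measurable_fun setT Th -> measurable_fun setT w -> measurable_fun setT g ->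
  (forall x, 0 <= w x) -> (forall x, `|g x| <= w x) ->
  (forall x, \int[m]_y (`|Th (x, y)| * w y)%:E <= (w x / 2)%:E)%E ->
  exists H : X -> R, [/\ measurable_fun setT H, forall x, `|H x| <= 2 * w x &
    forall x, H x = g x + \int[m]_y (Th (x, y) * H y)].
Proof.
move=> mTh mw mg w0 gw Thw.
have mThx x : measurable_fun setT (fun y => Th (x, y)).
  exact: (measurableT_comp mTh (measurable_pair1 x)).
have bndE (c : R) (h : X -> R) x : 0 <= c -> measurable_fun setT h -> (forall y, `|h y| <= c * w y) ->
    (\int[m]_y `|Th (x, y) * h y|%:E <= (c * w x / 2)%:E)%E.
  move=> c0 mh hw.
  have -> : (c * w x / 2)%:E = (c%:E * (w x / 2)%:E)%E by rewrite -EFinM mulrA.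
  apply: (@le_trans _ _ (c%:E * \int[m]_y (`|Th (x, y)| * w y)%:E)%E); last first.
    by apply: lee_wpmul2l.
  rewrite -ge0_integralZl//; last 2 first.
  - by apply/measurable_EFinP; apply: measurable_funM => //; exact: measurableT_comp.
  - by move=> y _; rewrite lee_fin mulr_ge0.
  apply: ge0_le_integral => //.
  - by apply/measurable_EFinP; apply: measurableT_comp => //; exact: measurable_funM.
  - apply/measurable_EFinP; apply: measurable_funM => //; apply: measurable_funM => //.
    exact: measurableT_comp.
  - by move=> y _; rewrite -EFinM lee_fin normrM mulrCA ler_wpM2l.
pose step (h : X -> R) x := \int[m]_y (Th (x, y) * h y).
pose g_ n := iter n step g.
have mstep h : measurable_fun setT h -> measurable_fun setT (step h).
  move=> mh; apply: (measurable_Rintegral2 m (F := fun z => Th z * h z.2)).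
  by apply: measurable_funM => //; exact: measurableT_comp.
have mg_ n : measurable_fun setT (g_ n) by elim: n => //= n; exact: mstep.
have g_w n x : `|g_ n x| <= 2^-1 ^+ n * w x.
  elim: n x => [|n ih] x; first by rewrite expr0 mul1r.
  apply: Rintegral_norm_bound; first exact: measurable_funM.
  rewrite exprSr mulrAC; apply: bndE => //.
have cg x : cvgn (series (g_ ^~ x)).
  apply: normed_cvg.
  apply: (@series_le_cvg _ _ (geometric (w x) 2^-1)).
  - by move=> n /=.
  - by move=> n; rewrite /= mulr_ge0.
  - by move=> n; rewrite /= [leRHS]mulrC.
  - by apply: is_cvg_geometric_series; rewrite ger0_norm// invf_lt1// ltr1n.
pose S n x := series (g_ ^~ x) n.
have SE n x : S n.+1 x = S n x + g_ n x by rewrite /S seriesSr.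
have S0 x : S 0%N x = 0 by rewrite /S seriesEnat /= big_geq.
have mS n : measurable_fun setT (S n).
  elim: n => [|n ih]; first by rewrite (_ : S 0%N = cst 0)//; apply/funext.
  by rewrite (_ : S n.+1 = S n \+ g_ n); [exact: measurable_funD|apply/funext].
have Sw n x : `|S n x| <= 2 * w x.
  (* The induction closes only with the exact geometric partial sum. *)
  suff : `|S n x| <= (2 - 2 * 2^-1 ^+ n) * w x.
    move/le_trans; apply; rewrite ler_wpM2r// lerBlDr lerDl mulr_ge0//.
  elim: n => [|n ih]; first by rewrite S0 normr0 expr0 mulr1 subrr mul0r.
  rewrite SE (le_trans (ler_normD _ _))//.
  apply: (le_trans (lerD ih (g_w n x))).
  by rewrite -mulrDl ler_wpM2r// exprS; lra.
have Si (c : R) x (h : X -> R) : 0 <= c -> measurable_fun setT h -> (forall y, `|h y| <= c * w y) ->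
    m.-integrable setT (EFin \o (fun y => Th (x, y) * h y)).
  move=> c0 mh hw; apply: integrable_boundT; first exact: measurable_funM.
  exact: bndE c0 mh hw.
have SS n x : S n.+1 x = g x + \int[m]_y (Th (x, y) * S n y).
  elim: n => [|n ih].
    rewrite SE S0 add0r; under eq_Rintegral do rewrite S0 mulr0.
    by rewrite Rintegral_cst// mul0r addr0.
  rewrite SE ih -addrA; congr (_ + _); rewrite /= /step -RintegralD//.
  - by apply: eq_Rintegral => y _; rewrite SE mulrDr.
  - exact: (Si 2).
  - exact: (Si (2^-1 ^+ n)).
pose H x := limn (S ^~ x).
have SH x : S ^~ x @ \oo --> H x by exact: cg.
have mH : measurable_fun setT H.
  by apply: (measurable_fun_cvg mS) => x _; exact: SH.
have Hw x : `|H x| <= 2 * w x.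
  have : `|S n x| @[n --> \oo] --> `|H x| by exact: cvg_norm.
  move/cvg_lim => <- //; apply: limr_le; first by apply/cvg_ex; exists `|H x|; exact: cvg_norm.
  by apply: nearW => n; exact: Sw.
exists H; split => // x.
have : S n.+1 x @[n --> \oo] --> H x by move: (SH x); rewrite -(cvg_shiftS (S ^~ x)).
move/cvg_lim => <- //.
have -> : (fun n => S n.+1 x) = (fun n => g x + \int[m]_y (Th (x, y) * S n y)).
  by apply/funext => n; exact: SS.
apply/cvg_lim => //; apply: cvgD; first exact: cvg_cst.
(* This function dominates all partial sums, which lets the limit pass under the integral. *)
have dom : m.-integrable setT (fun y => (`|Th (x, y)| * (2 * w y))%:E).
  have : m.-integrable setT (EFin \o (fun y => Th (x, y) * (2 * w y))).
    apply: (Si 2) => //; first exact: measurable_funM.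
    by move=> y; rewrite ger0_norm// mulr_ge0.
  move/integrable_norm; apply: eq_integrable => // y _ /=.
  by rewrite normrM (ger0_norm (mulr_ge0 _ (w0 y))).
have [_ _ cvI] : [/\ m.-integrable setT (fun y => (Th (x, y) * H y)%:E),
    (\int[m]_y `|(Th (x, y) * S n y)%:E - (Th (x, y) * H y)%:E| @[n --> \oo]
       --> 0)%E &
    (\int[m]_y (Th (x, y) * S n y)%:E @[n --> \oo]
       --> \int[m]_y (Th (x, y) * H y)%:E)%E].
  apply: dominated_convergence dom _ => //.
  - by move=> n; apply/measurable_EFinP; exact: measurable_funM.
  - by apply/measurable_EFinP; exact: measurable_funM.
  - apply: aeW => y _; apply: cvg_EFin; first exact: nearW.
    by apply: cvgM; [exact: cvg_cst|exact: SH].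
  - apply: aeW => y n _ /=.
    by rewrite lee_fin normrM ler_wpM2l.
by apply: fine_cvg; rewrite Rintegral_EFin//; exact: (Si 2).
Qed.

End Neumann.


(** * Integrals on the line: translations, primitives, exponentials *)

Section real_line.
Context {R : realType}.
Notation mu := (@lebesgue_measure R).
Implicit Types (f F : R -> R) (a b c : R).

Lemma measurable_natb d (T : measurableType d) (b : T -> bool) :
  measurable_fun setT b -> measurable_fun setT (fun x => (b x)%:R : R).
Proof.
move=> mb; rewrite (_ : (fun x => _) = (fun x => if b x then 1 else 0)).
  exact: measurable_fun_ifT.
by apply/funext => x; case: (b x).
Qed.

(** Lebesgue measure is determined by its values on half-open intervals, and those are translation
    invariant. *)
Lemma pushforward_shift c (A : set R) : measurable A ->
  pushforward mu ((fun x => x + c) : R -> measurableTypeR R) A = mu A.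
Proof.
move=> mA.
have mc : measurable_fun setT ((fun x => x + c) : R -> measurableTypeR R).
  exact: measurable_funD.
pose mx := isMeasurableFun.Build _ _ _ _ _ mc.
pose sh := MeasurableFun.Pack (MeasurableFun.Class mx).
rewrite -[LHS]/(pushforward mu sh A).
apply/esym/lebesgue_measure_unique => //= _ [[x y]] _ <-.
rewrite /pushforward.
rewrite (_ : _ @^-1` _ = `]x - c, y - c]%classic); last first.
  by apply/seteqP; split => z /=; rewrite !in_itv/= ltrBlDr lerBrDr.
rewrite !lebesgue_measure_itv/= !lte_fin ltrBlDr subrK.
by case: ifPn => // _; rewrite -!EFinD; congr EFin; ring.
Qed.

Lemma ge0_integral_shift c (f : R -> \bar R) : measurable_fun setT f ->
  (forall x, 0 <= f x)%E ->
  (\int[mu]_x f (x + c)%R = \int[mu]_x f x)%E.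
Proof.
move=> mf f0.
pose sh : _ -> measurableTypeR R := fun x : measurableTypeR R => x + c.
have msh : measurable_fun setT sh by exact: measurable_funD.
transitivity (\int[mu]_(x in sh @^-1` setT) (f \o sh) x)%E => //.
rewrite -ge0_integral_pushforward//=.
by apply: eq_measure_integral => //= A mA _; exact: pushforward_shift.
Qed.

Lemma Rintegral_shift c f : measurable_fun setT f ->
  \int[mu]_x f (x + c)%R = \int[mu]_x f x.
Proof.
move=> mf; rewrite /Rintegral; congr fine.
rewrite [LHS]integralE [RHS]integralE; congr (_ - _)%E.
- rewrite -[RHS](ge0_integral_shift c)//.
    by apply: eq_integral => x _; rewrite !funeposE.
  by apply: measurable_funepos; exact/measurable_EFinP.
- rewrite -[RHS](ge0_integral_shift c)//.
    by apply: eq_integral => x _; rewrite !funenegE.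
  by apply: measurable_funeneg; exact/measurable_EFinP.
Qed.

Lemma continuous_integrable_oo f a b : continuous f ->
  mu.-integrable `]a, b[ (EFin \o f).
Proof.
move=> cf.
have : mu.-integrable `[a, b] (EFin \o f).
  apply: continuous_compact_integrable; first exact: segment_compact.
  exact: continuous_subspaceT.
by apply: integrableS => //; exact: subset_itv_oo_cc.
Qed.

Lemma FTC_oo f F a b : (forall x : R, is_derive x 1 F (f x)) -> continuous f ->
  a <= b -> \int[mu]_(x in `]a, b[) f x = F b - F a.
Proof.
move=> dF cf; rewrite le_eqVlt => /predU1P[<-|ab].
  by rewrite subrr set_itv_ge ?Rintegral_set0// bnd_simp ltxx.
have cF x : {for x, continuous F} by exact/differentiable_continuous/derivable1_diffP.
rewrite /Rintegral integral_itv_obnd_cbnd; last first.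
  by apply/measurable_EFinP/measurable_funTS; exact: continuous_measurable_fun.
rewrite integral_itv_bndo_bndc; last first.
  by apply/measurable_EFinP/measurable_funTS; exact: continuous_measurable_fun.
rewrite (continuous_FTC2 (F := F))//.
- exact: continuous_subspaceT.
- by split => //; [apply: cvg_at_right_filter; exact: cF|
                   apply: cvg_at_left_filter; exact: cF].
- by move=> x _; rewrite derive1E derive_val.
Qed.
End real_line.


Section exp_integrals.
Context {R : realType}.
Notation mu := (@lebesgue_measure R).
Implicit Types (f F : R -> R) (a b c : R).

(** Restrictions to intervals are encoded throughout as factors [b%:R], so that Fubini and
    measurability are always applied on [setT]; this converts to and from restricted functions. *)
Lemma indicator_patch (b : bool) (x : R) : (b%:R * x : R) = if b then x else 0.
Proof. by case: b; rewrite ?mul1r ?mul0r. Qed.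

Lemma Rintegral_window f a b :
  \int[mu]_x ((a < x < b)%R%:R * f x) = \int[mu]_(x in `]a, b[) f x.
Proof.
rewrite [RHS]Rintegral_mkcond; apply: eq_Rintegral => x _.
by rewrite indicator_patch patchE mem_setE in_itv.
Qed.

Lemma integrable_window f a b :
  mu.-integrable setT (EFin \o (fun x => (a < x < b)%R%:R * f x)) <->
  mu.-integrable `]a, b[ (EFin \o f).
Proof.
rewrite [X in _ <-> X]integrable_mkcond//; split; apply: eq_integrable => // x _;
  by rewrite /= patchE mem_setE in_itv/= indicator_patch; case: ifP.
Qed.

Lemma is_derive_expRM c (x : R) :
  is_derive x 1 (fun x => expR (c * x)) (c * expR (c * x)).
Proof.
have dc : is_derive x 1 (fun y => c * y) c.
  have := is_deriveZ c (is_derive_id x (1 : R)).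
  by move/is_derive_eq; apply; rewrite /GRing.scale/= mulr1.
have -> : (fun y => expR (c * y)) = expR \o (fun y => c * y) by [].
by apply: is_derive_eq; rewrite mulrC.
Qed.

Lemma continuous_expRM c : continuous (fun x : R => expR (c * x)).
Proof.
move=> x; apply: continuous_comp; last exact: continuous_expR.
by apply: continuousM; [exact: cst_continuous|exact: id].
Qed.

Lemma measurable_expRM c (D : set R) : measurable_fun D (fun x => expR (c * x)).
Proof.
apply: measurable_funTS; apply: continuous_measurable_fun.
exact: continuous_expRM.
Qed.

Lemma integral_exp c a b : c != 0 -> a <= b ->
  \int[mu]_(x in `]a, b[) expR (c * x) = (expR (c * b) - expR (c * a)) / c.
Proof.
move=> c0 ab.
have dF (x : R) : is_derive x 1 (fun x => c^-1 * expR (c * x)) (expR (c * x)).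
  have := is_deriveZ c^-1 (is_derive_expRM c x).
  by move/is_derive_eq; apply; rewrite /GRing.scale/= mulKf.
rewrite (FTC_oo dF)//; first by rewrite -mulrBr mulrC.
exact: continuous_expRM.
Qed.

(** After multiplication by c this is the total mass 1 of the exponential density; the final case
    split rules out an infinite value. *)
Lemma integral_exp_halfline c : 0 < c ->
  (\int[mu]_x ((0 < x)%R%:R * expR (- c * x))%:E = (c^-1)%:E)%E.
Proof.
move=> c0; transitivity (\int[mu]_(x in `]0%R, +oo[) (expR (- c * x))%:E)%E.
  rewrite [RHS]integral_mkcond; apply: eq_integral => x _.
  by rewrite patchE mem_setE in_itv/= andbT indicator_patch; case: ifP.
rewrite integral_itv_obnd_cbnd; last first.
  by apply/measurable_EFinP; exact: measurable_expRM.
set I := (LHS).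
have cI : (c%:E * I = 1)%E.
  rewrite /I -ge0_integralZl ?lee_fin ?(ltW c0)//; last first.
    by apply/measurable_EFinP; exact: measurable_expRM.
  rewrite -[RHS](integral_exponential_pdf c0) [LHS]integral_mkcond.
  by apply: eq_integral => x _; rewrite /exponential_pdf !patchE; case: ifP.
have I0 : (0 <= I)%E by apply: integral_ge0 => x _; rewrite lee_fin expR_ge0.
case: I I0 cI => [r _ [cr]| _|//].
  by rewrite -[r](mulKf (lt0r_neq0 c0)) cr mulr1.
by rewrite gt0_muley ?lte_fin.
Qed.

End exp_integrals.


(** * Integrability on products; automation for measurability *)

Section product_bounds.
Context {d1 d2} {T1 : measurableType d1} {T2 : measurableType d2} {R : realType}.
Variables (m1 : {sigma_finite_measure set T1 -> \bar R})
  (m2 : {sigma_finite_measure set T2 -> \bar R}).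

Lemma product_integrable12 (F : T1 * T2 -> R) (A : T1 -> R) :
  measurable_fun setT F ->
  (forall x, \int[m2]_y `|F (x, y)|%:E <= (A x)%:E)%E ->
  m1.-integrable setT (EFin \o A) -> (m1 \x m2)%E.-integrable setT (EFin \o F).
Proof.
move=> mF FA iA; apply/integrable12ltyP; first exact/measurable_EFinP.
have /integrableP[mA] := iA; apply: le_lt_trans.
apply: ge0_le_integral => //.
- by move=> x _; apply: integral_ge0.
- apply: (measurable_fun_fubini_tonelli_F (fun z => `|F z|%:E)) => //.
  by apply/measurable_EFinP; exact: measurableT_comp.
- exact: measurableT_comp.
- by move=> x _; apply: (le_trans (FA x)); rewrite /= lee_fin ler_norm.
Qed.

Lemma product_integrable21 (F : T1 * T2 -> R) (A : T2 -> R) :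
  measurable_fun setT F ->
  (forall y, \int[m1]_x `|F (x, y)|%:E <= (A y)%:E)%E ->
  m2.-integrable setT (EFin \o A) -> (m1 \x m2)%E.-integrable setT (EFin \o F).
Proof.
move=> mF FA iA; apply/integrable21ltyP; first exact/measurable_EFinP.
have /integrableP[mA] := iA; apply: le_lt_trans.
apply: ge0_le_integral => //.
- by move=> x _; apply: integral_ge0.
- apply: (measurable_fun_fubini_tonelli_G (fun z => `|F z|%:E)) => //.
  by apply/measurable_EFinP; exact: measurableT_comp.
- exact: measurableT_comp.
- by move=> x _; apply: (le_trans (FA x)); rewrite /= lee_fin ler_norm.
Qed.

End product_bounds.

Section product_sigma_finite.
Context {d1 d2} {T1 : measurableType d1} {T2 : measurableType d2} {R : realType}.
Variables (m1 : {sigma_finite_measure set T1 -> \bar R})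
  (m2 : {sigma_finite_measure set T2 -> \bar R}).

(* The canonical sigma-finite structure that the library puts on a product
   measure is the one of products of subprobabilities, whence this alias. *)
Definition product_sf : set (T1 * T2) -> \bar R := (m1 \x m2)%E.

HB.instance Definition _ := Measure.on product_sf.

Lemma product_sf_sigma_finite : sigma_finite setT product_sf.
Proof.
by case: (lebesgue_integral_fubini.measure_function_Measure_isSigmaFinite__to__measure_function_isSigmaFinite m1 m2).
Qed.

HB.instance Definition _ := Measure_isSigmaFinite.Build _ _ _ product_sf
  product_sf_sigma_finite.
End product_sigma_finite.

Section measurable_compositions.
Context {d} {T : measurableType d} {R : realType}.
Implicit Types f : T -> R.

Lemma measurable_oppr_fun f : measurable_fun setT f ->
  measurable_fun setT (fun x => - f x).
Proof. by move=> mf; exact: measurableT_comp. Qed.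

Lemma measurable_expR_fun f : measurable_fun setT f ->
  measurable_fun setT (fun x => expR (f x)).
Proof. by move=> mf; exact: measurableT_comp. Qed.

Lemma measurable_normr_fun f : measurable_fun setT f ->
  measurable_fun setT (fun x => `|f x|).
Proof. by move=> mf; exact: measurableT_comp. Qed.

Lemma measurable_fst_fun d1 d2 (T1 : measurableType d1) (T2 : measurableType d2)
    (f : T -> T1 * T2) : measurable_fun setT f ->
  measurable_fun setT (fun x => (f x).1).
Proof. by move=> mf; exact: measurableT_comp. Qed.

Lemma measurable_snd_fun d1 d2 (T1 : measurableType d1) (T2 : measurableType d2)
    (f : T -> T1 * T2) : measurable_fun setT f ->
  measurable_fun setT (fun x => (f x).2).
Proof. by move=> mf; exact: measurableT_comp. Qed.

End measurable_compositions.

(** Structural recursion on the body of the function, eta-expanding it first; the last branch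
    composes with a function whose measurability is in the context. *)
Ltac meas := repeat first [ assumption
  | match goal with |- @measurable_fun ?d1 ?d2 ?T ?U ?D ?f =>
      lazymatch f with
      | (fun _ => _) => fail
      | _ => change (@measurable_fun d1 d2 T U D (fun x => f x))
      end end
  | lazymatch goal with
    | |- measurable_fun _ (fun x => expR _) => apply: measurable_expR_fun
    | |- measurable_fun _ (fun x => _ *+ _) => apply: measurable_natb
    | |- measurable_fun _ (fun x => `|_|) => apply: measurable_normr_fun
    | |- measurable_fun _ (fun x => (_ < _)%R) => apply: measurable_fun_ltr
    | |- measurable_fun _ (fun x => _ && _) => apply: measurable_and
    | |- measurable_fun _ (fun x => Num.max _ _) => apply: measurable_maxr
    | |- measurable_fun _ (fun x => (_ * _)%R) => apply: measurable_funM
    | |- measurable_fun _ (fun x => (_ + (- _))%R) => apply: measurable_funB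
    | |- measurable_fun _ (fun x => (_ + _)%R) => apply: measurable_funD
    | |- measurable_fun _ (fun x => (- _)%R) => apply: measurable_oppr_fun
    | |- measurable_fun _ (fun x => x) => exact: measurable_id
    | |- measurable_fun _ (fun x => x.1) => exact: measurable_fst
    | |- measurable_fun _ (fun x => x.2) => exact: measurable_snd
    | |- measurable_fun _ (fun x => (_, _)) => apply: measurable_fun_pair
    | |- measurable_fun _ (fun x => _.1) => apply: measurable_fst_fun
    | |- measurable_fun _ (fun x => _.2) => apply: measurable_snd_fun
    end
  | exact: measurable_cst
  | exact: measurable_fst | exact: measurable_snd | exact: measurable_id
  | match goal with h : measurable_fun setT ?g |- measurable_fun setT (fun x => ?g (@?f x)) =>
      apply: (@measurableT_comp _ _ _ _ _ _ g _ f h) end].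


(** * The conjugated Green function as a Laplace transform *)

Section kernel.
Context {R : realType}.
Notation mu := (@lebesgue_measure R).
Implicit Types (q : R -> R) (k : R * R -> R) (z t s r : R).

Definition delay t s := Num.max (s - t) 0.

Definition window t s r := delay t s < r < s.

(** For t, s >= 0 this is e^{z(t-s)} G(t,s), where G(t,s) = (e^{-z|t-s|} - e^{-z(t+s)}) / (2z) is
    the Green function of -d^2/dt^2 + z^2 on the half-line with a Dirichlet condition at 0. It is
    also the Laplace transform at 2z of the indicator of [window t s], which is what makes the
    solution a Laplace transform. *)
Definition hker z t s := (expR (- (2 * z) * delay t s) - expR (- (2 * z) * s)) / (2 * z).

(** The frequency is 2z because products of two solutions decay like e^{-2zt}. The integral may run
    over the whole line since the kernels vanish for r <= 0. *)
Definition laplace k z t := \int[mu]_r (expR (- (2 * z) * r) * k (t, r)).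

Lemma delay_ge0 t s : 0 <= delay t s.
Proof. by rewrite le_max lexx orbT. Qed.

Lemma delay_le t s : 0 <= t -> 0 <= s -> delay t s <= s.
Proof. by move=> t0 s0; rewrite ge_max s0 andbT lerBlDr lerDl. Qed.

Lemma window_pos t s r : window t s r -> 0 < r.
Proof. by move=> /andP[dr _]; exact: le_lt_trans (delay_ge0 t s) dr. Qed.

Lemma window_exp_integrable c t s r0 :
  mu.-integrable setT (EFin \o (fun r => (window t s (r - r0))%:R * expR (c * r))).
Proof.
have : mu.-integrable setT (EFin \o (fun r =>
    (delay t s + r0 < r < s + r0)%R%:R * expR (c * r))).
  by apply/integrable_window/continuous_integrable_oo/continuous_expRM.
apply: eq_integrable => // r _ /=.
by rewrite /window ltrBrDr ltrBlDr.
Qed.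

(** The shift [r0] is the variable of the second factor in the convolution performed by
    [kernel_step]; the signs of t and s make [delay t s] at most s, so that the window is a genuine
    interval. *)
Lemma window_exp z t s r0 : 0 < z -> 0 <= t -> 0 <= s ->
  \int[mu]_r ((window t s (r - r0))%:R * expR (- (2 * z) * r)) =
  expR (- (2 * z) * r0) * hker z t s.
Proof.
move=> z0 t0 s0.
have -> : \int[mu]_r ((window t s (r - r0))%:R * expR (- (2 * z) * r)) =
   \int[mu]_r ((delay t s + r0 < r < s + r0)%R%:R * expR (- (2 * z) * r)).
  by apply: eq_Rintegral => r _; rewrite /window ltrBrDr ltrBlDr.
rewrite Rintegral_window integral_exp ?lerD2r ?delay_le//; last first.
  by rewrite oppr_eq0 mulf_neq0// gt_eqF.
rewrite /hker !mulrDr !expRD.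
rewrite invrN mulrN -mulNr opprB -mulrBl mulrA; congr (_ / _).
by rewrite mulrC.
Qed.

Lemma hker_ge0 z t s : 0 < z -> 0 <= t -> 0 <= s -> 0 <= hker z t s.
Proof.
move=> z0 t0 s0; rewrite mulr_ge0 ?invr_ge0 ?subr_ge0//.
  by rewrite ler_expR ler_nM2l ?delay_le// oppr_lt0 mulr_gt0.
by rewrite mulr_ge0// ltW.
Qed.

Lemma hker_le z t s : 0 < z -> 0 <= t -> 0 <= s -> hker z t s <= (2 * z)^-1.
Proof.
move=> z0 t0 s0; rewrite /hker ler_pdivrMr ?mulr_gt0// mulVf ?mulf_neq0 ?gt_eqF//.
rewrite lerBlDr (@le_trans _ _ 1)// ?lerDl ?expR_ge0// expR_le1.
by rewrite mulNr oppr_le0 mulr_ge0 ?delay_ge0// mulr_ge0// ltW.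
Qed.

Lemma measurable_hker z t : measurable_fun setT (hker z t).
Proof. rewrite /hker /delay; meas. Qed.

Lemma window_exp_bound z t s r0 : 0 < z -> 0 <= r0 ->
  (\int[mu]_r `|(window t s (r - r0))%:R * expR (- (2 * z) * r)|%:E
    <= (expR (- (2 * z) * r0) / (2 * z))%:E)%E.
Proof.
move=> z0 r00.
have mw : measurable_fun setT (fun r => (window t s (r - r0))%:R * expR (- (2 * z) * r)).
  by rewrite /window /delay; meas.
have mh : measurable_fun setT (fun r => ((0 < r)%R%:R * expR (- (2 * z) * r))).
  by meas.
apply: (@le_trans _ _ ((expR (- (2 * z) * r0))%:E *
    \int[mu]_r ((0 < (r - r0))%R%:R * expR (- (2 * z) * (r - r0)))%R%:E)%E); last first.
  rewrite (ge0_integral_shift (- r0) (f := fun r => ((0 < r)%R%:R * expR (- (2 * z) * r))%R%:E)).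
  - by rewrite integral_exp_halfline ?mulr_gt0// -EFinM.
  - exact/measurable_EFinP.
  - by move=> r; rewrite lee_fin mulr_ge0// expR_ge0.
rewrite -ge0_integralZl ?lee_fin ?expR_ge0//; last first.
  by apply/measurable_EFinP; meas.
apply: ge0_le_integral => //.
- by apply/measurable_EFinP; exact: measurable_normr_fun.
- by apply/measurable_EFinP; meas.
move=> r _; rewrite -EFinM lee_fin normrM (ger0_norm (expR_ge0 _)) ger0_norm//.
rewrite mulrCA -expRD -mulrDr (addrC r0) subrK ler_wpM2r ?expR_ge0// ler_nat.
by case: (boolP (window _ _ _)) => // /window_pos ->.
Qed.

End kernel.


(** * The fixed point equation for the kernel *)

Section kernel_existence.
Context {R : realType}.
Notation mu := (@lebesgue_measure R).
Notation mu2 := (product_sf mu mu).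
Variables (q : R -> R) (N : R).
Hypotheses (mq : measurable_fun setT q) (N0 : 0 < N)
  (qN : (\int[mu]_s `|q s|%:E <= N%:E)%E) (q0 : forall s, s <= 0 -> q s = 0).

(** The equation f = 1 - int q [hker] f for f = 1 + [laplace k], written in the dual variable r:
    this is its inhomogeneous term, and [kernel_step] below convolves the window with k(s, .) in
    r. *)
Definition kernel_source (x : R * R) : R :=
  - \int[mu]_s (q s * (window x.1 s x.2)%:R).

Definition kernel_step (x y : R * R) : R :=
  - (q y.1 * ((0 < y.2)%R%:R * (window x.1 y.1 (x.2 - y.2))%:R)).

Let qi : mu.-integrable setT (EFin \o q).
Proof. by apply: integrable_boundT; [exact: mq|exact: qN]. Qed.

Lemma measurable_kernel_step : measurable_fun setT
  (fun z : (R * R) * (R * R) => kernel_step z.1 z.2).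
Proof. by rewrite /kernel_step /window /delay; meas. Qed.

Lemma measurable_kernel_source : measurable_fun setT kernel_source.
Proof.
rewrite /kernel_source; apply: measurable_oppr_fun.
apply: (measurable_Rintegral2 mu (F := fun z : (R * R) * R =>
  q z.2 * (window z.1.1 z.2 z.1.2)%:R)).
by rewrite /window /delay; meas.
Qed.

Lemma kernel_source_eq0 t r : r <= 0 -> kernel_source (t, r) = 0.
Proof.
move=> r0; rewrite /kernel_source /= (@eq_Rintegral _ _ _ mu setT (cst 0)).
  by rewrite Rintegral_cst// mul0r oppr0.
move=> s _ /=; case: (boolP (window _ _ _)) => [/window_pos|]; rewrite ?mulr0//.
by rewrite ltNge r0.
Qed.

Lemma kernel_source_le x : `|kernel_source x| <= N * expR (2 * N * x.2).
Proof.
case: x => t r; have [r0|r0] := leP r 0.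
  by rewrite kernel_source_eq0// normr0 mulr_ge0 ?expR_ge0// ltW.
rewrite /kernel_source normrN (@le_trans _ _ N)//.
  apply: Rintegral_norm_bound; first by rewrite /window /delay; meas.
  apply: le_trans qN; apply: ge0_le_integral => //.
  - by apply/measurable_EFinP; rewrite /window /delay; meas.
  - by apply/measurable_EFinP; meas.
  - by move=> s _; rewrite lee_fin normrM ler_piMr// ger0_norm// lern1; case: window.
rewrite ler_peMr ?(ltW N0)// -expR0 ler_expR !mulr_ge0//; exact: ltW.
Qed.

(** The rate 2N of the weight is chosen here: the step only sees 0 < p < r, the integral of N
    e^{2Np} over this range is at most e^{2Nr} / 2, and integrating |q| contributes a factor N. The
    result is half the weight, as [neumann] requires. *)
Lemma kernel_step_le x :
  (\int[mu2]_y (`|kernel_step x y| * (N * expR (2 * N * y.2)))%:E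
    <= (N * expR (2 * N * x.2) / 2)%:E)%E.
Proof.
case: x => t r.
have mF : measurable_fun setT (fun y : R * R =>
    `|kernel_step (t, r) y| * (N * expR (2 * N * y.2))).
  by rewrite /kernel_step /window /delay; meas.
have -> : (\int[mu2]_y (`|kernel_step (t, r) y| * (N * expR (2 * N * y.2)))%:E
    = \int[mu]_s \int[mu]_p (`|kernel_step (t, r) (s, p)| * (N * expR (2 * N * p)))%:E)%E.
  apply: (@fubini_tonelli1 _ _ _ _ _ mu mu (fun y : R * R =>
    (`|kernel_step (t, r) y| * (N * expR (2 * N * y.2)))%:E)).
    exact/measurable_EFinP.
  by move=> y; rewrite lee_fin !mulr_ge0// ?expR_ge0// ltW.
have inner s : (\int[mu]_p (`|kernel_step (t, r) (s, p)| * (N * expR (2 * N * p)))%:E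
    <= (`|q s| * (expR (2 * N * r) / 2))%:E)%E.
  apply: (@le_trans _ _ ((`|q s|)%:E *
     \int[mu]_p (N * ((0 < p < r)%R%:R * expR (2 * N * p)))%:E)%E).
    rewrite -ge0_integralZl//; last 2 first.
    - by apply/measurable_EFinP; meas.
    - by move=> p _; rewrite lee_fin !mulr_ge0// ?expR_ge0// ltW.
    apply: ge0_le_integral => //.
    - by move=> p _; rewrite lee_fin !mulr_ge0// ?expR_ge0// ltW.
    - apply/measurable_EFinP; apply: (measurableT_comp mF); exact: measurable_pair1.
    - by apply/measurable_EFinP; meas.
    move=> p _; rewrite -EFinM lee_fin /kernel_step /= normrN normrM -[leLHS]mulrA.
    rewrite ler_wpM2l// mulrCA ler_wpM2l ?(ltW N0)// ler_wpM2r ?expR_ge0//.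
    rewrite normrM !ger0_norm// -natrM ler_nat; case: ltP => //= p0.
    by rewrite mul1n; case: (boolP (window _ _ _)) => // /window_pos; rewrite subr_gt0 => ->.
  rewrite EFinM lee_wpmul2l//.
  have -> : (\int[mu]_p (N * ((0 < p < r)%R%:R * expR (2 * N * p)))%:E =
      (\int[mu]_p (N * ((0 < p < r)%R%:R * expR (2 * N * p))))%R%:E)%E.
    rewrite Rintegral_EFin//.
    have : mu.-integrable setT (EFin \o (fun p => (0 < p < r)%R%:R * expR (2 * N * p))).
      by apply/integrable_window/continuous_integrable_oo/continuous_expRM.
    by move/(integrableZl measurableT N); apply: eq_integrable.
  rewrite lee_fin RintegralZl//; last first.
    by apply/integrable_window/continuous_integrable_oo/continuous_expRM.
  rewrite Rintegral_window; have [r0|r0] := leP r 0.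
    rewrite set_itv_ge ?bnd_simp -?leNgt// Rintegral_set0 mulr0.
    by rewrite mulr_ge0// expR_ge0.
  rewrite integral_exp ?(ltW r0)//; last by rewrite mulf_neq0// gt_eqF.
  rewrite mulr0 expR0 (_ : N * _ = (expR (2 * N * r) - 1) / 2); last first.
    by field; rewrite gt_eqF.
  by rewrite ler_wpM2r// lerBlDr lerDl.
apply: (@le_trans _ _ (\int[mu]_s (`|q s| * (expR (2 * N * r) / 2))%:E)%E).
  apply: ge0_le_integral => //.
  - move=> s _; apply: integral_ge0 => p _.
    by rewrite lee_fin !mulr_ge0// ?expR_ge0// ltW.
  - apply: (@measurable_fun_fubini_tonelli_F _ _ _ _ _ mu (fun y : R * R =>
     (`|kernel_step (t, r) y| * (N * expR (2 * N * y.2)))%:E)).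
      exact/measurable_EFinP.
    by move=> y; rewrite lee_fin !mulr_ge0// ?expR_ge0// ltW.
  - by apply/measurable_EFinP; meas.
under eq_integral do rewrite EFinM.
rewrite ge0_integralZr ?lee_fin ?mulr_ge0 ?expR_ge0//; last first.
  by apply/measurable_EFinP; meas.
rewrite [leRHS](_ : _ = N%:E * (expR (2 * N * r) / 2)%:E)%E; last first.
  by rewrite -EFinM mulrA.
by rewrite lee_wpmul2r// lee_fin mulr_ge0// expR_ge0.
Qed.

End kernel_existence.


Section ge0_scaling.
Context {d} {T : measurableType d} {R : realType}.
Variable m : {measure set T -> \bar R}.

Lemma ge0_integral_scale (c : R) (f : T -> R) : 0 <= c ->
  measurable_fun setT f -> (forall x, 0 <= f x) ->
  (\int[m]_x (c * f x)%:E = c%:E * \int[m]_x (f x)%:E)%E.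
Proof.
move=> c0 mf f0; rewrite -ge0_integralZl//.
- exact/measurable_EFinP.
- by move=> x _; rewrite lee_fin.
Qed.

Lemma integrable_scale (c : R) (f : T -> R) :
  m.-integrable setT (EFin \o f) -> m.-integrable setT (EFin \o (fun x => c * f x)).
Proof. by move=> fi; have := integrableZl measurableT c fi; apply: eq_integrable. Qed.

Lemma le_integral_bound (f g : T -> R) : measurable_fun setT f ->
  measurable_fun setT g -> (forall x, 0 <= f x) -> (forall x, f x <= g x) ->
  (\int[m]_x (f x)%:E <= \int[m]_x (g x)%:E)%E.
Proof.
move=> mf mg f0 fg; apply: ge0_le_integral => //.
- by move=> x _; rewrite lee_fin.
- exact/measurable_EFinP.
- exact/measurable_EFinP.
- by move=> x _; rewrite lee_fin.
Qed.

End ge0_scaling.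

(** * Exponentially bounded kernels and the equation for their Laplace transform *)

Section kernel_class.
Context {R : realType}.
Notation mu := (@lebesgue_measure R).
Notation mu2 := (product_sf mu mu).
Implicit Types (k : R * R -> R) (z t s r M : R).

(* Kernels k(t, r) whose Laplace transform in r converges for large z. *)
Definition exp_kernel M k := [/\ measurable_fun setT k,
  forall t r, `|k (t, r)| <= M * expR (M * r) &
  forall t r, r <= 0 -> k (t, r) = 0].

Lemma laplace_integrand_le M k z t r : exp_kernel M k ->
  `|expR (- (2 * z) * r) * k (t, r)| <= M * ((0 < r)%R%:R * expR (- (2 * z - M) * r)).
Proof.
move=> [_ kM k0]; rewrite normrM (ger0_norm (expR_ge0 _)).
have [r0|r0] := ltP 0 r; last by rewrite k0// normr0 !(mulr0, mul0r).
rewrite mul1r (@le_trans _ _ (expR (- (2 * z) * r) * (M * expR (M * r))))//.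
  by rewrite ler_wpM2l ?expR_ge0.
by rewrite mulrCA -expRD; rewrite opprB mulrBl addrC mulNr.
Qed.

Lemma integral_exp_bound c M : 0 < c -> 0 <= M ->
  (\int[mu]_r (M * ((0 < r)%R%:R * expR (- c * r)))%:E = (M / c)%:E)%E.
Proof.
move=> c0 M0; rewrite ge0_integral_scale ?integral_exp_halfline//.
by meas.
Qed.

Lemma laplace_abs_le M k z t : exp_kernel M k -> 0 <= M -> M < 2 * z ->
  (\int[mu]_r `|expR (- (2 * z) * r) * k (t, r)|%:E <= (M / (2 * z - M))%:E)%E.
Proof.
move=> kM M0 Mz; rewrite -integral_exp_bound ?subr_gt0//.
have [mk _ _] := kM.
apply: ge0_le_integral => //.
- apply/measurable_EFinP; apply: measurable_normr_fun.
  by meas; apply: (measurableT_comp mk); exact: measurable_pair1.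
- by apply/measurable_EFinP; meas.
- by move=> r _; rewrite lee_fin; exact: laplace_integrand_le.
Qed.

Lemma laplace_integrable M k z t : exp_kernel M k -> 0 <= M -> M < 2 * z ->
  mu.-integrable setT (EFin \o (fun r => expR (- (2 * z) * r) * k (t, r))).
Proof.
move=> kM M0 Mz; apply: integrable_boundT; last exact: laplace_abs_le kM M0 Mz.
have [mk _ _] := kM.
by meas; apply: (measurableT_comp mk); exact: measurable_pair1.
Qed.

Lemma laplace_le M k z t : exp_kernel M k -> 0 <= M -> M < 2 * z ->
  `|laplace k z t| <= M / (2 * z - M).
Proof.
move=> kM M0 Mz; apply: Rintegral_norm_bound; last exact: laplace_abs_le kM M0 Mz.
have [mk _ _] := kM.
by meas; apply: (measurableT_comp mk); exact: measurable_pair1.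
Qed.

Lemma measurable_laplace k z : measurable_fun setT k ->
  measurable_fun setT (laplace k z).
Proof.
move=> mk; apply: (@measurable_Rintegral2 _ _ _ _ _ mu
  (fun x : R * R => expR (- (2 * z) * x.2) * k (x.1, x.2))).
by meas.
Qed.

End kernel_class.

Section kernel_equation.
Context {R : realType}.
Notation mu := (@lebesgue_measure R).
Notation mu2 := (product_sf mu mu).
Variables (q : R -> R) (N : R).
Hypotheses (mq : measurable_fun setT q) (N0 : 0 < N)
  (qN : (\int[mu]_s `|q s|%:E <= N%:E)%E) (q0 : forall s, s <= 0 -> q s = 0).

Let qi : mu.-integrable setT (EFin \o q).
Proof. by apply: integrable_boundT; [exact: mq|exact: qN]. Qed.

Let q_hker_cond z t s : 0 < z -> 0 <= t ->
  q s * hker z t s = q s * \int[mu]_r ((window t s r)%:R * expR (- (2 * z) * r)).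
Proof.
move=> z0 t0; have [s0|s0] := leP s 0; first by rewrite q0// !mul0r.
congr (_ * _); have := window_exp 0 z0 t0 (ltW s0).
rewrite mulr0 expR0 mul1r => <-.
by apply: eq_Rintegral => r _; rewrite subr0.
Qed.

Lemma integrable_q_hker z t (f : R -> R) c : 0 < z -> 0 <= t ->
  measurable_fun setT f -> (forall s, `|f s| <= c) ->
  mu.-integrable setT (EFin \o (fun s => q s * hker z t s * f s)).
Proof.
move=> z0 t0 mf fc; have mh := measurable_hker z t.
apply: (@integrable_leT _ _ _ mu _ (fun s => `|q s| * ((2 * z)^-1 * c))).
- by meas.
- move=> s; have [s0|s0] := leP s 0; first by rewrite q0// normr0 !mul0r normr0.
  rewrite -mulrA normrM ler_wpM2l// normrM ler_pM//.
  by rewrite ger0_norm ?hker_ge0 ?hker_le// ltW.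
- have := integrable_scale ((2 * z)^-1 * c) (integrable_norm qi).
  by apply: eq_integrable => // s _ /=; rewrite mulrC.
Qed.

(** By Fubini the window is integrated in r first, which produces [hker]. *)
Lemma laplace_kernel_source z t : 0 < z -> 0 <= t ->
  \int[mu]_r (expR (- (2 * z) * r) * kernel_source q (t, r)) =
  \int[mu]_s (- (q s * hker z t s)).
Proof.
move=> z0 t0.
pose F (x : R * R) := - q x.2 * ((window t x.2 x.1)%:R * expR (- (2 * z) * x.1)).
have mF : measurable_fun setT F by rewrite /F /window /delay; meas.
have Fi : (mu \x mu)%E.-integrable setT (EFin \o F).
  apply: (@product_integrable21 _ _ _ _ _ mu mu F (fun s => `|q s| * (2 * z)^-1)) => //.
  - move=> s; rewrite /F /=.
    under eq_integral do rewrite normrM normrN.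
    rewrite ge0_integral_scale//; last by rewrite /window /delay; meas.
    rewrite EFinM lee_wpmul2l//.
    have := @window_exp_bound R z t s 0 z0 (lexx _).
    rewrite mulr0 expR0 mul1r; apply: le_trans.
    by under [leRHS]eq_integral do rewrite subr0.
  - have := integrable_scale (2 * z)^-1 (integrable_norm qi).
    by apply: eq_integrable => // s _ /=; rewrite mulrC.
transitivity (\int[mu]_r \int[mu]_s F (r, s)).
  apply: eq_Rintegral => r _; rewrite /kernel_source /= mulrN -mulNr.
  rewrite -RintegralZl//=; last first.
    apply: (@integrable_leT _ _ _ mu _ (fun s => `|q s|)).
    - by rewrite /window /delay; meas.
    - by move=> s; rewrite normrM ler_piMr// ger0_norm// lern1; case: window.
    - exact: integrable_norm.
  by apply: eq_Rintegral => s _; rewrite /F /=; ring.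
rewrite (@Rintegral_fubini _ _ _ _ _ mu mu F Fi).
apply: eq_Rintegral => s _; rewrite q_hker_cond// -mulNr -RintegralZl//.
have := @window_exp_integrable R (- (2 * z)) t s 0.
by apply: eq_integrable => // r _ /=; rewrite subr0.
Qed.

(** The Laplace transform turns the convolution in r into a product: integrating in r first gives
    e^{-2zp} [hker z t s], and the integral in p then gives [laplace k z s]. *)
Lemma laplace_kernel_step k z t M : exp_kernel M k -> 0 <= M -> M < 2 * z ->
  0 < z -> 0 <= t ->
  \int[mu]_r (expR (- (2 * z) * r) *
     \int[mu2]_y (kernel_step q (t, r) y * k y)) =
  \int[mu]_s (- (q s * hker z t s * laplace k z s)).
Proof.
move=> kM M0 Mz z0 t0; have [mk kle k0] := kM.
pose G (y : R * R) := - q y.1 * ((0 < y.2)%R%:R * k y).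
pose F (x : R * (R * R)) :=
  G x.2 * ((window t x.2.1 (x.1 - x.2.2))%:R * expR (- (2 * z) * x.1)).
have mG : measurable_fun setT G by rewrite /G; meas.
have mF : measurable_fun setT F by rewrite /F /window /delay; meas.
pose E (y : R * R) := G y * expR (- (2 * z) * y.2) .
have mE : measurable_fun setT E by rewrite /E; meas.
have Ei : (mu \x mu)%E.-integrable setT (EFin \o E).
  apply: (@product_integrable12 _ _ _ _ _ mu mu E
    (fun s => (M / (2 * z - M)) * `|q s|)) => //.
    move=> s; rewrite mulrC EFinM.
    apply: le_trans (lee_wpmul2l _ (laplace_abs_le s kM M0 Mz)); rewrite ?lee_fin//.
    rewrite -ge0_integral_scale//; last first.
      by meas; apply: (measurableT_comp mk); exact: measurable_pair1.
    apply: le_integral_bound => //.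
    - by apply: measurable_normr_fun; apply: (measurableT_comp mE); exact: measurable_pair1.
    - by meas; apply: (measurableT_comp mk); exact: measurable_pair1.
    - move=> r; rewrite /E /G /= !normrM normrN -mulrA ler_wpM2l//.
      by rewrite mulrC ler_wpM2l// ger0_norm// ler_piMl// lern1; case: ltP.
  exact/integrable_scale/integrable_norm.
have Fi : (mu \x mu2)%E.-integrable setT (EFin \o F).
  apply: (@product_integrable21 _ _ _ _ _ mu mu2 F (fun y => (2 * z)^-1 * `|E y|)) => //.
    move=> y; rewrite /F /=.
    have [y0|y0] := ltP 0 y.2; last first.
      rewrite /E /G ltNge y0 /= mul0r mulr0 mul0r normr0 mulr0.
      by under eq_integral do rewrite mul0r normr0; rewrite integral0.
    under eq_integral do rewrite normrM.
    rewrite ge0_integral_scale//; last by rewrite /window /delay; meas.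
    have -> : `|E y| = `|G y| * expR (- (2 * z) * y.2).
      by rewrite /E normrM [X in _ * X]ger0_norm ?expR_ge0.
    rewrite mulrCA EFinM.
    rewrite lee_wpmul2l// [X in (_ <= X%:E)%E]mulrC.
    exact: window_exp_bound z0 (ltW y0).
  exact/integrable_scale/integrable_norm.
transitivity (\int[mu]_r \int[mu2]_y F (r, y)).
  apply: eq_Rintegral => r _; rewrite -RintegralZl//=; last first.
    (* On the window p < r, hence e^{2z(r-p)} >= 1, so integrability at this fixed r follows from
       that of [E]. *)
    apply: (@integrable_leT _ _ _ mu2 _ (fun y => expR (2 * z * r) * `|E y|)).
    - by rewrite /kernel_step /window /delay; meas.
    - move=> y; pose A := q y.1 * ((0 < y.2)%R%:R * k y).
      have -> : kernel_step q (t, r) y * k y = - (A * (window t y.1 (r - y.2))%:R).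
        by rewrite /A /kernel_step /=; ring.
      have -> : E y = - (A * expR (- (2 * z) * y.2)) by rewrite /A /E /G; ring.
      rewrite !normrN !normrM (ger0_norm (expR_ge0 _)) [leRHS]mulrCA ler_wpM2l//.
      rewrite ger0_norm// -expRD.
      case: (boolP (window _ _ _)) => [/window_pos/ltW w|_]; rewrite ?expR_ge0//.
      by rewrite -[leLHS]expR0 ler_expR mulNr -mulrBr mulr_ge0// mulr_ge0// ltW.
    - exact/integrable_scale/integrable_norm.
  apply: eq_Rintegral => y _.
  by rewrite /F /G /kernel_step /=; ring.
rewrite (@Rintegral_fubini _ _ _ _ _ mu mu2 F Fi).
pose K (y : R * R) := E y * hker z t y.1.
have KE y : \int[mu]_r F (r, y) = K y.
  rewrite /F /K /E /=; have [y0|y0] := leP y.1 0.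
    rewrite /G q0// oppr0 !mul0r; under eq_Rintegral do rewrite mul0r.
    by rewrite Rintegral_cst// mul0r.
  rewrite RintegralZl ?window_exp ?(ltW y0)//; first by rewrite mulrA.
  exact: window_exp_integrable.
have mK : measurable_fun setT K.
  by rewrite /K; have mh := measurable_hker z t; meas.
have Ki : (mu \x mu)%E.-integrable setT (EFin \o K).
  apply: (@integrable_leT _ _ _ mu2 _ (fun y => (2 * z)^-1 * `|E y|)) => //.
    move=> y; rewrite /K normrM mulrC; have [y0|y0] := leP y.1 0.
      by rewrite /E /G q0// oppr0 !mul0r normr0 !mulr0.
    by rewrite ler_wpM2r// ger0_norm ?hker_ge0 ?hker_le// ltW.
  exact/integrable_scale/integrable_norm.
rewrite (@eq_Rintegral _ _ _ mu2 setT K)//.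
rewrite (@Rintegral_product1 _ _ _ _ _ mu mu K Ki).
apply: eq_Rintegral => s _; rewrite /K /E /G /=.
rewrite [RHS](_ : _ = - q s * hker z t s * laplace k z s); last by ring.
rewrite /laplace -RintegralZl//; last exact: laplace_integrable kM M0 Mz.
apply: eq_Rintegral => r _; have [r0|r0] := ltP 0 r; last by rewrite k0// !(mulr0, mul0r).
rewrite mul1r; ring.
Qed.

(** The Neumann series is summed once, in the variables (t, r), so a single kernel serves every z >
    N. With the weight N e^{2Nr} the fixed point is bounded by 2N e^{2Nr}, and its Laplace transform
    converges as soon as 2N < 2z. *)
Theorem kernel_exists : exists2 k, exp_kernel (2 * N) k &
  forall z t, N < z -> 0 <= t ->
  laplace k z t = - \int[mu]_s (q s * hker z t s * (1 + laplace k z s)).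
Proof.
have mw : measurable_fun setT (fun x : R * R => N * expR (2 * N * x.2)) by meas.
have [k [mk kw kE]] := @neumann _ _ _ mu2 _ _ _ (measurable_kernel_step mq) mw
  (measurable_kernel_source mq) (fun x => mulr_ge0 (ltW N0) (expR_ge0 _))
  (kernel_source_le mq N0 qN) (kernel_step_le mq N0 qN).
have kN : exp_kernel (2 * N) k.
  split=> // [t r|t r r0]; first by have := kw (t, r); rewrite mulrA.
  (* Vanishing for r <= 0 is read off from the equation itself: both terms contain a window, which
     holds positive numbers only. *)
  rewrite kE kernel_source_eq0// add0r (@eq_Rintegral _ _ _ mu2 setT (cst 0)).
    by rewrite Rintegral_cst// mul0r.
  move=> y _; rewrite /kernel_step /=; case: ltP => [y0|]; last first.
    by rewrite mul0r mulr0 oppr0 mul0r.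
  case: (boolP (window _ _ _)) => [/window_pos|]; last by rewrite !mulr0 oppr0 mul0r.
  by rewrite subr_gt0 ltNge (le_trans r0 (ltW y0)).
have gN : exp_kernel (2 * N) (kernel_source q).
  split; first exact: measurable_kernel_source.
  - move=> t r; apply: (le_trans (kernel_source_le mq N0 qN _)).
    by rewrite ler_wpM2r ?expR_ge0// ler_peMl ?(ltW N0)// ler1n.
  - by move=> t r; exact: kernel_source_eq0.
exists k => // z t Nz t0.
have z0 : 0 < z by exact: lt_trans Nz.
have M0 : 0 <= 2 * N by rewrite mulr_ge0// ltW.
have Mz : 2 * N < 2 * z by rewrite ltr_pM2l.
have gi := laplace_integrable t gN M0 Mz.
have ki := laplace_integrable t kN M0 Mz.
have stepE r : expR (- (2 * z) * r) * \int[mu2]_y (kernel_step q (t, r) y * k y) =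
    expR (- (2 * z) * r) * k (t, r) - expR (- (2 * z) * r) * kernel_source q (t, r).
  by rewrite kE mulrDr addrAC subrr add0r.
have -> : laplace k z t =
    \int[mu]_r (expR (- (2 * z) * r) * kernel_source q (t, r)) +
    \int[mu]_r (expR (- (2 * z) * r) *
      \int[mu2]_y (kernel_step q (t, r) y * k y)).
  rewrite -RintegralD//; last first.
    have := integrableB measurableT ki gi.
    by apply: eq_integrable => // r _ /=; rewrite stepE EFinB.
  by apply: eq_Rintegral => r _; rewrite stepE addrC subrK.
rewrite laplace_kernel_source// (laplace_kernel_step kN M0 Mz z0 t0).
have hi (f : R -> R) (c : R) : measurable_fun setT f -> (forall s, `|f s| <= c) ->
    mu.-integrable setT (EFin \o (fun s => - (q s * hker z t s * f s))).
  move=> mf fc; have := integrable_scale (-1) (integrable_q_hker z0 t0 mf fc).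
  by apply: eq_integrable => // s _ /=; rewrite mulN1r.
have h1 : mu.-integrable setT (EFin \o (fun s => - (q s * hker z t s))).
  have := hi (cst 1) 1 (measurable_cst _) (fun=> ltac:(by rewrite normr1)).
  by apply: eq_integrable => // s _ /=; rewrite mulr1.
have h2 := hi _ _ (measurable_laplace z mk) (fun s => laplace_le s kN M0 Mz).
rewrite -RintegralD// -[RHS]mulN1r -RintegralZl//.
  by apply: eq_Rintegral => s _; ring.
have := integrable_scale (-1) (integrableD measurableT h1 h2).
by apply: eq_integrable => // s _ /=; congr EFin; ring.
Qed.

End kernel_equation.


(** * Volterra operators under the Laplace transform *)

Section integrable_marginal.
Context {d1 d2} {T1 : measurableType d1} {T2 : measurableType d2} {R : realType}.
Variables (m1 : {sigma_finite_measure set T1 -> \bar R})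
  (m2 : {sigma_finite_measure set T2 -> \bar R}).

Lemma integrable_Rintegral1 (F : T1 * T2 -> R) :
  (m1 \x m2)%E.-integrable setT (EFin \o F) ->
  m1.-integrable setT (EFin \o (fun x => \int[m2]_y F (x, y))).
Proof.
move=> Fi; have mF : measurable_fun setT F.
  by apply/measurable_EFinP; exact: measurable_int Fi.
apply/integrableP; split.
  by apply/measurable_EFinP; exact: measurable_Rintegral2.
have /integrable12ltyP : measurable_fun setT (EFin \o F) by exact/measurable_EFinP.
move=> /(_ m1 m2)[/(_ Fi) Foo _]; apply: le_lt_trans Foo.
apply: ge0_le_integral => //.
- apply/measurable_EFinP; apply: measurable_normr_fun.
  exact: measurable_Rintegral2.
- apply: (measurable_fun_fubini_tonelli_F (fun z => `|(EFin \o F) z|%E)) => //=.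
  by apply/measurable_EFinP; exact: measurable_normr_fun.
(* [fine] sends an infinite inner integral to 0, so it can only decrease the absolute value. *)
- move=> x _ /=; apply: (@le_trans _ _ `|\int[m2]_y (F (x, y))%:E|%E).
    rewrite /Rintegral; case: (\int[m2]_y _)%E => [r| |] //=.
    - by rewrite normr0 leey.
    - by rewrite normr0 leey.
  apply: le_abse_integral => //; apply/measurable_EFinP.
  exact: (measurableT_comp mF (measurable_pair1 x)).
Qed.

End integrable_marginal.

Section volterra.
Context {R : realType}.
Notation mu := (@lebesgue_measure R).
Implicit Types (k K : R * R -> R) (z t s r M : R) (D G : R -> R).

Lemma measurable_section k t : measurable_fun setT k ->
  measurable_fun setT (fun r => k (t, r)).
Proof. by move=> mk; exact: (measurableT_comp mk (measurable_pair1 t)). Qed.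

Lemma exp_kernelS M M' k : 0 <= M -> M <= M' -> exp_kernel M k -> exp_kernel M' k.
Proof.
move=> M0 MM [mk kM k0]; split=> // t r; have [r0|r0] := leP r 0.
  by rewrite k0// normr0 mulr_ge0 ?expR_ge0// (le_trans M0).
rewrite (le_trans (kM _ _))// ler_pM// ?expR_ge0//.
by rewrite ler_expR ler_wpM2r// ltW.
Qed.

(** Only 0 < t < s contributes; there K(t, s - t) is at most M e^{Ms}, and e^{2z(s-t)} >= 1 restores
    the weight under which [G] is known to be integrable. *)
Lemma volterra_integrable M K G z s : exp_kernel M K -> 0 <= M -> 0 <= z ->
  measurable_fun setT G -> (forall t, t <= 0 -> G t = 0) ->
  mu.-integrable setT (EFin \o (fun t => expR (- (2 * z) * t) * G t)) ->
  mu.-integrable setT (EFin \o (fun t => G t * K (t, s - t))).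
Proof.
move=> [mK KM K0] M0 z0 mG G0 iG.
apply: (@integrable_leT _ _ _ mu _
  (fun t => (expR (2 * z * s) * M * expR (M * s)) * `|expR (- (2 * z) * t) * G t|)).
- by meas.
- move=> t; have [t0|t0] := leP t 0; first by rewrite G0// mul0r normr0 !mulr_ge0 ?expR_ge0.
  have [st|st] := leP (s - t) 0; first by rewrite K0// mulr0 normr0 !mulr_ge0 ?expR_ge0.
  rewrite subr_gt0 in st.
  rewrite !normrM (ger0_norm (expR_ge0 _)).
  have -> : expR (2 * z * s) * M * expR (M * s) * (expR (- (2 * z) * t) * `|G t|) =
    `|G t| * (M * expR (M * s) * expR (2 * z * (s - t))).
    by rewrite mulrBr -mulNr expRD; ring.
  rewrite ler_wpM2l// (le_trans (KM _ _))//.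
  rewrite -[leLHS]mulr1 ler_pM// ?mulr_ge0 ?expR_ge0//.
    by rewrite ler_wpM2l// ler_expR ler_wpM2l// lerBlDr lerDl ltW.
  by rewrite -expR0 ler_expR mulr_ge0 ?mulr_ge0// subr_ge0 ltW.
- exact/integrable_scale/integrable_norm.
Qed.

(** Fubini and the substitution r = s - t, with e^{-2zs} = e^{-2zt} e^{-2zr}. *)
Lemma laplace_volterra M K G z : exp_kernel M K -> 0 <= M -> M < 2 * z ->
  measurable_fun setT G -> (forall t, t <= 0 -> G t = 0) ->
  mu.-integrable setT (EFin \o (fun t => expR (- (2 * z) * t) * G t)) ->
  mu.-integrable setT
    (EFin \o (fun s => expR (- (2 * z) * s) * \int[mu]_t (G t * K (t, s - t)))) /\
  \int[mu]_s (expR (- (2 * z) * s) * \int[mu]_t (G t * K (t, s - t))) =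
  \int[mu]_t (expR (- (2 * z) * t) * G t * laplace K z t).
Proof.
move=> KM M0 Mz mG G0 iG; have [mK _ _] := KM.
have z0 : 0 <= z by lra.
pose F (x : R * R) := expR (- (2 * z) * x.1) * (G x.2 * K (x.2, x.1 - x.2)).
have mF : measurable_fun setT F by rewrite /F; meas.
have FE s : \int[mu]_t F (s, t) =
    expR (- (2 * z) * s) * \int[mu]_t (G t * K (t, s - t)).
  by rewrite /F /= RintegralZl//; exact: volterra_integrable KM _ _ _ _ iG.
pose phi t r := expR (- (2 * z) * t) * G t * (expR (- (2 * z) * r) * K (t, r)).
have phiE t s : F (s, t) = phi t (s + - t).
  rewrite /F /phi /= [X in _ = X](_ : _ = expR (- (2 * z) * t) * expR (- (2 * z) * (s + - t)) *
    (G t * K (t, s - t))); last by ring.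
  by rewrite -expRD -mulrDr addrCA subrr addr0.
have mphi t : measurable_fun setT (phi t).
  by rewrite /phi; have ms := measurable_section t mK; meas.
have Fi : (mu \x mu)%E.-integrable setT (EFin \o F).
  apply: (@product_integrable21 _ _ _ _ _ mu mu F
    (fun t => M / (2 * z - M) * `|expR (- (2 * z) * t) * G t|)) => //.
    move=> t; under eq_integral do rewrite phiE.
    rewrite (ge0_integral_shift (- t) (f := fun r => (`|phi t r|)%:E))//; last first.
      by apply/measurable_EFinP; exact: measurable_normr_fun.
    rewrite mulrC EFinM; apply: le_trans (lee_wpmul2l _ (laplace_abs_le t KM M0 Mz)) => //.
    rewrite -ge0_integral_scale//; last first.
      by have ms := measurable_section t mK; meas.
    by under [leRHS]eq_integral do rewrite -normrM.
  exact/integrable_scale/integrable_norm.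
split.
  have := @integrable_Rintegral1 _ _ _ _ _ mu mu F Fi.
  by apply: eq_integrable => // s _ /=; rewrite FE.
transitivity (\int[mu]_s \int[mu]_t F (s, t)).
  by apply: eq_Rintegral => s _; rewrite FE.
rewrite (@Rintegral_fubini _ _ _ _ _ mu mu F Fi).
apply: eq_Rintegral => t _; under eq_Rintegral do rewrite phiE.
rewrite (Rintegral_shift (- t) (mphi t)) /phi RintegralZl//.
exact: laplace_integrable KM M0 Mz.
Qed.

End volterra.


(** * The kernel of a product of two solutions *)

Section product_kernel.
Context {R : realType}.
Notation mu := (@lebesgue_measure R).
Implicit Types (k K : R * R -> R) (z t s r M : R) (D : R -> R).

Definition kernel_conv k1 k2 (x : R * R) : R :=
  \int[mu]_p (k1 (x.1, p) * k2 (x.1, x.2 - p)).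

(* 1 + laplace (kernel_prod k1 k2) is the product of the 1 + laplace k_i. *)
Definition kernel_prod k1 k2 (x : R * R) : R :=
  k1 x + k2 x + kernel_conv k1 k2 x.

(** The identity plus a Volterra operator: for an [exp_kernel] the integrand vanishes when t >=
    s. *)
Definition volterra K D s := D s + \int[mu]_t (D t * K (t, s - t)).

Lemma measurable_kernel_conv k1 k2 : measurable_fun setT k1 ->
  measurable_fun setT k2 -> measurable_fun setT (kernel_conv k1 k2).
Proof.
move=> mk1 mk2; apply: (@measurable_Rintegral2 _ _ _ _ _ mu
  (fun z : (R * R) * R => k1 (z.1.1, z.2) * k2 (z.1.1, z.1.2 - z.2))).
by meas.
Qed.

(** The integral over 0 < p < r is at most M^2 r e^{Mr}, and r <= e^r. The number M^2 + M + 1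
    exceeds both M^2 and M + 1, so it serves as constant and as rate. *)
Lemma kernel_conv_exp M k1 k2 : 0 <= M -> exp_kernel M k1 -> exp_kernel M k2 ->
  exp_kernel (M ^+ 2 + M + 1) (kernel_conv k1 k2).
Proof.
move=> M0 [mk1 k1M k10] [mk2 k2M k20].
have M2 := sqr_ge0 M.
have kc0 t r : r <= 0 -> kernel_conv k1 k2 (t, r) = 0.
  move=> r0; rewrite /kernel_conv (@eq_Rintegral _ _ _ mu setT (cst 0)).
    by rewrite Rintegral_cst// mul0r.
  move=> p _ /=; have [p0|p0] := leP p 0; first by rewrite k10// mul0r.
  by rewrite k20 ?mulr0// subr_le0 (le_trans r0 (ltW p0)).
split; [exact: measurable_kernel_conv| |exact: kc0].
move=> t r; have [r0|r0] := leP r 0.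
  by rewrite kc0// normr0 mulr_ge0 ?expR_ge0//; lra.
have bi : mu.-integrable setT (EFin \o (fun p => (0 < p < r)%R%:R * (M ^+ 2 * expR (M * r)))).
  apply/integrable_window/continuous_integrable_oo; exact: cst_continuous.
apply: (@le_trans _ _ (\int[mu]_p ((0 < p < r)%R%:R * (M ^+ 2 * expR (M * r))))).
  apply: (Rintegral_norm_le _ _ bi).
    have ms1 := measurable_section t mk1; have ms2 := measurable_section t mk2.
    by rewrite /=; meas.
  move=> p; have [p0|p0] := leP p 0; first by rewrite k10//= mul0r normr0 mul0r.
  have [rp|rp] := leP (r - p) 0.
    by rewrite k20//= mulr0 normr0 mulr_ge0// mulr_ge0 ?expR_ge0.
  rewrite -subr_gt0 rp mul1r normrM (le_trans (ler_pM _ _ (k1M _ _) (k2M _ _)))//.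
  by rewrite mulrACA -expRD -mulrDr addrC subrK expr2.
rewrite Rintegral_window Rintegral_cst//.
rewrite [X in _ * fine X](_ : _ = r%:E); last first.
  by rewrite [LHS]lebesgue_measure_itv/= lte_fin r0 -EFinD subr0.
rewrite /= -mulrA; apply: ler_pM => //.
- by rewrite mulr_ge0 ?expR_ge0// ltW.
- by lra.
- rewrite (@le_trans _ _ (expR (M * r) * expR r))//.
    by rewrite ler_wpM2l ?expR_ge0// (le_trans _ (expR_ge1Dx _))// lerDr.
  rewrite -expRD ler_expR -[X in _ + X <= _]mul1r -mulrDl ler_wpM2r ?(ltW r0)//.
  by lra.
Qed.

Lemma exp_kernelD M k1 k2 : 0 <= M -> exp_kernel M k1 -> exp_kernel M k2 ->
  exp_kernel (2 * M) (fun x => k1 x + k2 x).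
Proof.
move=> M0 kM1 kM2.
have [mk1 k1M k10] := kM1; have [mk2 k2M k20] := kM2.
split; first by meas.
- move=> t r; have [r0|r0] := leP r 0.
    by rewrite k10// k20// addr0 normr0 !mulr_ge0 ?expR_ge0.
  rewrite (le_trans (ler_normD _ _))// (le_trans (lerD (k1M _ _) (k2M _ _)))//.
  rewrite -mulrDl -mulr2n -(mulr_natl M) ler_wpM2l ?mulr_ge0//.
  by rewrite ler_expR ler_wpM2r ?(ltW r0)// ler_peMl// ler1n.
- by move=> t r r0; rewrite k10// k20// addr0.
Qed.

(** Three kernels are added in two steps, and [exp_kernelD] doubles the constant each time. *)
Lemma kernel_prod_exp M k1 k2 : 0 <= M -> exp_kernel M k1 -> exp_kernel M k2 ->
  exp_kernel (4 * (M ^+ 2 + M + 1)) (kernel_prod k1 k2).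
Proof.
move=> M0 kM1 kM2; set M' := M ^+ 2 + M + 1.
have MM : M <= M' by rewrite /M' addrAC lerDr addr_ge0// sqr_ge0.
have M'0 : 0 <= M' by exact: le_trans MM.
have := exp_kernelD M'0 (exp_kernelS M0 MM kM1) (exp_kernelS M0 MM kM2).
have := exp_kernelS M'0 (_ : M' <= 2 * M') (kernel_conv_exp M0 kM1 kM2).
move=> /(_ ltac:(by rewrite ler_peMl// ler1n)) kc kd.
have -> : 4 * M' = 2 * (2 * M') by ring.
by apply: exp_kernelD; rewrite ?mulr_ge0.
Qed.

Lemma laplace_conv M k1 k2 z t : 0 <= M -> M < 2 * z ->
  exp_kernel M k1 -> exp_kernel M k2 ->
  laplace (kernel_conv k1 k2) z t = laplace k1 z t * laplace k2 z t.
Proof.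
move=> M0 Mz kM1 kM2.
have [mk1 k1M k10] := kM1; have [mk2 k2M k20] := kM2.
(* With t frozen, the convolution is a Volterra integral whose kernel does not depend on its first
   variable. *)
have kM2' : exp_kernel M (fun x => k2 (t, x.2)).
  split=> //; first by meas.
  by move=> t' r r0; exact: k20.
have i1 := laplace_integrable t kM1 M0 Mz.
have ms := measurable_section t mk1.
have [_] := laplace_volterra kM2' M0 Mz ms (k10 t) i1.
by rewrite /laplace /kernel_conv /= => ->; rewrite RintegralZr.
Qed.

Lemma laplace_prod M k1 k2 z t : 0 <= M -> 4 * (M ^+ 2 + M + 1) < 2 * z ->
  exp_kernel M k1 -> exp_kernel M k2 ->
  1 + laplace (kernel_prod k1 k2) z t = (1 + laplace k1 z t) * (1 + laplace k2 z t).
Proof.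
move=> M0 Mz kM1 kM2.
have M2 := sqr_ge0 M.
have Mz1 : M < 2 * z by lra.
have kc := kernel_conv_exp M0 kM1 kM2.
have -> : laplace (kernel_prod k1 k2) z t =
    laplace k1 z t + laplace k2 z t + laplace (kernel_conv k1 k2) z t.
  have i1 := laplace_integrable t kM1 M0 Mz1.
  have i2 := laplace_integrable t kM2 M0 Mz1.
  have ic : mu.-integrable setT
      (EFin \o (fun r => expR (- (2 * z) * r) * kernel_conv k1 k2 (t, r))).
    apply: (laplace_integrable t kc); lra.
  have i12 := integrableD measurableT i1 i2.
  rewrite /laplace -RintegralD// -RintegralD//.
  by apply: eq_Rintegral => r _; rewrite /kernel_prod !mulrDr.
by rewrite (laplace_conv _ M0 Mz1 kM1 kM2); ring.
Qed.

(* Laplace representation of \int D v1 v2 for v_i = e^{-zt} (1 + laplace k_i). *)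
Lemma product_representation M k1 k2 z D : 0 <= M -> 4 * (M ^+ 2 + M + 1) < 2 * z ->
  exp_kernel M k1 -> exp_kernel M k2 ->
  measurable_fun setT D -> (forall t, t <= 0 -> D t = 0) ->
  mu.-integrable setT (EFin \o (fun t => expR (- (2 * z) * t) * D t)) ->
  mu.-integrable setT (EFin \o (fun s => expR (- (2 * z) * s) *
    volterra (kernel_prod k1 k2) D s)) /\
  \int[mu]_t (expR (- (2 * z) * t) * D t * ((1 + laplace k1 z t) * (1 + laplace k2 z t))) =
  \int[mu]_s (expR (- (2 * z) * s) * volterra (kernel_prod k1 k2) D s).
Proof.
move=> M0 Mz kM1 kM2 mD D0 iD.
have kp := kernel_prod_exp M0 kM1 kM2.
have lp t := laplace_prod t M0 Mz kM1 kM2.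
move: (kernel_prod k1 k2) kp lp => P kp lp.
have [mk _ _] := kp.
have M2 := sqr_ge0 M.
have Mp0 : 0 <= 4 * (M ^+ 2 + M + 1) by lra.
have [iV EV] := laplace_volterra kp Mp0 Mz mD D0 iD.
have vE s : expR (- (2 * z) * s) * volterra P D s = expR (- (2 * z) * s) * D s +
    expR (- (2 * z) * s) * \int[mu]_t (D t * P (t, s - t)).
  by rewrite /volterra mulrDr.
have ml := measurable_laplace z mk.
have iL : mu.-integrable setT
    (EFin \o (fun t => expR (- (2 * z) * t) * D t * laplace P z t)).
  apply: (@integrable_leT _ _ _ mu _ (fun t =>
    4 * (M ^+ 2 + M + 1) / (2 * z - 4 * (M ^+ 2 + M + 1)) * `|expR (- (2 * z) * t) * D t|)).
  - by meas.
  - by move=> t; rewrite normrM mulrC ler_wpM2r//; exact: laplace_le kp Mp0 Mz.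
  - exact/integrable_scale/integrable_norm.
split.
  have := integrableD measurableT iD iV.
  by apply: eq_integrable; [by []|move=> s _; rewrite /= vE EFinD].
transitivity (\int[mu]_s (expR (- (2 * z) * s) * D s +
    expR (- (2 * z) * s) * \int[mu]_t (D t * P (t, s - t)))); last first.
  by apply: eq_Rintegral => s _; rewrite vE.
rewrite (RintegralD measurableT iD iV) EV -(RintegralD measurableT iD iL).
by apply: eq_Rintegral => t _; rewrite -lp; ring.
Qed.

End product_kernel.


(** * Functions with Laplace transform O(e^{-2zb}) vanish on (0,b) *)

Section Rintegral_dominated.
Context {d} {T : measurableType d} {R : realType}.
Variable m : {measure set T -> \bar R}.

Lemma Rintegral_dominated (f_ : nat -> T -> R) (f g : T -> R) :
  (forall n, measurable_fun setT (f_ n)) -> measurable_fun setT f ->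
  {ae m, forall x, f_ ^~ x @ \oo --> f x} ->
  (forall n x, `|f_ n x| <= g x) -> m.-integrable setT (EFin \o g) ->
  \int[m]_x f_ n x @[n --> \oo] --> \int[m]_x f x.
Proof.
move=> mf_ mf cf fg gi.
have [fi _ cvI] : [/\ m.-integrable setT (EFin \o f),
    (\int[m]_x `|(f_ n x)%:E - (f x)%:E| @[n --> \oo] --> 0)%E &
    (\int[m]_x (f_ n x)%:E @[n --> \oo] --> \int[m]_x (f x)%:E)%E].
  apply: dominated_convergence gi _ => //.
  - by move=> n; apply/measurable_EFinP.
  - exact/measurable_EFinP.
  - apply: filterS cf => x fx _; apply: cvg_EFin; first exact: nearW.
    exact: fx.
  - by apply: aeW => x n _ /=; rewrite lee_fin.
by apply: fine_cvg; rewrite Rintegral_EFin.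
Qed.

End Rintegral_dominated.

Section exp_partial_sums.
Context {R : realType}.
Implicit Types (x y : R) (m : nat).

(** The Taylor polynomial of degree m of 1 - e^{-x}; the constant term of the series cancels the
    1. *)
Definition one_minus_exp m x := 1 - series (exp_coeff (- x)) m.+1.

Lemma series_exp_coeff1 x : series (exp_coeff x) 1 = 1.
Proof. by rewrite seriesEnat /= big_nat1 /exp_coeff /= expr0 divr1. Qed.

Lemma one_minus_expS m x : one_minus_exp m.+1 x =
  one_minus_exp m x - (- x) ^+ m.+1 / m.+1`!%:R.
Proof. by rewrite /one_minus_exp seriesSr opprD addrA. Qed.

Lemma one_minus_exp0 x : one_minus_exp 0 x = 0.
Proof. by rewrite /one_minus_exp series_exp_coeff1 subrr. Qed.

Lemma series_exp_coeff_le m x : 0 <= x -> series (exp_coeff x) m <= expR x.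
Proof.
move=> x0; apply: nondecreasing_cvgn_le; last exact: is_cvg_series_exp_coeff.
apply/nondecreasing_seqP => n; rewrite seriesSr lerDl; exact: exp_coeff_ge0.
Qed.

(** Uniform in m, through e^x - 1 <= x e^x. The factor x matters: with x = e^{c(t-s)} it supplies
    the e^{-cs} that makes the product with F integrable. *)
Lemma one_minus_exp_le m x : 0 <= x -> `|one_minus_exp m x| <= x * expR x.
Proof.
move=> x0.
have h : `|one_minus_exp m x| <= series (exp_coeff x) m.+1 - 1.
  elim: m => [|m ih].
    by rewrite one_minus_exp0 normr0 series_exp_coeff1 subrr.
  rewrite one_minus_expS (le_trans (ler_normB _ _))// seriesSr addrAC lerD//.
  by rewrite normrM normrX normrN ger0_norm// ger0_norm.
apply: (le_trans h); apply: (@le_trans _ _ (expR x - 1)).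
  by rewrite lerD2r series_exp_coeff_le.
have := ler_wpM2r (expR_ge0 x) (expR_ge1Dx (- x)).
rewrite -expRD addNr expR0 mulrDl mul1r mulNr; lra.
Qed.

Lemma one_minus_exp_cvg x : one_minus_exp m x @[m --> \oo] --> 1 - expR (- x).
Proof.
apply: cvgB; first exact: cvg_cst.
have : series (exp_coeff (- x)) n @[n --> \oo] --> expR (- x).
  exact: is_cvg_series_exp_coeff.
by rewrite -(cvg_shiftS (series _)).
Qed.

Lemma measurable_one_minus_exp m : measurable_fun setT (one_minus_exp m).
Proof.
elim: m => [|m ih].
  by rewrite (_ : one_minus_exp 0 = cst 0)//; apply/funext => x; rewrite one_minus_exp0.
rewrite (_ : one_minus_exp m.+1 =
  (fun x => one_minus_exp m x - (- x) ^+ m.+1 / m.+1`!%:R)).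
  apply: measurable_funB => //; apply: measurable_funM => //.
  by apply: measurable_funX; exact: measurable_oppr_fun.
by apply/funext => x; rewrite one_minus_expS.
Qed.

End exp_partial_sums.

Section laplace_uniqueness.
Context {R : realType}.
Notation mu := (@lebesgue_measure R).
Variables (F : R -> R) (b C z0 : R).
Hypotheses (mF : measurable_fun setT F) (F0 : forall s, s <= 0 -> F s = 0)
  (z0_gt0 : 0 < z0) (C0 : 0 <= C)
  (Fi : forall z, z0 <= z ->
     mu.-integrable setT (EFin \o (fun s => expR (- (2 * z) * s) * F s)))
  (FC : forall z, z0 <= z ->
     `|\int[mu]_s (expR (- (2 * z) * s) * F s)| <= C * expR (- (2 * z) * b)).

Let step (c t s : R) := expR (c * (t - s)).

Let measurable_step c t : measurable_fun setT (step c t).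
Proof. by rewrite /step; meas. Qed.

Let stepE c t s : step c t s = expR (c * t) * expR (- (2 * (c / 2)) * s).
Proof. by rewrite /step -expRD; congr expR; field. Qed.

(** The polynomial in e^{c(t-s)} is integrated term by term: the term of degree k involves only the
    Laplace transform at z = kc/2, where the hypothesis gives C e^{-kcb}. The bounds add up to an
    exponential series without its constant term. *)
Lemma mikusinski_partial m c t : 2 * z0 <= c -> 0 <= t ->
  mu.-integrable setT (EFin \o (fun s => F s * one_minus_exp m (step c t s))) /\
  `|\int[mu]_s (F s * one_minus_exp m (step c t s))| <=
    C * (series (exp_coeff (expR (c * (t - b)))) m.+1 - 1).
Proof.
move=> cz t0; elim: m => [|m [ih1 ih2]].
  have e0 s : F s * one_minus_exp 0 (step c t s) = 0 by rewrite one_minus_exp0 mulr0.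
  split.
    by apply: eq_integrable (integrable0 mu _) => // s _ /=; rewrite e0.
  under eq_Rintegral do rewrite e0.
  by rewrite Rintegral_cst// mul0r normr0 series_exp_coeff1 subrr mulr0.
pose c' := m.+1%:R * c.
have c'z : z0 <= c' / 2.
  rewrite ler_pdivlMr// mulrC (le_trans cz)// ler_peMl ?ler1n//.
  by rewrite (le_trans _ cz)// mulr_ge0// ltW.
pose a := (- 1) ^+ m.+1 / m.+1`!%:R * expR (c' * t).
have tE s : F s * one_minus_exp m.+1 (step c t s) =
    F s * one_minus_exp m (step c t s) - a * (expR (- (2 * (c' / 2)) * s) * F s).
  rewrite one_minus_expS mulrBr; congr (_ - _).
  rewrite exprNn /step -expRM_natl mulrA -/c' -/(step c' t s) stepE /a; ring.
have i1 := integrable_scale a (Fi c'z).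
split.
  have := integrableB measurableT ih1 i1.
  by apply: eq_integrable; [by []|move=> s _; rewrite /= tE EFinB].
under eq_Rintegral do rewrite tE.
rewrite RintegralB// (le_trans (ler_normB _ _))// seriesSr addrAC mulrDr lerD//.
rewrite RintegralZl//; last exact: Fi.
rewrite normrM (le_trans (ler_wpM2l _ (FC c'z)))//.
rewrite /a !normrM normrX normrN1 expr1n mul1r (ger0_norm (expR_ge0 _)) ger0_norm ?invr_ge0//.
rewrite /exp_coeff /= [X in _ <= C * (X / _)](_ : _ =
    expR (c' * t) * expR (- (2 * (c' / 2)) * b)); last first.
  by rewrite -expRM_natl -expRD; congr expR; rewrite /c'; field.
by rewrite le_eqVlt; apply/orP; left; apply/eqP; ring.
Qed.

(** The limit m -> oo at fixed c, by dominated convergence. *)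
Lemma mikusinski_bound c t : 2 * z0 <= c -> 0 <= t ->
  `|\int[mu]_s (F s * (1 - expR (- step c t s)))| <= C * (expR (expR (c * (t - b))) - 1).
Proof.
move=> cz t0.
have c0 : 0 <= c by rewrite (le_trans _ cz)// mulr_ge0// ltW.
have z0c : z0 <= c / 2 by rewrite ler_pdivlMr// mulrC.
have cv : \int[mu]_s (F s * one_minus_exp m (step c t s)) @[m --> \oo] -->
    \int[mu]_s (F s * (1 - expR (- step c t s))).
  apply: (@Rintegral_dominated _ _ _ mu _ _ (fun s => (expR (c * t) * expR (expR (c * t))) *
      `|expR (- (2 * (c / 2)) * s) * F s|)).
  - move=> m; have mo := @measurable_one_minus_exp R m; have ms := measurable_step c t.
    by meas.
  - by have ms := measurable_step c t; meas.
  - apply: aeW => s; apply: cvgM; [exact: cvg_cst|exact: one_minus_exp_cvg].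
  - move=> m s; have [s0|s0] := leP s 0; first by rewrite F0// mul0r normr0 !mulr_ge0 ?expR_ge0.
    rewrite !normrM (ger0_norm (expR_ge0 _)) [leRHS](_ : _ =
      `|F s| * (expR (c * t) * expR (- (2 * (c / 2)) * s) * expR (expR (c * t)))); last by ring.
    rewrite ler_wpM2l// -stepE (le_trans (one_minus_exp_le _ _)) ?expR_ge0//.
    rewrite ler_wpM2l ?expR_ge0// ler_expR /step ler_expR ler_wpM2l//.
    by rewrite lerBlDr lerDl ltW.
  - exact/integrable_scale/integrable_norm/Fi.
have cn : `|\int[mu]_s (F s * one_minus_exp m (step c t s))| @[m --> \oo] -->
    `|\int[mu]_s (F s * (1 - expR (- step c t s)))| by exact: cvg_norm.
rewrite -(cvg_lim _ cn)//; apply: limr_le; first by apply/cvg_ex; eexists; exact: cn.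
apply: nearW => m.
apply: (le_trans (mikusinski_partial m cz t0).2); rewrite ler_wpM2l// lerD2r.
by rewrite series_exp_coeff_le ?expR_ge0.
Qed.

End laplace_uniqueness.


Section laplace_uniqueness.
Context {R : realType}.
Notation mu := (@lebesgue_measure R).

Lemma ae_neq (t : R) : {ae mu, forall s : R, s != t}.
Proof.
exists [set t]; split => //; first exact: lebesgue_measure_set1.
by move=> s /= /negP; rewrite negbK => /eqP.
Qed.

Lemma expR_natmul_cvg0 (y : R) n0 : y < 0 -> expR ((n + n0)%:R * y) @[n --> \oo] --> 0.
Proof.
move=> y0.
have : GRing.exp (expR y) n @[n --> \oo] --> 0.
  by apply: cvg_expr; rewrite ger0_norm ?expR_ge0// expR_lt1.
rewrite -(cvg_shiftn n0); apply: cvg_trans; apply: near_eq_cvg.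
by apply: nearW => n /=; rewrite expRM_natl.
Qed.

Lemma expRN_expR_natmul_cvg0 (y : R) n0 : 0 < y ->
  expR (- expR ((n + n0)%:R * y)) @[n --> \oo] --> 0.
Proof.
move=> y0; have Ny0 : - y < 0 by rewrite oppr_lt0.
apply: (squeeze_cvgr _ (cvg_cst 0) (expR_natmul_cvg0 n0 Ny0)).
apply: nearW => n; rewrite expR_ge0/= mulrN !expRN lef_pV2 ?posrE ?expR_gt0//.
by rewrite (le_trans _ (expR_ge1Dx _))// lerDr.
Qed.

(** Let c -> oo in [mikusinski_bound]: the double exponential 1 - exp(-e^{c(t-s)}) tends to the
    indicator of s < t, while the right-hand side C (exp(e^{c(t-b)}) - 1) tends to 0 because t <
    b. *)
Lemma mikusinski_integral (F : R -> R) (b C z0 t : R) : measurable_fun setT F ->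
  (forall s, s <= 0 -> F s = 0) -> 0 < z0 -> 0 <= C ->
  (forall z, z0 <= z ->
     mu.-integrable setT (EFin \o (fun s => expR (- (2 * z) * s) * F s))) ->
  (forall z, z0 <= z ->
     `|\int[mu]_s (expR (- (2 * z) * s) * F s)| <= C * expR (- (2 * z) * b)) ->
  0 <= t < b -> \int[mu]_s (F s * (s < t)%R%:R) = 0.
Proof.
move=> mF F0 z00 C0 Fi FC /andP[t0 tb].
(* The parameter c runs through the integers n + n0 >= 2 z0, so every transform that occurs is taken
   at a point >= z0. *)
pose n0 := Num.bound (2 * z0).
have n0z : 2 * z0 <= n0%:R by rewrite ltW// archi_boundP// mulr_ge0// ltW.
pose c n := (n + n0)%:R : R.
have cz n : 2 * z0 <= c n by rewrite (le_trans n0z)// ler_nat leq_addl.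
have cv : \int[mu]_s (F s * (1 - expR (- expR (c n * (t - s))))) @[n --> \oo] -->
    \int[mu]_s (F s * (s < t)%R%:R).
  apply: (@Rintegral_dominated _ _ _ mu _ _ (fun s => expR (n0%:R * t) *
      `|expR (- (2 * (n0%:R / 2)) * s) * F s|)).
  - by move=> n; meas.
  - by meas.
  - have := ae_neq t; apply: filterS; first exact: (ae_filter_ringOfSetsType mu).
    move=> s st; apply: cvgM; first exact: cvg_cst.
    have [{}st|ts] := ltP s t.
      rewrite -[X in _ --> X](subr0 1); apply: cvgB; first exact: cvg_cst.
      by apply: expRN_expR_natmul_cvg0; rewrite subr_gt0.
    have {}ts : t - s < 0 by rewrite subr_lt0 lt_neqAle eq_sym st.
    rewrite -[X in _ --> X](subrr 1); apply: cvgB; first exact: cvg_cst.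
    rewrite -expR0 -oppr0; apply: (cvg_comp _ _ (cvgN (expR_natmul_cvg0 n0 ts))).
    exact: continuous_expR.
  - move=> n s; have [s0|s0] := leP s 0; first by rewrite F0// mul0r !(mulr0, normr0).
    rewrite !normrM (ger0_norm (expR_ge0 _)).
    rewrite [leRHS](_ : _ = `|F s| * expR (n0%:R * (t - s))); last first.
      rewrite mulrBr expRD (_ : - (2 * (n0%:R / 2)) * s = - (n0%:R * s)); [ring|by field].
    rewrite ler_wpM2l//.
    have X0 := expR_ge0 (c n * (t - s)).
    rewrite ger0_norm ?subr_ge0 ?expR_le1 ?oppr_le0//.
    (* As 1 - e^{-X} is at most 1 and at most X, with X = e^{c(t-s)}, it is below e^{n0(t-s)} on
       either side of t. *)
    have [st|ts] := leP s t.
      apply: (@le_trans _ _ 1); first by rewrite lerBlDr lerDl expR_ge0.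
      by rewrite -expR0 ler_expR mulr_ge0// subr_ge0.
    apply: (@le_trans _ _ (expR (c n * (t - s)))).
      by have := expR_ge1Dx (- expR (c n * (t - s))); lra.
    by rewrite ler_expR ler_wnM2r ?subr_le0 ?(ltW ts)// ler_nat leq_addl.
  - apply/integrable_scale/integrable_norm; apply: Fi.
    by rewrite ler_pdivlMr// mulrC.
have bv : C * (expR (expR (c n * (t - b))) - 1) @[n --> \oo] --> 0.
  rewrite -[X in _ --> X](mulr0 C); apply: cvgM; first exact: cvg_cst.
  rewrite -[X in _ --> X](subrr 1); apply: cvgB; last exact: cvg_cst.
  have tb' : t - b < 0 by rewrite subr_lt0.
  rewrite -expR0; apply: (cvg_comp _ _ (expR_natmul_cvg0 n0 tb')).
  exact: continuous_expR.
apply/eqP; rewrite -normr_le0.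
have cn : `|\int[mu]_s (F s * (1 - expR (- expR (c n * (t - s)))))| @[n --> \oo] -->
    `|\int[mu]_s (F s * (s < t)%R%:R)| by exact: cvg_norm.
apply: (ler_cvg_to cn bv); apply: nearW => n.
exact: (@mikusinski_bound R F b C z0).
Qed.

Theorem laplace_unique (F : R -> R) (b C z0 : R) : measurable_fun setT F ->
  (forall s, s <= 0 -> F s = 0) -> 0 < z0 -> 0 <= C ->
  (forall z, z0 <= z ->
     mu.-integrable setT (EFin \o (fun s => expR (- (2 * z) * s) * F s))) ->
  (forall z, z0 <= z ->
     `|\int[mu]_s (expR (- (2 * z) * s) * F s)| <= C * expR (- (2 * z) * b)) ->
  {ae mu, forall s, s < b -> F s = 0}.
Proof.
move=> mF F0 z00 C0 Fi FC.
pose f s := F s * (s < b)%R%:R.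
have fi : mu.-integrable setT (EFin \o f).
  apply: (@integrable_leT _ _ _ mu _ (fun s => expR (2 * z0 * b) *
    `|expR (- (2 * z0) * s) * F s|)).
  - by rewrite /f; meas.
  - move=> s; rewrite /f normrM [X in _ * X]ger0_norm//.
    have [sb|sb] := ltP s b; last by rewrite mulr0 mulr_ge0// expR_ge0.
    rewrite mulr1 normrM mulrA ler_peMl// ger0_norm ?expR_ge0// -expRD.
    by rewrite -[leLHS]expR0 ler_expR mulNr -mulrBr mulr_ge0 ?mulr_ge0 ?subr_ge0// ltW.
  - exact/integrable_scale/integrable_norm/Fi.
have fiy y : mu.-integrable `]-oo, y] (EFin \o f) by exact: integrableS fi.
(* By Lebesgue differentiation F is a.e. the derivative of its primitive, and the primitive vanishes
   on (0,b) by [mikusinski_integral]. *)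
have := FTC1Ny fiy (open_integrable_locally openT fi).
apply: filterS; first exact: (ae_filter_ringOfSetsType mu).
move=> s [_ dG] sb; have [s0|s0] := leP s 0; first exact: F0.
suff : f s = 0 by rewrite /f sb mulr1.
rewrite -dG derive1E (@near_eq_derive _ _ _ _ (cst 0)) ?derive_cst//.
near=> x.
have xb : x < b by near: x; exact: lt_nbhsl.
have x0 : 0 <= x by apply: ltW; near: x; exact: lt_nbhsr.
rewrite /= -Rintegral_itv_bndo_bndc; last exact: integrableS fi.
rewrite -(@mikusinski_integral F b C z0 x)// ?x0//.
rewrite Rintegral_mkcond; apply: eq_Rintegral => y _.
rewrite patchE mem_setE in_itv/=; case: ltP => yx; rewrite ?mulr0//.
by rewrite /f (lt_trans yx xb).
Unshelve. all: by end_near.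
Qed.

End laplace_uniqueness.


(** * Absolutely continuous functions and integration by parts *)

Section absolute_continuity.
Context {R : realType}.
Notation mu := (@lebesgue_measure R).
Implicit Types (F f G g h : R -> R) (b t s : R).

Definition cutoff b f t := (0 < t < b)%R%:R * f t.

Lemma integrable_cutoff b f :
  mu.-integrable setT (EFin \o cutoff b f) <-> mu.-integrable `]0, b[ (EFin \o f).
Proof. exact: integrable_window. Qed.

Lemma Rintegral_cutoff b f : \int[mu]_t cutoff b f t = \int[mu]_(t in `]0, b[) f t.
Proof. exact: Rintegral_window. Qed.

Lemma cutoff_lt b f t s : t <= b -> cutoff b f s * (s < t)%R%:R = cutoff t f s.
Proof.
move=> tb; rewrite /cutoff; have [st|] := ltP s t; last by rewrite andbF mulr0 mul0r.
by rewrite (lt_le_trans st tb) mulr1.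
Qed.

Lemma integrable_measurable (h : R -> R) :
  mu.-integrable setT (EFin \o h) -> measurable_fun setT h.
Proof. by move=> ih; apply/measurable_EFinP; exact: measurable_int ih. Qed.

Lemma loc_abs_primitiveP F f b : loc_abs_primitive F f -> 0 < b ->
  mu.-integrable setT (EFin \o cutoff b f) /\
  forall t, 0 <= t <= b -> F t = F 0 + \int[mu]_s (cutoff b f s * (s < t)%R%:R).
Proof.
move=> Ff b0; have [fi _] := Ff b b0; split; first exact/integrable_cutoff.
move=> t /andP[t0 tb]; under eq_Rintegral do rewrite cutoff_lt//.
rewrite Rintegral_cutoff; move: t0; rewrite le_eqVlt => /predU1P[<-|t0].
  by rewrite set_itv_ge ?bnd_simp ?ltxx// Rintegral_set0 addr0.
by have [] := Ff t t0.
Qed.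

(** The representation controls F on [0, b] and says nothing for negative arguments; h is a
    measurable bounded substitute on the whole line. *)
Lemma loc_abs_primitive_bounded F f b : loc_abs_primitive F f -> 0 < b ->
  exists (h : R -> R) (c : R), [/\ measurable_fun setT h, forall t, `|h t| <= c &
    forall t, 0 <= t <= b -> F t = h t].
Proof.
move=> Ff b0; have [fi FE] := loc_abs_primitiveP Ff b0.
have mf := integrable_measurable fi.
exists (fun t => F 0 + \int[mu]_s (cutoff b f s * (s < t)%R%:R)).
exists (`|F 0| + \int[mu]_s `|cutoff b f s|); split => //.
- apply: measurable_funD => //.
  apply: (@measurable_Rintegral2 _ _ _ _ _ mu
    (fun x : R * R => cutoff b f x.2 * (x.2 < x.1)%R%:R)).
  by meas.
- move=> t; rewrite (le_trans (ler_normD _ _))// lerD2l.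
  apply: Rintegral_norm_le; [by meas| |exact: integrable_norm].
  by move=> s; rewrite normrM ler_piMr// ger0_norm// lern1; case: ltP.
Qed.

Lemma measurable_primitive h : measurable_fun setT h ->
  measurable_fun setT (fun t => \int[mu]_s (h s * (s < t)%R%:R)).
Proof.
move=> mh; apply: (@measurable_Rintegral2 _ _ _ _ _ mu
  (fun x : R * R => h x.2 * (x.2 < x.1)%R%:R)).
by meas.
Qed.

Lemma integrable_lt h t : mu.-integrable setT (EFin \o h) ->
  mu.-integrable setT (EFin \o (fun s => h s * (s < t)%R%:R)).
Proof.
move=> hi; have mh := integrable_measurable hi.
apply: (@integrable_leT _ _ _ mu _ (fun s => `|h s|)); [by meas| |exact: integrable_norm].
by move=> s; rewrite normrM ler_piMr// ger0_norm// lern1; case: ltP.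
Qed.

Lemma primitive_le h t : mu.-integrable setT (EFin \o h) ->
  `|\int[mu]_s (h s * (s < t)%R%:R)| <= \int[mu]_s `|h s|.
Proof.
move=> hi; have mh := integrable_measurable hi.
apply: Rintegral_norm_le; [by meas| |exact: integrable_norm].
by move=> s; rewrite normrM ler_piMr// ger0_norm// lern1; case: ltP.
Qed.

Lemma integrable_mul_primitive f g : mu.-integrable setT (EFin \o f) ->
  mu.-integrable setT (EFin \o g) ->
  mu.-integrable setT (EFin \o (fun t => f t * \int[mu]_s (g s * (s < t)%R%:R))).
Proof.
move=> fi gi; have mf := integrable_measurable fi; have mg := integrable_measurable gi.
have mI := measurable_primitive mg.
apply: (@integrable_leT _ _ _ mu _ (fun t => (\int[mu]_s `|g s|) * `|f t|)).
- by meas.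
- by move=> t; rewrite normrM mulrC ler_wpM2r// primitive_le.
- exact/integrable_scale/integrable_norm.
Qed.

(** Integration by parts: the plane is split into s < t and s > t, the diagonal being null, and
    Fubini exchanges the two halves. *)
Lemma primitive_product f g : mu.-integrable setT (EFin \o f) ->
  mu.-integrable setT (EFin \o g) ->
  \int[mu]_t (f t * \int[mu]_s (g s * (s < t)%R%:R)) +
  \int[mu]_t (g t * \int[mu]_s (f s * (s < t)%R%:R)) =
  (\int[mu]_t f t) * \int[mu]_t g t.
Proof.
move=> fi gi; have mf := integrable_measurable fi; have mg := integrable_measurable gi.
pose B (x : R * R) := f x.1 * (g x.2 * (x.1 < x.2)%R%:R).
have mB : measurable_fun setT B by rewrite /B; meas.
have Bi : (mu \x mu)%E.-integrable setT (EFin \o B).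
  apply: (@product_integrable12 _ _ _ _ _ mu mu B
    (fun t => (\int[mu]_s `|g s|) * `|f t|)) => //.
    have gn : mu.-integrable setT (EFin \o (fun s => `|g s|)) by exact: integrable_norm.
    move=> t; rewrite mulrC EFinM (Rintegral_EFin gn) -ge0_integral_scale//; last by meas.
    apply: le_integral_bound => //.
    - by rewrite /B /=; meas.
    - by meas.
    move=> s; rewrite /B !normrM ler_wpM2l// ler_piMr// ger0_norm// lern1.
    by case: ltP.
  exact/integrable_scale/integrable_norm.
have gt_i t : mu.-integrable setT (EFin \o (fun s => g s * (t < s)%R%:R)).
  apply: (@integrable_leT _ _ _ mu _ (fun s => `|g s|)); [by meas| |exact: integrable_norm].
  by move=> s; rewrite normrM ler_piMr// ger0_norm// lern1; case: ltP.
have -> : \int[mu]_t (g t * \int[mu]_s (f s * (s < t)%R%:R)) =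
    \int[mu]_t (f t * \int[mu]_s (g s * (t < s)%R%:R)).
  transitivity (\int[mu]_s \int[mu]_t B (t, s)).
    apply: eq_Rintegral => s _; rewrite -RintegralZl//; last exact: integrable_lt.
    by apply: eq_Rintegral => t _; rewrite /B /=; ring.
  rewrite -(@Rintegral_fubini _ _ _ _ _ mu mu B Bi).
  by apply: eq_Rintegral => t _; rewrite /B /= RintegralZl.
have cE t : \int[mu]_s (g s * (s < t)%R%:R) + \int[mu]_s (g s * (t < s)%R%:R) =
    \int[mu]_s g s.
  rewrite -RintegralD//; last exact: integrable_lt.
  rewrite /Rintegral; congr fine; apply: ae_eq_integral => //.
  - by apply/measurable_EFinP; meas.
  - exact/measurable_EFinP.
  have := ae_neq t; apply: filterS; first exact: (ae_filter_ringOfSetsType mu).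
  move=> s st _; congr EFin; case: ltgtP st => // _ _.
    by rewrite mulr1 mulr0 addr0.
  by rewrite mulr1 mulr0 add0r.
have fgt_i : mu.-integrable setT (EFin \o (fun t => f t * \int[mu]_s (g s * (t < s)%R%:R))).
  have := integrableB measurableT (integrable_scale (\int[mu]_s g s) fi)
    (integrable_mul_primitive fi gi).
  apply: eq_integrable; [by []|move=> t _ /=].
  by rewrite -EFinB -(cE t); congr EFin; ring.
rewrite -RintegralD//; last exact: integrable_mul_primitive.
rewrite -RintegralZr//; apply: eq_Rintegral => t _.
by rewrite -mulrDr cE.
Qed.

Lemma loc_abs_primitive_product F f G g b :
  loc_abs_primitive F f -> loc_abs_primitive G g -> 0 < b ->
  mu.-integrable setT (EFin \o cutoff b (fun t => f t * G t + F t * g t)) /\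
  \int[mu]_t cutoff b (fun t => f t * G t + F t * g t) t = F b * G b - F 0 * G 0.
Proof.
move=> Ff Gg b0.
have [fi FE] := loc_abs_primitiveP Ff b0.
have [gi GE] := loc_abs_primitiveP Gg b0.
have cE t : cutoff b (fun t => f t * G t + F t * g t) t =
    (G 0 * cutoff b f t + cutoff b f t * \int[mu]_s (cutoff b g s * (s < t)%R%:R)) +
    (F 0 * cutoff b g t + cutoff b g t * \int[mu]_s (cutoff b f s * (s < t)%R%:R)).
  have [/andP[t0 tb]|/negbTE tF] := boolP (0 < t < b).
    have cT h : cutoff b h t = h t by rewrite /cutoff t0 tb mul1r.
    by rewrite !cT (FE t) ?(ltW t0) ?(ltW tb)// (GE t) ?(ltW t0) ?(ltW tb)//; ring.
  have cF h : cutoff b h t = 0 by rewrite /cutoff tF mul0r.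
  by rewrite !cF; ring.
have i1 := integrable_scale (G 0) fi.
have i2 := integrable_mul_primitive fi gi.
have i3 := integrable_scale (F 0) gi.
have i4 := integrable_mul_primitive gi fi.
have i12 := integrableD measurableT i1 i2.
have i34 := integrableD measurableT i3 i4.
split.
  have := integrableD measurableT i12 i34.
  by apply: eq_integrable; [by []|move=> t _; rewrite /= cE !EFinD].
under eq_Rintegral do rewrite cE.
rewrite (RintegralD measurableT i12 i34) (RintegralD measurableT i1 i2).
rewrite (RintegralD measurableT i3 i4) !RintegralZl//.
have cutb h : \int[mu]_s (cutoff b h s * (s < b)%R%:R) = \int[mu]_s cutoff b h s.
  by under eq_Rintegral do rewrite cutoff_lt//.
have bb : 0 <= b <= b by rewrite lexx ltW.
rewrite (FE b bb) (GE b bb) !cutb.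
by rewrite addrACA primitive_product//; ring.
Qed.

End absolute_continuity.


(** * The Wronskian identity; uniform local bounds in A^1 *)

Section wronskian.
Context {R : realType}.
Notation mu := (@lebesgue_measure R).
Implicit Types (Q u v w : R -> R) (lambda a b t s z : R).

Lemma wronskian u u' u'' v v' v'' b :
  loc_abs_primitive u u' -> loc_abs_primitive u' u'' ->
  loc_abs_primitive v v' -> loc_abs_primitive v' v'' -> 0 < b ->
  mu.-integrable setT (EFin \o cutoff b (fun t => u'' t * v t - u t * v'' t)) /\
  \int[mu]_t cutoff b (fun t => u'' t * v t - u t * v'' t) t =
  u' b * v b - u b * v' b - (u' 0 * v 0 - u 0 * v' 0).
Proof.
move=> uu uu' vv vv' b0.
have [i1 E1] := loc_abs_primitive_product uu' vv b0.
have [i2 E2] := loc_abs_primitive_product uu vv' b0.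
have cE t : cutoff b (fun t => u'' t * v t - u t * v'' t) t =
    cutoff b (fun t => u'' t * v t + u' t * v' t) t -
    cutoff b (fun t => u' t * v' t + u t * v'' t) t.
  by rewrite /cutoff; ring.
split.
  have := integrableB measurableT i1 i2.
  by apply: eq_integrable; [by []|move=> t _; rewrite /= cE EFinB].
under eq_Rintegral do rewrite cE.
rewrite (RintegralB measurableT i1 i2) E1 E2; ring.
Qed.

Lemma smooth_loc_abs_primitive (phi phi' : R -> R) :
  (forall x : R, is_derive x 1 phi (phi' x)) -> continuous phi' ->
  loc_abs_primitive phi phi'.
Proof.
move=> dphi cphi b b0; split; first exact: continuous_integrable_oo.
by rewrite (FTC_oo dphi cphi (ltW b0)) addrC subrK.
Qed.

Lemma exp_loc_abs_primitive z c :
  loc_abs_primitive (fun t => c * expR (z * t)) (fun t => z * c * expR (z * t)).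
Proof.
apply: smooth_loc_abs_primitive => x.
  have := is_deriveZ c (is_derive_expRM z x).
  by move/is_derive_eq; apply; rewrite /GRing.scale/=; ring.
by apply: cvgM; [exact: cvg_cst|exact: continuous_expRM].
Qed.

Lemma inA1_measurable Q : inA1 Q ->
  measurable_fun setT (fun s => (0 < s)%R%:R * Q s).
Proof.
move=> [[mQ _ _] _].
have := (measurable_restrictT _ (measurable_itv `]0%R, +oo[)).1 mQ.
apply: eq_measurable_fun => s _.
by rewrite patchE mem_setE in_itv/= andbT indicator_patch.
Qed.

(* Monotone convergence x -> 0+ turns the windows ]x, x + 1[, x > 0, into ]0, 1[. *)
Lemma inA1_window Q : inA1 Q -> exists2 M : R, 0 < M &
  forall x, (\int[mu]_s ((0 < s)%R%:R * (x < s < x + 1)%R%:R * `|Q s|)%:E <= M%:E)%E.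
Proof.
move=> QA; have [[mQ _ _] Qsup] := QA.
have mq := inA1_measurable QA.
pose S := ereal_sup [set (\int[mu]_(t in `]x, (x + 1)%R[) `|Q t|%:E)%E | x in `]0%R, +oo[].
have mA x : measurable_fun setT (fun s => (0 < s)%R%:R * (x < s < x + 1)%R%:R * `|Q s|).
  rewrite (_ : (fun s => _) = (fun s => (x < s < x + 1)%R%:R * `|(0 < s)%R%:R * Q s|)).
    by meas.
  by apply/funext => s; rewrite normrM [X in _ = _ * (X * _)]ger0_norm//; ring.
have SE x : 0 < x ->
    (\int[mu]_s ((0 < s)%R%:R * (x < s < x + 1)%R%:R * `|Q s|)%:E <= S)%E.
  move=> x0; apply: ereal_sup_ubound; exists x; first by rewrite /= in_itv/= andbT.
  rewrite [LHS]integral_mkcond; apply: eq_integral => s _.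
  rewrite patchE mem_setE in_itv/=; case: ifPn => [/andP[xs _]|_]; last by rewrite mulr0 mul0r.
  by rewrite (lt_trans x0 xs)/= !mul1r.
have S0 : (0 <= S)%E.
  by apply: le_trans (SE 1 ltr01); apply: integral_ge0 => s _; rewrite lee_fin !mulr_ge0.
have Sfin : S \is a fin_num by rewrite ge0_fin_numE.
exists (fine S + 1); first by rewrite ltr_wpDl// fine_ge0.
have SM : (S <= (fine S + 1)%:E)%E by rewrite EFinD fineK// leeDl.
move=> x; apply: le_trans SM; have [x0|x0] := ltP 0 x; first exact: SE.
pose g n s := ((n.+1%:R^-1 < s < 1)%R%:R * `|(0 < s)%R%:R * Q s|)%:E.
have gm n : measurable_fun setT (g n) by apply/measurable_EFinP; meas.
have gS n : (\int[mu]_s g n s <= S)%E.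
  apply: le_trans (SE n.+1%:R^-1 _); last by rewrite invr_gt0.
  apply: le_integral_bound => //; [by meas|exact: mA|].
  move=> s; rewrite normrM [X in _ * (X * _)]ger0_norm// mulrCA mulrA.
  rewrite ler_wpM2r// ler_wpM2l// ler_nat.
  case: ltP => //= _; case: (ltP s 1) => //= s1.
  by rewrite (lt_le_trans s1)// lerDr.
have gl s : g n s @[n --> \oo] --> ((0 < s < 1)%R%:R * `|(0 < s)%R%:R * Q s|)%:E.
  apply: cvg_EFin; first exact: nearW.
  apply: cvgM; last exact: cvg_cst.
  apply: cvg_near_cst; have [s0|s0] := ltP 0 s; last first.
    by apply: nearW => n; rewrite ltNge (le_trans s0).
  near=> n; rewrite (_ : n.+1%:R^-1 < s)//; near: n.
  exact: near_infty_natSinv_lt (PosNum s0).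
apply: (@le_trans _ _ (\int[mu]_s limn (g ^~ s))%E).
  rewrite [leRHS](_ : _ = \int[mu]_s ((0 < s < 1)%R%:R * `|(0 < s)%R%:R * Q s|)%:E)%E; last first.
    by apply: eq_integral => s _; apply/cvg_lim.
  apply: le_integral_bound => //; [exact: mA|by meas|].
  move=> s; rewrite normrM [X in _ * (X * _)]ger0_norm//.
  rewrite mulrA ler_wpM2r// -!natrM ler_nat; case: ltP => //= _; rewrite mul1n muln1.
  case: (ltP x s) => //= _; case: (ltP s (x + 1)) => //= sx.
  by rewrite (lt_le_trans sx)// gerDr.
have g0 n s : setT s -> (0 <= g n s)%E by move=> _; rewrite lee_fin.
have gnd s : setT s -> {homo g ^~ s : n m / (n <= m)%N >-> (n <= m)%E}.
  move=> _ n m nm; rewrite lee_fin ler_wpM2r// ler_nat.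
  case: (ltP n.+1%:R^-1 s) => //= ns; case: (s < 1); rewrite ?andbF ?andbT//.
  by rewrite (le_lt_trans _ ns : m.+1%:R^-1 < s)// lef_pV2 ?posrE// ler_nat.
have cv : (\int[mu]_s g n s @[n --> \oo] --> \int[mu]_s limn (g ^~ s))%E.
  exact: cvg_monotone_convergence.
rewrite -(cvg_lim _ cv)//.
by apply: lime_le; [apply/cvg_ex; eexists; exact: cv|exact: nearW].
Unshelve. all: by end_near.
Qed.

End wronskian.


Section uniform_weight.
Context {R : realType}.
Notation mu := (@lebesgue_measure R).
Implicit Types (Q : R -> R) (t s x : R).

Lemma integral_expN_norm : (\int[mu]_x (expR (- `|x|))%:E <= 2%:E)%E.
Proof.
pose f x : \bar R := ((0 < x)%R%:R * expR (- 1 * x))%:E.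
have fE : (\int[mu]_x f x = 1)%E by rewrite /f integral_exp_halfline// invr1.
have mf : measurable_fun setT f by apply/measurable_EFinP; meas.
have f0 x : (0 <= f x)%E by rewrite lee_fin mulr_ge0 ?expR_ge0.
have mN : measurable_fun setT (fun x => f (- x)).
  by apply/measurable_EFinP; meas.
have fNE : (\int[mu]_x f (- x)%R = 1)%E.
  rewrite -fE.
  pose sh : _ -> measurableTypeR R := fun x : measurableTypeR R => - x.
  have msh : measurable_fun setT sh by exact: oppr_measurable.
  transitivity (\int[mu]_(x in sh @^-1` setT) (f \o sh) x)%E; first by [].
  rewrite -(ge0_integral_pushforward msh)//.
  by apply: eq_measure_integral => //= A mA _; exact: lebesgue_measureN.
rewrite [leLHS](_ : _ = \int[mu]_x (f x + f (- x)%R))%E; last first.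
  apply: ae_eq_integral => //.
  - by apply/measurable_EFinP; meas.
  - exact: emeasurable_funD.
  have := ae_neq (0 : R); apply: filterS; first exact: (ae_filter_ringOfSetsType mu).
  move=> x x0 _; rewrite /f -EFinD oppr_gt0 mulrNN mul1r; congr EFin.
  case: ltgtP x0 => // x0 _.
    by rewrite mul0r !mul1r addr0 gtr0_norm// mulN1r.
  by rewrite mul0r mul1r add0r ltr0_norm// opprK.
by rewrite ge0_integralD// fE fNE.
Qed.

(** Average over windows: each s lies in ]x, x + 1[ for a set of x of length 1, and there e^{-|t-s|}
    <= e e^{-|t-x|}. After exchanging the integrals, each window costs at most M by [inA1_window],
    and e^{-|t-x|} has integral at most 2. *)
Lemma inA1_weight Q : inA1 Q -> exists2 K : R, 0 < K &
  forall t, (\int[mu]_s ((0 < s)%R%:R * (expR (- `|t - s|) * `|Q s|))%:E <= K%:E)%E.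
Proof.
move=> QA; have [M M0 QM] := inA1_window QA.
have mq := inA1_measurable QA.
exists (expR 1 * (M * 2)); first by rewrite !mulr_gt0// expR_gt0.
move=> t.
pose q s := `|(0 < s)%R%:R * Q s|.
have qE s : (0 < s)%R%:R * `|Q s| = q s by rewrite /q normrM ger0_norm.
have mq' : measurable_fun setT q by rewrite /q; meas.
pose F (z : R * R) := expR (- `|t - z.2|) * (z.2 < z.1 < z.2 + 1)%R%:R * q z.1.
have mF : measurable_fun setT F by rewrite /F; meas.
have F0 z : (0 <= (F z)%:E)%E by rewrite lee_fin /F /q !mulr_ge0 ?expR_ge0.
have mF' : measurable_fun setT (fun z => (F z)%:E) by exact/measurable_EFinP.
have step s : (((0 < s)%R%:R * (expR (- `|t - s|) * `|Q s|))%:E <=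
    (expR 1)%:E * \int[mu]_x (F (s, x))%:E)%E.
  have -> : (0 < s)%R%:R * (expR (- `|t - s|) * `|Q s|) =
      expR 1 * (expR (- `|t - s|) * expR (- 1) * q s).
    have e1 : expR 1 * expR (- 1) = 1 :> R by rewrite -expRD subrr expR0.
    by rewrite -qE -[LHS]mul1r -{1}e1; ring.
  rewrite EFinM lee_wpmul2l ?lee_fin ?expR_ge0//.
  apply: (@le_trans _ _ (\int[mu]_x ((s - 1 < x < s)%R%:R * (expR (- `|t - s|) * expR (- 1) * q s))%:E)%E).
    rewrite [leRHS](_ : _ = (\int[mu]_x ((s - 1 < x < s)%R%:R * (expR (- `|t - s|) * expR (- 1) * q s)))%R%:E); last first.
      rewrite Rintegral_EFin//; apply/integrable_window/continuous_integrable_oo.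
      exact: cst_continuous.
    rewrite lee_fin Rintegral_window Rintegral_cst//.
    rewrite [X in _ <= _ * fine X](_ : _ = 1%:E) ?mulr1//.
    rewrite [LHS]lebesgue_measure_itv/= lte_fin ltrBlDr ltrDl ltr01 -EFinD.
    by congr EFin; ring.
  apply: le_integral_bound => //.
  - by meas.
  - by rewrite /F /=; meas.
  - by move=> x; rewrite !mulr_ge0 ?expR_ge0// /q.
  move=> x; rewrite /F /= ltrBlDr andbC.
  case: (boolP (_ && _)) => [/andP[xs sx]|_]; last by rewrite !(mul0r, mulr0).
  rewrite mul1r mulr1 ler_wpM2r// /q// -expRD ler_expR.
  have sx1 : `|s - x| <= 1 by rewrite ger0_norm ?subr_ge0 ?(ltW xs)//; lra.
  have := ler_distD s t x; lra.
apply: (@le_trans _ _ (\int[mu]_s ((expR 1)%:E * \int[mu]_x (F (s, x))%:E))%E).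
  apply: ge0_le_integral => //.
  - apply/measurable_EFinP; rewrite (_ : (fun s => _) = (fun s => expR (- `|t - s|) * q s)).
      by meas.
    by apply/funext => s; rewrite -qE; ring.
  apply: measurable_funeM.
  exact: (@measurable_fun_fubini_tonelli_F _ _ _ _ _ mu (fun z => (F z)%:E) mF' F0).
rewrite ge0_integralZl ?lee_fin ?expR_ge0//; last 2 first.
- exact: (@measurable_fun_fubini_tonelli_F _ _ _ _ _ mu (fun z => (F z)%:E) mF' F0).
- by move=> s _; apply: integral_ge0.
rewrite EFinM lee_wpmul2l ?lee_fin ?expR_ge0//.
rewrite (@fubini_tonelli _ _ _ _ _ mu mu (fun z => (F z)%:E) mF' F0).
apply: (@le_trans _ _ (\int[mu]_x (M * expR (- `|x + - t|))%:E)%E); last first.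
  rewrite ge0_integral_scale ?(ltW M0)//; last by meas.
  rewrite EFinM lee_wpmul2l ?lee_fin ?(ltW M0)//.
  rewrite (ge0_integral_shift (- t) (f := fun x => (expR (- `|x|))%:E)).
  - exact: integral_expN_norm.
  - by apply/measurable_EFinP; meas.
  - by move=> x; rewrite lee_fin expR_ge0.
apply: ge0_le_integral => //.
- by move=> x _; apply: integral_ge0.
- exact: (@measurable_fun_fubini_tonelli_G _ _ _ _ _ mu (fun z => (F z)%:E) mF' F0).
- by apply/measurable_EFinP; meas.
move=> x _; rewrite mulrC EFinM; apply: le_trans (lee_wpmul2l _ (QM x)); rewrite ?lee_fin ?expR_ge0//.
have mW : measurable_fun setT (fun s => (0 < s)%R%:R * (x < s < x + 1)%R%:R * `|Q s|).
  rewrite (_ : (fun s => _) = (fun s => (x < s < x + 1)%R%:R * q s)); first by meas.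
  by apply/funext => s; rewrite -qE; ring.
rewrite -ge0_integral_scale ?expR_ge0//.
apply: le_integral_bound => //.
- by rewrite /F /=; meas.
- by meas.
- by move=> s; rewrite -lee_fin.
- move=> s; rewrite /F /= -qE distrC le_eqVlt; apply/orP; left; apply/eqP.
  ring.
Qed.

End uniform_weight.


(** * The integral equation satisfied by a solution *)

Section L2_solutions.
Context {R : realType}.
Notation mu := (@lebesgue_measure R).
Implicit Types (Q u v w : R -> R) (lambda a b t s z T : R).

Lemma cutoff0 b (h : R -> R) : b <= 0 -> cutoff b h = fun=> 0.
Proof.
move=> b0; apply/funext => s; rewrite /cutoff; case: ltP => [s0|]; last by rewrite mul0r.
by rewrite ltNge (le_trans b0 (ltW s0)) mul0r.
Qed.

Lemma measurable_cutoff_solution Q v v' b : inA1 Q -> loc_abs_primitive v v' ->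
  measurable_fun setT (cutoff b v) /\ measurable_fun setT (cutoff b (fun s => Q s * v s)).
Proof.
move=> QA vv; have mq := inA1_measurable QA.
have [b0|b0] := ltP 0 b; last by rewrite !cutoff0.
have [h [c [mh _ vh]]] := loc_abs_primitive_bounded vv b0.
have cutE (k : R -> R) s : cutoff b (fun s => k s * v s) s = (0 < s < b)%R%:R * (k s * h s).
  rewrite /cutoff; case: (boolP (_ && _)) => [/andP[s0 sb]|_]; last by rewrite !mul0r.
  by rewrite vh// !ltW.
split.
  rewrite (_ : cutoff b v = fun s => (0 < s < b)%R%:R * h s); first by meas.
  apply/funext => s; have := cutE (cst 1) s; rewrite /cutoff /= !mul1r => <-.
  by [].
rewrite (_ : cutoff b _ = fun s => (0 < s < b)%R%:R * (((0 < s)%R%:R * Q s) * h s)).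
  by meas.
apply/funext => s; rewrite cutE; case: (boolP (_ && _)) => [/andP[s0 sb]|_].
  by rewrite s0 !mul1r.
by rewrite !mul0r.
Qed.

(** Replaces the second derivative, known only almost everywhere, by the explicit expression (Q -
    lambda) v, so that later identities hold pointwise under the integral. *)
Lemma L2_solution_primitive Q lambda v v' : inA1 Q -> L2_solution Q lambda v v' ->
  loc_abs_primitive v v' /\ loc_abs_primitive v' (fun x => (Q x - lambda) * v x).
Proof.
move=> QA [[v'' [vv v'v'' vae]] _ _]; split => // b b0.
have [v''i v'E] := v'v'' b b0.
have [mv mQv] := measurable_cutoff_solution b QA vv.
have cE s : cutoff b (fun x => (Q x - lambda) * v x) s =
    cutoff b (fun s => Q s * v s) s - lambda * cutoff b v s.
  by rewrite /cutoff; ring.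
have mc : measurable_fun setT (cutoff b (fun x => (Q x - lambda) * v x)).
  rewrite (_ : cutoff _ _ = fun s => cutoff b (fun s => Q s * v s) s - lambda * cutoff b v s).
    by meas.
  by apply/funext.
have v''i' := (integrable_cutoff b v'').2 v''i.
have mv'' := integrable_measurable v''i'.
have ae_c : {ae mu, forall s, cutoff b v'' s = cutoff b (fun x => (Q x - lambda) * v x) s}.
  move: vae; apply: filterS; first exact: (ae_filter_ringOfSetsType mu).
  move=> s vs; rewrite /cutoff; case: (boolP (_ && _)) => [/andP[s0 sb]|_].
    by have := vs s0; rewrite !mul1r; lra.
  by rewrite !mul0r.
split.
  apply/integrable_cutoff/integrableP; split; first exact/measurable_EFinP.
  have /integrableP[_] := v''i'; apply: le_lt_trans.
  apply: ae_ge0_le_integral => //.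
  - by apply/measurableT_comp => //; exact/measurable_EFinP.
  - by apply/measurableT_comp => //; exact/measurable_EFinP.
  move: ae_c; apply: filterS; first exact: (ae_filter_ringOfSetsType mu).
  by move=> s /= -> _.
rewrite v'E; congr (_ + _); rewrite -!Rintegral_cutoff /Rintegral; congr fine.
apply: ae_eq_integral => //; [exact/measurable_EFinP|exact/measurable_EFinP|].
move: ae_c; apply: filterS; first exact: (ae_filter_ringOfSetsType mu).
by move=> s /= -> _.
Qed.

(** The Wronskian identity for v against e^{cs}, which solves the free equation at the same energy;
    it is used with c = z and c = -z. *)
Lemma exp_wronskian Q c v v' b : inA1 Q -> L2_solution Q (- c ^+ 2) v v' -> 0 <= b ->
  mu.-integrable setT (EFin \o cutoff b (fun s => Q s * v s * expR (c * s))) /\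
  \int[mu]_s cutoff b (fun s => Q s * v s * expR (c * s)) s =
  expR (c * b) * (v' b - c * v b) - (v' 0 - c).
Proof.
move=> QA vs; have [vv v'v''] := L2_solution_primitive QA vs.
have [_ v0 _] := vs.
rewrite le_eqVlt => /predU1P[<-|b0].
  rewrite cutoff0//; split.
    by apply: eq_integrable (integrable0 mu setT).
  by rewrite Rintegral_cst// mul0r mulr0 expR0 mul1r v0 mulr1 subrr.
have e1 := @exp_loc_abs_primitive R c 1.
have e2 := @exp_loc_abs_primitive R c (c * 1).
have [i E] := wronskian vv v'v'' e1 e2 b0.
have cE s : cutoff b (fun s => Q s * v s * expR (c * s)) s =
  cutoff b (fun t => (Q t - - c ^+ 2) * v t * (1 * expR (c * t)) -
     v t * (c * (c * 1) * expR (c * t))) s.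
  by rewrite /cutoff; ring.
split.
  by apply: eq_integrable i; [by []|move=> s _; rewrite /= cE].
under eq_Rintegral do rewrite cE.
by rewrite E v0 mulr0 expR0; ring.
Qed.

(** Variation of constants for f = e^{zt} v: three instances of [exp_wronskian], on [0,t] with both
    signs of z and on [0,T] with -z, eliminate v'(0) and v'(t). The coefficient of e^{2zt} - 1
    measures the growing mode of v at T. *)
Lemma solution_hker Q z v v' t T : inA1 Q -> L2_solution Q (- z ^+ 2) v v' ->
  0 < z -> 0 <= t <= T -> 0 < T ->
  mu.-integrable setT
    (EFin \o cutoff T (fun s => Q s * hker z t s * (expR (z * s) * v s))) /\
  expR (z * t) * v t =
  1 + expR (- z * T) * (v' T + z * v T) / (2 * z) * (expR (2 * z * t) - 1) -
  \int[mu]_s cutoff T (fun s => Q s * hker z t s * (expR (z * s) * v s)) s.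
Proof.
move=> QA vs z0 /andP[t0 tT] T0.
have vsN : L2_solution Q (- (- z) ^+ 2) v v' by rewrite sqrrN.
have [ip Ep] := exp_wronskian QA vs t0.
have [im Em] := exp_wronskian QA vsN t0.
have [iT ET] := exp_wronskian QA vsN (ltW T0).
pose X := expR (z * t).
have XE : expR (2 * z * t) = X * X by rewrite /X -expRD; congr expR; ring.
have XN : expR (- z * t) = X^-1 by rewrite /X -expRN mulNr.
have X0 : X != 0 by rewrite gt_eqF// expR_gt0.
(* The delay is 0 for s < t and s - t for s >= t; on each side [hker] e^{zs} is a combination of
   e^{zs} and e^{-zs}. *)
have cE s : cutoff T (fun s => Q s * hker z t s * (expR (z * s) * v s)) s =
  (2 * z)^-1 * (cutoff t (fun s => Q s * v s * expR (z * s)) s +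
    ((X * X - 1) * cutoff T (fun s => Q s * v s * expR (- z * s)) s
    + (- (X * X)) * cutoff t (fun s => Q s * v s * expR (- z * s)) s)).
  pose Y := expR (z * s).
  have YN : expR (- z * s) = Y^-1 by rewrite /Y -expRN mulNr.
  have YE : expR (- (2 * z) * s) = Y^-1 * Y^-1 by rewrite -YN -expRD; congr expR; ring.
  have Y0 : Y != 0 by rewrite gt_eqF// expR_gt0.
  rewrite /cutoff YN -/Y /hker YE /delay.
  case: ltP => [s0|_] /=; last by rewrite !mul0r; ring.
  have [st|ts] := ltP s t.
    rewrite (lt_le_trans st tT) (_ : Num.max (s - t) 0 = 0); last first.
      by apply/max_idPr; rewrite subr_le0 ltW.
    by rewrite mulr0 expR0; field; rewrite Y0 (gt_eqF z0).
  rewrite (_ : Num.max (s - t) 0 = s - t); last by apply/max_idPl; rewrite subr_ge0.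
  rewrite (_ : expR (- (2 * z) * (s - t)) = Y^-1 * Y^-1 * (X * X)); last first.
    by rewrite -YE -XE -expRD; congr expR; ring.
  by case: (s < T); rewrite ?mul0r; field; rewrite ?Y0 (gt_eqF z0).
have i1 := integrable_scale (X * X - 1) iT.
have i2 := integrable_scale (- (X * X)) im.
have i12 := integrableD measurableT i1 i2.
have i3 := integrableD measurableT ip i12.
split.
  have := integrable_scale (2 * z)^-1 i3.
  by apply: eq_integrable; [by []|move=> s _; rewrite /= cE].
under eq_Rintegral do rewrite cE.
rewrite RintegralZl// (RintegralD measurableT ip i12) (RintegralD measurableT i1 i2).
rewrite !RintegralZl// Ep Em ET -/X XE XN.
by field; rewrite ?X0 (gt_eqF z0).
Qed.

End L2_solutions.


(** * A priori bounds and decay of square integrable solutions *)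

Section a_priori_bound.
Context {R : realType}.
Notation mu := (@lebesgue_measure R).
Implicit Types (Q v g W : R -> R) (K a b c t s z T A S : R).

(** Exponentials e^{cs} with rate in [1, 2z - 1] are admissible weights: [hker] is flat in s up to t
    and falls off like e^{-2z(s-t)} afterwards, so a margin of 1 at each end of the range of c
    leaves the factor e^{-|t-s|} against which |Q| has a bounded integral. *)
Lemma hker_exp z c t s : 0 < z -> 1 <= c -> c <= 2 * z - 1 -> 0 <= t -> 0 <= s ->
  hker z t s * expR (c * s) <= (2 * z)^-1 * (expR (- `|t - s|) * expR (c * t)).
Proof.
move=> z0 c1 cz t0 s0.
have z20 : 0 < 2 * z by rewrite mulr_gt0.
rewrite /hker mulrAC ler_pdivrMr// mulrC [leRHS]mulrAC mulVf ?gt_eqF// mul1r.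
apply: (@le_trans _ _ (expR (c * s) * expR (- (2 * z) * delay t s))).
  by rewrite ler_wpM2l ?expR_ge0// gerBl expR_ge0.
rewrite -!expRD ler_expR /delay.
have [st|ts] := leP s t.
  rewrite (_ : Num.max (s - t) 0 = 0); last by apply/max_idPr; rewrite subr_le0.
  by rewrite ger0_norm ?subr_ge0//; nra.
rewrite (_ : Num.max (s - t) 0 = s - t); last by apply/max_idPl; rewrite subr_ge0 ltW.
by rewrite ler0_norm ?subr_le0 ?(ltW ts)//; nra.
Qed.

Definition exp_mean_le Q K :=
  forall t, (\int[mu]_s ((0 < s)%R%:R * (expR (- `|t - s|) * `|Q s|))%:E <= K%:E)%E.

(** On the space with weight [W] the operator with kernel Q [hker] has norm at most K/(2z), small
    for large z. *)
Lemma hker_integral_le Q K z T W g S t :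
  measurable_fun setT (fun s => (0 < s)%R%:R * Q s) -> exp_mean_le Q K ->
  0 < z -> 0 <= t -> 0 <= S -> 0 <= W t ->
  (forall s, 0 <= s -> hker z t s * W s <= (2 * z)^-1 * (expR (- `|t - s|) * W t)) ->
  measurable_fun setT (cutoff T (fun s => Q s * hker z t s * g s)) ->
  (forall s, 0 < s < T -> `|g s| <= S * W s) ->
  `|\int[mu]_s cutoff T (fun s => Q s * hker z t s * g s) s| <= K / (2 * z) * S * W t.
Proof.
move=> mQ QK z0 t0 S0 W0 hW mg gS.
have z20 : 0 < (2 * z)^-1 by rewrite invr_gt0 mulr_gt0.
apply: Rintegral_norm_bound => //.
pose k s := (2 * z)^-1 * S * W t * ((0 < s)%R%:R * (expR (- `|t - s|) * `|Q s|)).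
have m1 : measurable_fun setT (fun s => (0 < s)%R%:R * (expR (- `|t - s|) * `|Q s|)).
  rewrite (_ : (fun s => _) = (fun s => expR (- `|t - s|) * `|(0 < s)%R%:R * Q s|)).
    by meas.
  by apply/funext => s; rewrite normrM ger0_norm//; ring.
apply: (@le_trans _ _ (\int[mu]_s (k s)%:E)%E).
  apply: le_integral_bound => //.
  - by apply: measurableT_comp.
  - by rewrite /k; meas.
  move=> s; rewrite /cutoff /k; case: (ltP 0 s) => [s0|_] /=; last first.
    by rewrite !mul0r normr0 mulr0.
  case: ltP => [sT|_]; last by rewrite mul0r normr0 !mulr_ge0 ?(ltW z20) ?expR_ge0.
  rewrite !mul1r 2!normrM (ger0_norm (hker_ge0 z0 t0 (ltW s0))).
  have g1 : `|g s| <= S * W s by apply: gS; rewrite s0.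
  have := hW s (ltW s0) => h1.
  apply: (@le_trans _ _ (`|Q s| * (hker z t s * (S * W s)))).
    by rewrite -mulrA ler_wpM2l// ler_wpM2l// hker_ge0// ltW.
  rewrite [leRHS](_ : _ = `|Q s| * (S * ((2 * z)^-1 * (expR (- `|t - s|) * W t)))); last by ring.
  rewrite ler_wpM2l// [leLHS](_ : _ = S * (hker z t s * W s)); last by ring.
  by rewrite ler_wpM2l.
rewrite /k ge0_integral_scale; [|by rewrite !mulr_ge0 ?(ltW z20)|exact: m1|
  by move=> s; rewrite !mulr_ge0 ?expR_ge0].
rewrite [leRHS](_ : _ = ((2 * z)^-1 * S * W t)%:E * K%:E)%E.
  by rewrite lee_wpmul2l// lee_fin !mulr_ge0 ?(ltW z20).
by rewrite -EFinM; congr EFin; ring.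
Qed.

(** Apply the improvement to the best constant S = sup |g|/W, finite by the a priori bound [S0]:
    from S <= A + S/2 follows S <= 2A, whatever [S0] was. *)
Lemma bootstrap (I : Type) (D : I -> Prop) (g W : I -> R) A S0 i :
  (forall j, D j -> 0 < W j) -> (forall j, D j -> `|g j| <= S0 * W j) ->
  (forall S, 0 <= S -> (forall j, D j -> `|g j| <= S * W j) ->
     forall j, D j -> `|g j| <= (A + S / 2) * W j) ->
  D i -> `|g i| <= 2 * A * W i.
Proof.
move=> W0 gS0 step Di.
pose E := [set `|g j| / W j | j in D].
have Eub : has_ubound E.
  by exists S0 => _ [j Dj <-]; rewrite ler_pdivrMr ?W0//; exact: gS0.
have En0 : E !=set0 by exists (`|g i| / W i), i.
pose S := sup E.
have gS j : D j -> `|g j| <= S * W j.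
  by move=> Dj; rewrite -ler_pdivrMr ?W0//; apply: sup_upper_bound => //; exists j.
have S_ge0 : 0 <= S.
  apply: (@le_trans _ _ (`|g i| / W i)); last by apply: sup_upper_bound => //; exists i.
  by rewrite divr_ge0// ltW// W0.
have SA : S <= A + S / 2.
  apply: ge_sup => // _ [j Dj <-].
  by rewrite ler_pdivrMr ?W0//; exact: step.
apply: le_trans (gS _ Di) _; rewrite ler_wpM2r ?(ltW (W0 _ Di))//.
by move: SA; lra.
Qed.

End a_priori_bound.


Section solution_bounds.
Context {R : realType}.
Notation mu := (@lebesgue_measure R).
Variables (Q v v' : R -> R) (z K : R).
Hypotheses (QA : inA1 Q) (QK : exp_mean_le Q K).
Hypotheses (vs : L2_solution Q (- z ^+ 2) v v') (z2 : 2 <= z) (Kz : 2 * K <= z).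
Implicit Types (t s T c : R).

Let z0 : 0 < z. Proof. by rewrite (lt_le_trans _ z2). Qed.

Let vv : loc_abs_primitive v v'. Proof. by have [] := L2_solution_primitive QA vs. Qed.

Lemma measurable_solution : measurable_fun setT (fun s => (0 < s)%R%:R * v s).
Proof.
apply: (@measurable_fun_cvg _ _ _ setT (fun n => cutoff n.+1%:R v)) => //.
  by move=> n; have [] := measurable_cutoff_solution n.+1%:R QA vv.
move=> s _; rewrite /cutoff; apply: cvgM; last exact: cvg_cst.
apply: cvg_near_cst; near=> n; rewrite (_ : s < n.+1%:R) ?andbT//.
near: n; exists (Num.truncn s).+1 => // n /= sn.
rewrite (lt_le_trans (truncnS_gt s))// ler_nat.
by rewrite (leq_trans sn).
Unshelve. all: by end_near.
Qed.

(** Transports a bound on the growing mode from the end point T back to t. *)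
Lemma expR_end c t T : 0 <= c <= 2 * z -> 0 <= t <= T ->
  (expR (2 * z * t) - 1) * expR (c * T) <= (expR (2 * z * T) - 1) * expR (c * t).
Proof.
move=> /andP[c0 cz] /andP[t0 tT].
rewrite !mulrBl !mul1r -!expRD lerB// ler_expR; nra.
Qed.

Lemma measurable_solution_hker t T : 0 <= t -> measurable_fun setT
  (cutoff T (fun s => Q s * hker z t s * (expR (z * s) * v s))).
Proof.
move=> t0; have [_ m] := measurable_cutoff_solution T QA vv.
have mh := measurable_hker z t.
rewrite (_ : cutoff _ _ = fun s => cutoff T (fun s => Q s * v s) s * (hker z t s * expR (z * s))).
  by meas.
by apply/funext => s; rewrite /cutoff; move: (hker z t s) => h; ring.
Qed.

(** The coefficient [kap] is eliminated by the integral equation at t = T, where f(T) is controlled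
    by |v(T)|. Since K/(2z) <= 1/4, the three terms of the equation are bounded by W, (1 + S/4) W
    and S/4 W, whence [bootstrap] with A = 2. *)
Lemma solution_bound_end t T : 0 < T -> 0 <= t <= T -> `|expR (z * t) * v t| <=
  4 * (expR t + `|v T| * expR (- (z - 1) * T) * expR ((2 * z - 1) * t)).
Proof.
move=> T0 tT.
pose f s := expR (z * s) * v s.
(* The two extreme rates allowed by [hker_exp]; the second term is normalised to equal |e^{zT} v(T)|
   at s = T. *)
pose W s := expR (1 * s) + `|v T| * expR (- (z - 1) * T) * expR ((2 * z - 1) * s).
have W0 s : 0 < W s by rewrite ltr_pwDl ?expR_gt0// !mulr_ge0// expR_ge0.
have zz : 0 < 2 * z by rewrite mulr_gt0.
have hW s r : 0 <= s -> 0 <= r -> hker z s r * W r <= (2 * z)^-1 * (expR (- `|s - r|) * W s).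
  move=> s0 r0; rewrite /W !mulrDr lerD//.
    by apply: hker_exp => //; move: z2; lra.
  rewrite mulrCA [leRHS](_ : _ = `|v T| * expR (- (z - 1) * T) *
    ((2 * z)^-1 * (expR (- `|s - r|) * expR ((2 * z - 1) * s)))); last by ring.
  rewrite ler_wpM2l ?mulr_ge0 ?expR_ge0//.
  by apply: hker_exp => //; move: z2; lra.
have WE s : 0 <= s <= T -> (expR (2 * z * s) - 1) * W T <= (expR (2 * z * T) - 1) * W s.
  move=> sT; rewrite /W !mulrDr lerD//.
    by apply: expR_end => //; apply/andP; split; move: z2; lra.
  rewrite mulrCA [leRHS]mulrCA ler_wpM2l ?mulr_ge0 ?expR_ge0//.
  by apply: expR_end => //; apply/andP; split; move: z2; lra.
have WT : `|f T| + 1 <= W T.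
  have -> : `|f T| = `|v T| * expR (- (z - 1) * T) * expR ((2 * z - 1) * T).
    by rewrite normrM ger0_norm ?expR_ge0// -mulrA -expRD mulrC; congr (_ * expR _); ring.
  by rewrite addrC lerD2r mul1r -expR0 ler_expR ltW.
have W1 s : 0 <= s -> 1 <= W s.
  move=> s0; rewrite /W mul1r -[leLHS]addr0 lerD//.
  by rewrite -expR0 ler_expR.
have [S0 fS0] : exists S0, forall s, 0 <= s <= T -> `|f s| <= S0 * W s.
  have [h [c [_ hc vh]]] := loc_abs_primitive_bounded vv T0.
  exists (expR (z * T) * c) => s sT; rewrite /f normrM ger0_norm ?expR_ge0//.
  have c0 : 0 <= c by apply: le_trans (hc 0).
  rewrite -[leLHS]mulr1; apply: ler_pM => //; [|
    by apply: W1; case/andP: sT].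
  apply: ler_pM; rewrite ?expR_ge0//; last by rewrite vh.
  by rewrite ler_expR ler_pM2l//; case/andP: sT.
suff : `|f t| <= 2 * 2 * W t by rewrite /W mul1r -natrM.
apply: (@bootstrap _ _ (fun s => 0 <= s <= T) f W 2 S0) => // S S_ge0 fS s sT.
pose J r := \int[mu]_s cutoff T (fun s => Q s * hker z r s * (expR (z * s) * v s)) s.
pose kap := expR (- z * T) * (v' T + z * v T) / (2 * z).
have eqE r (rT : 0 <= r <= T) : f r = 1 + kap * (expR (2 * z * r) - 1) - J r.
  exact: (solution_hker QA vs z0 rT T0).2.
have IS r : 0 <= r <= T -> `|J r| <= S / 4 * W r.
  move=> /andP[r0 rT]; apply: (@le_trans _ _ (K / (2 * z) * S * W r)).
    apply: hker_integral_le => //; [exact: inA1_measurable|exact: ltW|by move=> ? ?; exact: hW| |].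
      exact: measurable_solution_hker.
    by move=> q /andP[q0 qT]; apply: fS; rewrite !ltW.
  rewrite ler_wpM2r ?(ltW (W0 _))// mulrC ler_wpM2l// ler_pdivrMr//.
  by move: Kz; lra.
have TT : 0 <= T <= T by rewrite lexx ltW.
have := eqE s sT; have := eqE T TT; have := IS s sT; have := IS T TT.
move: (J T) (J s) => IT Is hT hs fTE fsE.
have ET0 : 0 < expR (2 * z * T) - 1.
  by rewrite subr_gt0 expR_gt1 mulr_gt0.
have Es0 : 0 <= expR (2 * z * s) - 1.
  by rewrite subr_ge0 -[leLHS]expR0 ler_expR; case/andP: sT => s0 _; exact: mulr_ge0 (ltW zz) s0.
have kT : `|kap| * (expR (2 * z * T) - 1) <= (1 + S / 4) * W T.
  rewrite -[X in _ * X](ger0_norm (ltW ET0)) -normrM.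
  rewrite [X in `|X|](_ : _ = f T - 1 + IT); last by rewrite fTE; ring.
  rewrite (le_trans (ler_normD _ _))// mulrDl mul1r lerD//.
  by rewrite (le_trans (ler_normB _ _))// normr1.
have ks : `|kap| * (expR (2 * z * s) - 1) <= (1 + S / 4) * W s.
  rewrite -(ler_pM2r ET0) mulrAC.
  apply: (@le_trans _ _ ((1 + S / 4) * W T * (expR (2 * z * s) - 1))).
    by rewrite ler_wpM2r.
  rewrite -[leLHS]mulrA -[leRHS]mulrA; apply: ler_wpM2l; first by rewrite addr_ge0// divr_ge0.
  by rewrite mulrC [leRHS]mulrC; exact: WE.
rewrite fsE (le_trans (ler_normB _ _))// [leRHS](_ : _ = W s + (1 + S / 4) * W s + S / 4 * W s); last by field.
rewrite lerD// (le_trans (ler_normD _ _))// lerD//.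
  by rewrite normr1 W1//; case/andP: sT.
by rewrite normrM (ger0_norm Es0).
Qed.

End solution_bounds.


Section solution_decay.
Context {R : realType}.
Notation mu := (@lebesgue_measure R).
Variables (Q v v' : R -> R) (z K : R).
Hypotheses (QA : inA1 Q) (QK : exp_mean_le Q K).
Hypotheses (vs : L2_solution Q (- z ^+ 2) v v') (z2 : 2 <= z) (Kz : 2 * K <= z).
Implicit Types (t s T a : R).

Let z0 : 0 < z. Proof. by rewrite (lt_le_trans _ z2). Qed.

(** Otherwise v^2 >= 1 on a half-line, against square integrability. *)
Lemma solution_small T : 0 <= T -> exists2 T', T < T' & `|v T'| <= 1.
Proof.
move=> T0; apply: contrapT => H.
have v1 s : T < s -> 1 <= v s ^+ 2.
  move=> Ts; rewrite -real_normK ?num_real// exprn_ege1//.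
  by rewrite leNgt; apply/negP => vs1; apply: H; exists s => //; exact: ltW.
have [_ _ vfin] := vs.
pose I := (\int[mu]_(x in `]0%R, +oo[) (v x ^+ 2)%:E)%E.
have mv := measurable_solution QA vs.
have IE : I = (\int[mu]_x (((0 < x)%R%:R * v x) ^+ 2)%:E)%E.
  rewrite [LHS]integral_mkcond; apply: eq_integral => x _.
  rewrite patchE mem_setE in_itv/= andbT; case: ifP => _; first by rewrite mul1r.
  by rewrite mul0r expr0n.
have I0 : (0 <= I)%E by apply: integral_ge0 => x _; rewrite lee_fin sqr_ge0.
have Ifin : I \is a fin_num by rewrite ge0_fin_numE.
have IN c : 0 <= c -> c <= fine I.
  move=> c0; rewrite -lee_fin fineK// IE.
  rewrite (_ : c%:E = (\int[mu]_x ((T < x < T + c)%R%:R * 1)%:E)%E).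
    apply: le_integral_bound; [by meas|exact: measurable_funX|by move=> x; rewrite mulr1|].
    move=> x; case: ltP => [Tx|_] /=; last by rewrite mul0r sqr_ge0.
    rewrite (le_lt_trans T0 Tx) mulr1 mul1r.
    by apply: le_trans (v1 _ Tx); case: (x < T + c).
  rewrite -(Rintegral_EFin); last first.
    by apply/integrable_window/continuous_integrable_oo; exact: cst_continuous.
  rewrite Rintegral_window Rintegral_cst// mul1r.
  rewrite [X in fine X](_ : _ = c%:E)//.
  rewrite [LHS]lebesgue_measure_itv/= lte_fin ltrDl; case: ltP => [c0'|c0'].
    by rewrite -EFinD; congr EFin; ring.
  by congr EFin; apply/eqP; rewrite eq_le c0 c0'.
have := IN (fine I + 1); rewrite addr_ge0 ?fine_ge0// => /(_ isT).
by rewrite leNgt ltrDl ltr01.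
Qed.

(** In [solution_bound_end] let T go to infinity along points where |v(T)| <= 1: the second term of
    the bound disappears. *)
Lemma solution_bound t : 0 <= t -> `|expR (z * t) * v t| <= 4 * expR t.
Proof.
move=> t0; apply/ler_addgt0Pr => e e0.
pose c := 4 * expR ((2 * z - 1) * t).
have c0 : 0 < c by rewrite mulr_gt0 ?expR_gt0.
(* T > c/e suffices, since e^{-(z-1)T} <= e^{-T} <= 1/T. *)
have [T] := @solution_small (t + c / e) (addr_ge0 t0 (divr_ge0 (ltW c0) (ltW e0))).
move=> tT vT1.
have tT' : t < T by apply: le_lt_trans tT; rewrite lerDl divr_ge0// ltW.
have cT : c / e < T by apply: le_lt_trans tT; rewrite lerDr.
have T0 : 0 < T by apply: le_lt_trans t0 tT'.
apply: le_trans (@solution_bound_end _ _ _ _ _ _ QA QK vs z2 Kz t T T0 _) _.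
  by rewrite t0 ltW.
rewrite mulrDr lerD2l [leLHS](_ : _ = `|v T| * (expR (- (z - 1) * T) * c)); last by rewrite /c; ring.
apply: (@le_trans _ _ (1 * (T^-1 * c))).
  apply: ler_pM => //; first by rewrite mulr_ge0 ?expR_ge0 ?(ltW c0).
  rewrite ler_wpM2r ?(ltW c0)//.
  apply: (@le_trans _ _ (expR (- T))); first by rewrite ler_expR; move: z2 T0; nra.
  by rewrite expRN lef_pV2 ?posrE ?expR_gt0//; apply: le_trans (expR_ge1Dx T); lra.
by rewrite mul1r mulrC ler_pdivrMr// mulrC -ler_pdivrMr// ltW.
Qed.

(** The integral equation on [0,a] at t = a gives |[kap]| (e^{2za} - 1) <= (4 + 1 + 1) e^a, and 1 <=
    za gives e^{2za} - 1 >= e^{2za}/2, hence 12. Then v'(a) = 2z e^{za} [kap] - z v(a), hence 28 =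
    24 + 4. *)
Lemma solution_end a : 0 < a -> 1 <= z * a ->
  [/\ `|expR (- z * a) * (v' a + z * v a) / (2 * z)| <= 12 * expR a * expR (- (2 * z) * a),
      `|v a| <= 4 * expR a * expR (- z * a) &
      `|v' a| <= 28 * z * expR a * expR (- z * a)].
Proof.
move=> a0 za1.
have aa : 0 <= a <= a by rewrite lexx ltW.
have [_ E] := solution_hker QA vs z0 aa a0.
have fa := solution_bound (ltW a0).
have X0 := expR_gt0 (z * a).
have XN : expR (- z * a) = (expR (z * a))^-1 by rewrite mulNr expRN.
have XX : expR (2 * z * a) = expR (z * a) ^+ 2 by rewrite expr2 -expRD; congr expR; ring.
have XXN : expR (- (2 * z) * a) = (expR (z * a) ^+ 2)^-1 by rewrite -XX mulNr expRN.
have ea1 : 1 <= expR a by rewrite -[leLHS]expR0 ler_expR ltW.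
have va : `|v a| <= 4 * expR a * expR (- z * a).
  by rewrite XN ler_pdivlMr// mulrC -[X in X * _]gtr0_norm// -normrM.
set kap := _ / (2 * z) in E *.
have J : `|\int[mu]_s cutoff a (fun s => Q s * hker z a s * (expR (z * s) * v s)) s|
    <= expR a.
  apply: (@le_trans _ _ (K / (2 * z) * 4 * expR (1 * a))).
    apply: (@hker_integral_le _ Q K z a (fun s => expR (1 * s))) => //.
    - exact: inA1_measurable.
    - exact: ltW.
    - by move=> s s0; apply: hker_exp => //; [move: z2; lra|exact: ltW].
    - by apply: (measurable_solution_hker QA vs); exact: ltW.
    - by move=> s /andP[s0 _]; rewrite mul1r; apply: solution_bound; exact: ltW.
  rewrite mul1r ler_piMl ?expR_ge0// -ler_pdivlMr// ler_pdivrMr ?mulr_gt0//.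
  by move: Kz; lra.
have kb : `|kap| * (expR (2 * z * a) - 1) <= 6 * expR a.
  have e1 : 0 <= expR (2 * z * a) - 1.
    by rewrite subr_ge0 -[leLHS]expR0 ler_expR; apply: mulr_ge0; rewrite ltW// mulr_gt0.
  rewrite -[X in _ * X](ger0_norm e1) -normrM.
  rewrite [X in `|X|](_ : _ = expR (z * a) * v a - 1 +
    \int[mu]_s cutoff a (fun s => Q s * hker z a s * (expR (z * s) * v s)) s); last first.
    by rewrite E; ring.
  rewrite (le_trans (ler_normD _ _))//.
  have := ler_normB (expR (z * a) * v a) 1; rewrite normr1.
  by move: J fa; lra.
have kb' : `|kap| <= 12 * expR a * expR (- (2 * z) * a).
  rewrite XXN ler_pdivlMr ?exprn_gt0//.
  have e2 : expR (z * a) ^+ 2 / 2 <= expR (2 * z * a) - 1.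
    by have := expR_ge1Dx (2 * z * a); rewrite -XX; move: za1; lra.
  have := ler_wpM2l (normr_ge0 kap) e2; move: kb; lra.
split => //.
have -> : v' a = 2 * z * (expR (z * a) * kap) - z * v a.
  by rewrite /kap XN; field; rewrite (gt_eqF z0) gt_eqF.
clearbody kap; rewrite (le_trans (ler_normB _ _))// !normrM (gtr0_norm z0) (gtr0_norm X0) (gtr0_norm (ltr0Sn _ _)).
have h : expR (z * a) * `|kap| <= 12 * expR a * expR (- z * a).
  apply: (@le_trans _ _ (expR (z * a) * (12 * expR a * expR (- (2 * z) * a)))).
    by rewrite ler_wpM2l// ltW.
  rewrite XXN XN le_eqVlt; apply/orP; left; apply/eqP.
  by field; rewrite gt_eqF.
have h1 : 2 * z * (expR (z * a) * `|kap|) <= 2 * z * (12 * expR a * expR (- z * a)).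
  by rewrite ler_wpM2l// mulr_ge0// ltW.
have h2 : z * `|v a| <= z * (4 * expR a * expR (- z * a)) by rewrite ler_wpM2l// ltW.
by move: h1 h2; lra.
Qed.

End solution_decay.


(** * The Weyl function through Wronskians *)

Section weyl_function.
Context {R : realType}.
Notation mu := (@lebesgue_measure R).
Implicit Types (Q v w : R -> R) (z K a b lambda m : R).

Lemma solutions_wronskian Q1 Q2 lambda v1 v1' v2 v2' b : inA1 Q1 -> inA1 Q2 ->
  L2_solution Q1 lambda v1 v1' -> L2_solution Q2 lambda v2 v2' -> 0 < b ->
  mu.-integrable setT (EFin \o cutoff b (fun s => (Q1 s - Q2 s) * (v1 s * v2 s))) /\
  \int[mu]_s cutoff b (fun s => (Q1 s - Q2 s) * (v1 s * v2 s)) s =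
  v1' b * v2 b - v1 b * v2' b - (v1' 0 - v2' 0).
Proof.
move=> QA1 QA2 vs1 vs2 b0.
have [p1 p1'] := L2_solution_primitive QA1 vs1.
have [p2 p2'] := L2_solution_primitive QA2 vs2.
have [i E] := wronskian p1 p1' p2 p2' b0.
have [_ v10 _] := vs1; have [_ v20 _] := vs2.
have cE s : cutoff b (fun s => (Q1 s - Q2 s) * (v1 s * v2 s)) s =
    cutoff b (fun t => (Q1 t - lambda) * v1 t * v2 t - v1 t * ((Q2 t - lambda) * v2 t)) s.
  by rewrite /cutoff; ring.
split.
  by apply: eq_integrable i; [by []|move=> s _; rewrite /= cE].
under eq_Rintegral do rewrite cE.
by rewrite E v10 v20; ring.
Qed.

Lemma solutions_wronskian_end Q1 Q2 K z v1 v1' v2 v2' a : inA1 Q1 -> inA1 Q2 ->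
  exp_mean_le Q1 K -> exp_mean_le Q2 K ->
  L2_solution Q1 (- z ^+ 2) v1 v1' -> L2_solution Q2 (- z ^+ 2) v2 v2' ->
  2 <= z -> 2 * K <= z -> 0 < a -> 1 <= z * a ->
  `|v1' a * v2 a - v1 a * v2' a| <= 224 * z * expR (2 * a) * expR (- (2 * z) * a).
Proof.
move=> QA1 QA2 QK1 QK2 vs1 vs2 z2 Kz a0 za.
have [_ v1a v1'a] := solution_end QA1 QK1 vs1 z2 Kz a0 za.
have [_ v2a v2'a] := solution_end QA2 QK2 vs2 z2 Kz a0 za.
have z0 : 0 < z by rewrite (lt_le_trans _ z2).
rewrite (le_trans (ler_normB _ _))// !normrM.
have -> : expR (2 * a) = expR a * expR a by rewrite -expRD; congr expR; ring.
have -> : expR (- (2 * z) * a) = expR (- z * a) * expR (- z * a).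
  by rewrite -expRD; congr expR; ring.
have h1 := ler_pM (normr_ge0 _) (normr_ge0 _) v1'a v2a.
have h2 := ler_pM (normr_ge0 _) (normr_ge0 _) v1a v2'a.
by move: h1 h2; lra.
Qed.

(** The Wronskian of two solutions of the same equation is constant; at 0 it is v'(0) - w'(0), and
    by [solutions_wronskian_end] it tends to 0 at infinity. *)
Lemma solution_derive_unique Q K z v v' w w' : inA1 Q -> exp_mean_le Q K ->
  2 <= z -> 2 * K <= z ->
  L2_solution Q (- z ^+ 2) v v' -> L2_solution Q (- z ^+ 2) w w' -> v' 0 = w' 0.
Proof.
move=> QA QK z2 Kz vs ws.
have z0 : 0 < z by rewrite (lt_le_trans _ z2).
apply/eqP; rewrite -subr_eq0 -normr_le0; apply/ler_addgt0Pr => e e0; rewrite add0r.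
(* As z >= 2, the Wronskian at b is at most 224 z e^{-b} <= 224 z / b <= e. *)
pose b := Num.max 1 (224 * z / e).
have b1 : 1 <= b by rewrite le_max lexx.
have b0 : 0 < b by rewrite (lt_le_trans _ b1).
have [_] := solutions_wronskian QA QA vs ws b0.
rewrite (@eq_Rintegral _ _ _ mu setT (cst 0)); last first.
  by move=> s _; rewrite /cutoff subrr mul0r mulr0.
rewrite Rintegral_cst// mul0r => /esym/eqP; rewrite subr_eq0 => /eqP <-.
have zb : 1 <= z * b by apply: mulr_ege1 => //; move: z2; lra.
apply: le_trans (solutions_wronskian_end QA QA QK QK vs ws z2 Kz b0 zb) _.
rewrite -mulrA -expRD.
apply: (@le_trans _ _ (224 * z * b^-1)).
  apply: ler_wpM2l; first exact: mulr_ge0 (ler0n _ _) (ltW z0).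
  apply: (@le_trans _ _ (expR (- b))); first by rewrite ler_expR; move: z2 b0; nra.
  by rewrite expRN lef_pV2 ?posrE ?expR_gt0//; apply: le_trans (expR_ge1Dx b); lra.
have eb : 224 * z / e <= b by rewrite le_max lexx orbT.
by rewrite ler_pdivrMr// [leRHS]mulrC -ler_pdivrMr.
Qed.

Lemma weyl_titchmarsh_solution Q K z m w w' : inA1 Q -> exp_mean_le Q K ->
  2 <= z -> 2 * K <= z -> weyl_titchmarsh Q (- z ^+ 2) m ->
  L2_solution Q (- z ^+ 2) w w' -> m = w' 0.
Proof.
move=> QA QK z2 Kz [v [v' [vs _ ->]]] ws.
exact: solution_derive_unique QA QK z2 Kz vs ws.
Qed.

End weyl_function.


(** * Truncated kernels approximate solutions and their products *)

Section solution_kernel.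
Context {R : realType}.
Notation mu := (@lebesgue_measure R).
Implicit Types (Q v : R -> R) (z K N a t s : R) (k : R * R -> R).

Lemma measurable_cutoff Q b : inA1 Q -> measurable_fun setT (cutoff b Q).
Proof.
move=> /inA1_measurable mQ.
rewrite (_ : cutoff b Q = fun s => (0 < s < b)%R%:R * ((0 < s)%R%:R * Q s)); first by meas.
apply/funext => s; rewrite /cutoff; case: (ltP 0 s) => _ /=; last by rewrite !mul0r.
by rewrite mul1r.
Qed.

Lemma cutoff_le0 b (h : R -> R) s : s <= 0 -> cutoff b h s = 0.
Proof. by move=> s0; rewrite /cutoff ltNge s0 mul0r. Qed.

Definition truncated_kernel Q a N k := exp_kernel (2 * N) k /\
  forall z t, N < z -> 0 <= t ->
  laplace k z t = - \int[mu]_s (cutoff a Q s * hker z t s * (1 + laplace k z s)).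

Lemma laplace_le1 N k z t : exp_kernel (2 * N) k -> 0 < N -> 2 * N <= z ->
  `|laplace k z t| <= 1.
Proof.
move=> kN N0 Nz; apply: le_trans (laplace_le _ kN _ _) _; [by rewrite mulr_ge0// ltW|lra|].
by rewrite ler_pdivrMr; lra.
Qed.

(** Subtracting the two integral equations on [0,a], the difference g satisfies g = [kap] (e^{2zt} -
    1) - int Q [hker] g with [kap] = O(e^{-2za}). With the weight e^{(2z-1)t}, the steepest allowed
    by [hker_exp], [bootstrap] doubles the bound on the source term. *)
Lemma solution_kernel Q K N k z v v' a : inA1 Q -> exp_mean_le Q K ->
  truncated_kernel Q a N k -> (\int[mu]_s `|cutoff a Q s|%:E <= N%:E)%E -> 0 < N ->
  L2_solution Q (- z ^+ 2) v v' ->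
  2 <= z -> 2 * K <= z -> 2 * N <= z -> 0 < a -> 1 <= z * a ->
  forall t, 0 <= t <= a -> `|expR (z * t) * v t - (1 + laplace k z t)| <=
    24 * expR (2 * a) * expR (- (2 * z) * (a - t)).
Proof.
move=> QA QK [kN kE] QN N0 vs z2 Kz Nz a0 za t ta.
have z0 : 0 < z by rewrite (lt_le_trans _ z2).
have Nz' : N < z by lra.
have mq := measurable_cutoff a QA.
pose ft s := 1 + laplace k z s.
have mft : measurable_fun setT ft.
  by apply: measurable_funD => //; apply: measurable_laplace; case: kN.
have ft2 s : `|ft s| <= 2.
  rewrite (le_trans (ler_normD _ _))// normr1 -[leRHS]/(1 + 1) lerD2l.
  exact: laplace_le1 kN N0 Nz.
pose g s := expR (z * s) * v s - ft s.
pose W s := expR ((2 * z - 1) * s).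
have [kap_le _ _] := solution_end QA QK vs z2 Kz a0 za.
set kap := (X in `|X|) in kap_le.
have ift s : 0 <= s -> mu.-integrable setT (EFin \o (fun r => cutoff a Q r * hker z s r * ft r)).
  move=> s0; apply: (integrable_q_hker mq QN _ z0 s0 mft ft2) => r r0.
  exact: cutoff_le0.
have cE s r : cutoff a (fun r => Q r * hker z s r * g r) r =
   cutoff a (fun r => Q r * hker z s r * (expR (z * r) * v r)) r -
   cutoff a Q r * hker z s r * ft r.
  by rewrite /cutoff /g; move: (hker z s r) (ft r) => h fr; ring.
have gE s : 0 <= s <= a -> g s = kap * (expR (2 * z * s) - 1) -
    \int[mu]_r cutoff a (fun r => Q r * hker z s r * g r) r.
  move=> sa; have s0 : 0 <= s by case/andP: sa.
  have [i E] := solution_hker QA vs z0 sa a0.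
  under eq_Rintegral do rewrite cE.
  rewrite (RintegralB measurableT i (ift s s0)) /g E /ft kE// -/kap.
  by ring.
have Ca : 0 <= expR (2 * a) * expR (- (2 * z) * a) by rewrite mulr_ge0 ?expR_ge0.
pose A := 12 * (expR (2 * a) * expR (- (2 * z) * a)).
have A0 : 0 <= A by rewrite mulr_ge0.
have kap_W s : 0 <= s <= a -> `|kap * (expR (2 * z * s) - 1)| <= A * W s.
  move=> /andP[s0 sa]; have e0 : 0 <= expR (2 * z * s) - 1.
    rewrite subr_ge0 -[leLHS]expR0 ler_expR; apply: mulr_ge0 s0.
    by rewrite ltW// mulr_gt0.
  rewrite normrM (ger0_norm e0).
  apply: (@le_trans _ _ (12 * expR a * expR (- (2 * z) * a) * expR (2 * z * s))).
    by apply: ler_pM => //; rewrite gerBl.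
  rewrite /A /W -!mulrA ler_wpM2l// -!expRD ler_expR; lra.
have gA : `|g t| <= 2 * A * W t.
  have W1 s : 0 <= s -> 1 <= W s.
    move=> s0; rewrite -[leLHS]expR0 ler_expR; apply: mulr_ge0 s0.
    by move: z2; lra.
  apply: (@bootstrap _ _ (fun s => 0 <= s <= a) g W A (4 * expR a + 2)) => //.
  - by move=> s _; exact: expR_gt0.
  - move=> s /andP[s0 sa]; rewrite -[leLHS]mulr1; apply: ler_pM => //; last exact: W1.
    rewrite (le_trans (ler_normB _ _))// lerD//.
    apply: le_trans (solution_bound QA QK vs z2 Kz s0) _.
    by rewrite ler_wpM2l// ler_expR.
  move=> S S0 gS s sa; have s0 : 0 <= s by case/andP: sa.
  rewrite gE// (le_trans (ler_normB _ _))// [leRHS]mulrDl; apply: lerD; first exact: kap_W.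
  apply: (@le_trans _ _ (K / (2 * z) * S * W s)).
    apply: (@hker_integral_le _ Q K z a W) => //.
    - exact: inA1_measurable.
    - exact: expR_ge0.
    - by move=> r r0; apply: hker_exp => //; move: z2; lra.
    - rewrite (_ : cutoff _ _ = fun r =>
        cutoff a (fun r => Q r * hker z s r * (expR (z * r) * v r)) r -
        cutoff a Q r * hker z s r * ft r).
        apply: measurable_funB; first exact: (measurable_solution_hker QA vs).
        by apply: integrable_measurable; exact: ift.
      by apply/funext => r; exact: cE.
    - by move=> r /andP[r0 ra]; apply: gS; rewrite !ltW.
  rewrite ler_wpM2r ?expR_ge0// mulrC ler_wpM2l// ler_pdivrMr ?mulr_gt0//.
  by move: Kz z0; lra.
apply: (le_trans gA).
rewrite /A /W [leLHS](_ : _ = 24 * (expR (2 * a) *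
  (expR (- (2 * z) * a) * expR ((2 * z - 1) * t)))); last by ring.
rewrite -mulrA ler_wpM2l// ler_wpM2l ?expR_ge0// -expRD ler_expR.
by case/andP: ta; lra.
Qed.

End solution_kernel.


Section solution_product.
Context {R : realType}.
Notation mu := (@lebesgue_measure R).
Implicit Types (Q v D : R -> R) (z K N a t s : R) (k : R * R -> R).

Lemma product_dist (x1 x2 y1 y2 A B d : R) :
  `|x1| <= A -> `|y2| <= B -> `|x1 - y1| <= d -> `|x2 - y2| <= d ->
  `|x1 * x2 - y1 * y2| <= d * (A + B).
Proof.
move=> x1A y2B d1 d2.
rewrite (_ : x1 * x2 - y1 * y2 = x1 * (x2 - y2) + (x1 - y1) * y2); last by ring.
rewrite (le_trans (ler_normD _ _))// !normrM mulrDr lerD//.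
  by rewrite mulrC ler_pM.
by rewrite ler_pM.
Qed.

Lemma cutoff_norm_le b D (ND c : R) (h : R -> R) : 0 <= c ->
  measurable_fun setT (cutoff b D) -> (\int[mu]_s `|cutoff b D s|%:E <= ND%:E)%E ->
  measurable_fun setT (cutoff b (fun s => D s * h s)) ->
  (forall s, 0 < s < b -> `|h s| <= c) ->
  (\int[mu]_s `|cutoff b (fun s => D s * h s) s|%:E <= (ND * c)%:E)%E.
Proof.
move=> c0 mD DN mDh hc.
apply: (@le_trans _ _ (\int[mu]_s (c * `|cutoff b D s|)%:E)%E).
  apply: le_integral_bound => //; [by apply: measurableT_comp|by meas|].
  move=> s; rewrite /cutoff; case: (boolP (_ && _)) => [sb|_]; last first.
    by rewrite !mul0r normr0 mulr0.
  by rewrite !mul1r normrM mulrC ler_wpM2r// hc.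
rewrite ge0_integral_scale//; last by meas.
by rewrite mulrC EFinM lee_wpmul2l// lee_fin.
Qed.

(** The factor e^{-2zs} of v1 v2 compensates the growth of the error e^{-2z(a-s)} of
    [solution_kernel], so the integrand is off by O(e^{-2za}) uniformly in s. The factor 4 e^a + 2
    bounds e^{zs} v1 and 1 + [laplace k2 z s] in [product_dist]. *)
Lemma solution_product_laplace Q1 Q2 K N k1 k2 z v1 v1' v2 v2' a D ND :
  inA1 Q1 -> inA1 Q2 -> exp_mean_le Q1 K -> exp_mean_le Q2 K ->
  truncated_kernel Q1 a N k1 -> truncated_kernel Q2 a N k2 ->
  (\int[mu]_s `|cutoff a Q1 s|%:E <= N%:E)%E ->
  (\int[mu]_s `|cutoff a Q2 s|%:E <= N%:E)%E -> 0 < N ->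
  L2_solution Q1 (- z ^+ 2) v1 v1' -> L2_solution Q2 (- z ^+ 2) v2 v2' ->
  2 <= z -> 2 * K <= z -> 2 * N <= z ->
  4 * ((2 * N) ^+ 2 + 2 * N + 1) < 2 * z -> 0 < a -> 1 <= z * a ->
  measurable_fun setT (cutoff a D) -> (\int[mu]_s `|cutoff a D s|%:E <= ND%:E)%E ->
  mu.-integrable setT (EFin \o (fun s => expR (- (2 * z) * s) *
    volterra (kernel_prod k1 k2) (cutoff a D) s)) /\
  `|\int[mu]_s cutoff a (fun s => D s * (v1 s * v2 s)) s -
    \int[mu]_s (expR (- (2 * z) * s) * volterra (kernel_prod k1 k2) (cutoff a D) s)| <=
  ND * (24 * expR (2 * a) * (4 * expR a + 2)) * expR (- (2 * z) * a).
Proof.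
move=> QA1 QA2 QK1 QK2 tk1 tk2 QN1 QN2 N0 vs1 vs2 z2 Kz Nz Mz a0 za mD DN.
have z0 : 0 < z by rewrite (lt_le_trans _ z2).
have [kN1 _] := tk1; have [kN2 _] := tk2.
have iD : mu.-integrable setT (EFin \o cutoff a D) by apply: integrable_boundT; [exact: mD|exact: DN].
have mexp : measurable_fun setT (fun s : R => expR (- (2 * z) * s)) by meas.
have iD' : mu.-integrable setT (EFin \o (fun s => expR (- (2 * z) * s) * cutoff a D s)).
  apply: (@integrable_leT _ _ _ mu _ (fun s => `|cutoff a D s|)).
  - by meas.
  - move=> s; have [s0|s0] := leP s 0; first by rewrite cutoff_le0// mulr0 normr0.
    rewrite normrM ger0_norm ?expR_ge0// ler_piMl// -expR0 ler_expR.
    by rewrite mulNr oppr_le0 mulr_ge0 ?mulr_ge0 ?ltW.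
  - exact: integrable_norm.
have N20 : 0 <= 2 * N by rewrite mulr_ge0 ?ltW.
have [iV EV] := product_representation N20 Mz kN1 kN2 mD (@cutoff_le0 _ a D) iD'.
split; first exact: iV.
rewrite -EV.
pose f1 s := 1 + laplace k1 z s; pose f2 s := 1 + laplace k2 z s.
have mf1 : measurable_fun setT f1.
  by apply: measurable_funD => //; apply: measurable_laplace; case: kN1.
have mf2 : measurable_fun setT f2.
  by apply: measurable_funD => //; apply: measurable_laplace; case: kN2.
have f1le s : `|f1 s| <= 2.
  rewrite (le_trans (ler_normD _ _))// normr1 -[leRHS]/(1 + 1) lerD2l.
  exact: laplace_le1 kN1 N0 Nz.
have f2le s : `|f2 s| <= 2.
  rewrite (le_trans (ler_normD _ _))// normr1 -[leRHS]/(1 + 1) lerD2l.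
  exact: laplace_le1 kN2 N0 Nz.
have [p1 _] := L2_solution_primitive QA1 vs1.
have [p2 _] := L2_solution_primitive QA2 vs2.
have [mv1 _] := measurable_cutoff_solution a QA1 p1.
have [mv2 _] := measurable_cutoff_solution a QA2 p2.
have cM (h1 h2 : R -> R) : cutoff a (fun s => D s * (h1 s * h2 s)) =
    fun s => cutoff a D s * (cutoff a h1 s * cutoff a h2 s).
  apply/funext => s; rewrite /cutoff; case: (boolP (_ && _)) => _.
    by rewrite !mul1r.
  by rewrite !mul0r.
have cEE s : cutoff a (fun s => D s * (v1 s * v2 s)) s -
    expR (- (2 * z) * s) * cutoff a D s * (f1 s * f2 s) =
    cutoff a (fun s => D s * (v1 s * v2 s - expR (- (2 * z) * s) * (f1 s * f2 s))) s.
  by rewrite /cutoff; move: (f1 s) (f2 s) => x y; ring.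
have mvv : measurable_fun setT (cutoff a (fun s => D s * (v1 s * v2 s))).
  by rewrite cM; meas.
have mff : measurable_fun setT (fun s => expR (- (2 * z) * s) * cutoff a D s * (f1 s * f2 s)).
  by meas.
have vle (v v' : R -> R) Q : inA1 Q -> exp_mean_le Q K -> L2_solution Q (- z ^+ 2) v v' ->
    forall s, 0 < s < a -> `|expR (z * s) * v s| <= 4 * expR a.
  move=> QA QK vs s /andP[s0 sa]; apply: le_trans (solution_bound QA QK vs z2 Kz (ltW s0)) _.
  by rewrite ler_wpM2l// ler_expR ltW.
have vle4 (v v' : R -> R) Q : inA1 Q -> exp_mean_le Q K -> L2_solution Q (- z ^+ 2) v v' ->
    forall s, 0 < s < a -> `|v s| <= 4 * expR a.
  move=> QA QK vs s sa; apply: le_trans (vle _ _ _ QA QK vs s sa).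
  rewrite normrM ger0_norm ?expR_ge0// ler_peMl//.
  rewrite -[leLHS]expR0 ler_expR; case/andP: sa => s0 _.
  by rewrite mulr_ge0 ?ltW.
have C0 : 0 <= 4 * expR a by rewrite mulr_ge0// expR_ge0.
have ivv : mu.-integrable setT (EFin \o cutoff a (fun s => D s * (v1 s * v2 s))).
  apply: (@integrable_boundT _ _ _ mu _ (ND * (4 * expR a * (4 * expR a)))) => //.
  apply: (cutoff_norm_le _ mD DN mvv); first by rewrite mulr_ge0.
  move=> s sa; rewrite normrM ler_pM//; first exact: vle4 QA1 QK1 vs1 s sa.
  exact: vle4 QA2 QK2 vs2 s sa.
have iff : mu.-integrable setT
    (EFin \o (fun s => expR (- (2 * z) * s) * cutoff a D s * (f1 s * f2 s))).
  apply: (@integrable_leT _ _ _ mu _ (fun s => (2 * 2) * `|expR (- (2 * z) * s) * cutoff a D s|)) => //.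
    by move=> s; rewrite normrM mulrC ler_wpM2r// normrM ler_pM.
  exact/integrable_scale/integrable_norm.
rewrite -(RintegralB measurableT ivv iff).
under eq_Rintegral do rewrite cEE.
set E := 24 * expR (2 * a) * (4 * expR a + 2).
have E0 : 0 <= E by rewrite /E !mulr_ge0 ?addr_ge0 ?expR_ge0.
apply: Rintegral_norm_bound.
  by rewrite (_ : cutoff _ _ = fun s => cutoff a (fun s => D s * (v1 s * v2 s)) s -
    expR (- (2 * z) * s) * cutoff a D s * (f1 s * f2 s));
    [exact: measurable_funB|apply/funext => s; rewrite cEE].
rewrite -mulrA; apply: (cutoff_norm_le _ mD DN).
- by rewrite mulr_ge0// expR_ge0.
- by rewrite (_ : cutoff _ _ = fun s => cutoff a (fun s => D s * (v1 s * v2 s)) s -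
    expR (- (2 * z) * s) * cutoff a D s * (f1 s * f2 s));
    [exact: measurable_funB|apply/funext => s; rewrite cEE].
move=> s sa; have sa' : 0 <= s <= a by case/andP: sa => *; rewrite !ltW.
have X1 := expR_gt0 (z * s).
have -> : v1 s * v2 s = expR (- (2 * z) * s) * ((expR (z * s) * v1 s) * (expR (z * s) * v2 s)).
  rewrite (_ : expR (- (2 * z) * s) = (expR (z * s) * expR (z * s))^-1).
    by field; rewrite gt_eqF.
  by rewrite -expRD -expRN; congr expR; ring.
rewrite -mulrBr normrM ger0_norm ?expR_ge0//.
have d1 := solution_kernel QA1 QK1 tk1 QN1 N0 vs1 z2 Kz Nz a0 za sa'.
have d2 := solution_kernel QA2 QK2 tk2 QN2 N0 vs2 z2 Kz Nz a0 za sa'.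
have := product_dist (vle _ _ _ QA1 QK1 vs1 s sa) (f2le s) d1 d2.
move/(ler_wpM2l (expR_ge0 (- (2 * z) * s))) => h; apply: (le_trans h).
rewrite le_eqVlt; apply/orP; left; apply/eqP.
rewrite /E (_ : expR (- (2 * z) * a) = expR (- (2 * z) * s) * expR (- (2 * z) * (a - s))).
  by ring.
by rewrite -expRD; congr expR; ring.
Qed.

End solution_product.


(** * The Gamma function *)

Section gamma_function.
Context {R : realType}.
Notation mu := (@lebesgue_measure R).
Implicit Types (r s x : R).

(** The r-th power of y <= e^y at y = x/(2r). *)
Lemma powR_le_expR r x : 0 <= r -> 0 <= x -> x `^ r <= (2 * r) `^ r * expR (x / 2).
Proof.
rewrite le_eqVlt => /predU1P[<- x0|r0 x0].
  by rewrite !powRr0 mul1r -[leLHS]expR0 ler_expR divr_ge0.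
have r20 : 0 < 2 * r by rewrite mulr_gt0.
have xE : x = 2 * r * (x / (2 * r)) by rewrite mulrC divfK// gt_eqF.
rewrite [in leLHS]xE powRM; [|exact: ltW|by apply: divr_ge0 => //; exact: ltW].
rewrite ler_wpM2l ?powR_ge0//.
apply: (@le_trans _ _ (expR (x / (2 * r)) `^ r)).
  apply: ge0_ler_powR; rewrite ?nnegrE ?expR_ge0//; [exact: ltW|by apply: divr_ge0 => //; exact: ltW|].
  by apply: le_trans (expR_ge1Dx _); rewrite lerDr.
rewrite -expRM le_eqVlt; apply/orP; left; apply/eqP; congr expR.
by field; rewrite gt_eqF.
Qed.

Definition gamma_density r x := (0 < x)%R%:R * (x `^ r * expR (- x)).

Lemma GammaE s : Gamma s = \int[mu]_x gamma_density (s - 1) x.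
Proof.
rewrite /Gamma [LHS]Rintegral_mkcond; apply: eq_Rintegral => x _.
by rewrite /gamma_density indicator_patch patchE mem_setE in_itv/= andbT.
Qed.

Lemma measurable_gamma_density r : measurable_fun setT (gamma_density r).
Proof.
rewrite /gamma_density.
have h1 : measurable_fun setT (fun x : R => expR (- x)) by meas.
have h2 := @measurable_powR R r.
by meas.
Qed.

Lemma integrable_gamma_density r : 0 <= r ->
  mu.-integrable setT (EFin \o gamma_density r).
Proof.
move=> r0; have e0 : 0 < (2^-1 : R) by [].
have C0 : 0 <= (2 * r) `^ r by rewrite powR_ge0.
have mg := measurable_gamma_density r.
apply: (@integrable_boundT _ _ _ mu _ ((2 * r) `^ r * (2^-1)^-1)) => //.
have me : measurable_fun setT (fun x => (0 < x)%R%:R * expR (- 2^-1 * x)) by meas.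
have ge0e x : 0 <= (0 < x)%R%:R * expR (- 2^-1 * x) by rewrite mulr_ge0 ?expR_ge0.
rewrite EFinM -(integral_exp_halfline e0) -(@ge0_integral_scale _ _ _ mu _ _ C0 me ge0e).
apply: le_integral_bound => //; [by apply: measurableT_comp|by meas|].
move=> x; rewrite /gamma_density; case: ltP => [x0|_]; last by rewrite !mul0r normr0 mulr0.
rewrite !mul1r ger0_norm ?mulr_ge0 ?powR_ge0 ?expR_ge0//.
apply: (@le_trans _ _ ((2 * r) `^ r * expR (x / 2) * expR (- x))).
  by rewrite ler_wpM2r ?expR_ge0// powR_le_expR// ltW.
rewrite -mulrA ler_wpM2l// -expRD ler_expR; lra.
Qed.

Lemma Gamma_gt0 s : 1 <= s -> 0 < Gamma s.
Proof.
move=> s1; rewrite GammaE; have r0 : 0 <= s - 1 by lra.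
apply: (@lt_le_trans _ _ (expR (- 2))); first exact: expR_gt0.
rewrite -lee_fin (Rintegral_EFin (integrable_gamma_density r0)).
rewrite (_ : (expR (- 2))%:E = (\int[mu]_x ((1 < x < 2)%R%:R * expR (- 2))%:E)%E).
  apply: le_integral_bound => //; [by meas|exact: measurable_gamma_density|].
  move=> x; rewrite /gamma_density; case: (boolP (_ && _)) => [/andP[x1 x2]|_]; last first.
    by rewrite mul0r !mulr_ge0 ?powR_ge0 ?expR_ge0.
  rewrite (lt_trans ltr01 x1) !mul1r -[leLHS]mul1r ler_pM ?expR_ge0//.
    by rewrite -[leLHS](powRr0 x); apply: ler_powR; [exact: ltW|exact: r0].
  by rewrite ler_expR lerN2 ltW.
have icst : mu.-integrable setT (EFin \o (fun x => (1 < x < 2)%R%:R * expR (- 2))).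
  by apply/integrable_window/continuous_integrable_oo; exact: cst_continuous.
rewrite -(Rintegral_EFin icst) Rintegral_window Rintegral_cst//.
rewrite [X in fine X](_ : _ = 1%:E) ?mulr1//.
rewrite [LHS]lebesgue_measure_itv/= lte_fin ltrDl ltr01 -EFinD.
by congr EFin; ring.
Qed.

Lemma FTC_pos (f F : R -> R) a b : measurable_fun setT f ->
  (forall x, 0 < x -> is_derive x 1 F (f x)) ->
  (forall x, 0 < x -> {for x, continuous f}) ->
  0 < a -> a <= b -> \int[mu]_(x in `]a, b[) f x = F b - F a.
Proof.
move=> mf dF cf a0; rewrite le_eqVlt => /predU1P[<-|ab].
  by rewrite subrr set_itv_ge ?Rintegral_set0// bnd_simp ltxx.
have b0 := lt_trans a0 ab.
have cF x : 0 < x -> {for x, continuous F}.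
  by move=> x0; have := dF x x0 => d; exact/differentiable_continuous/derivable1_diffP.
have xa x : x \in `]a, b[ -> 0 < x by rewrite in_itv/= => /andP[ax _]; exact: lt_trans ax.
rewrite /Rintegral integral_itv_obnd_cbnd; last first.
  by apply/measurable_EFinP/measurable_funTS.
rewrite integral_itv_bndo_bndc; last first.
  by apply/measurable_EFinP/measurable_funTS.
rewrite (continuous_FTC2 (F := F))//.
- apply: continuous_in_subspaceT => x; rewrite mem_setE in_itv/= => /andP[ax _].
  by apply: cf; exact: lt_le_trans ax.
- split.
  + by move=> x /xa x0; have := dF x x0 => d.
  + by apply: cvg_at_right_filter; exact: cF.
  + by apply: cvg_at_left_filter; exact: cF.
- by move=> x /xa x0; have := dF x x0 => d; rewrite derive1E derive_val.
Qed.

(** The function (s x^{s-1} - x^s) e^{-x} is the derivative of x^s e^{-x}; it is integrated over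
    ]1/(n+1), n+1[, and the boundary terms tend to 0. *)
Lemma GammaS s : 1 < s -> Gamma (s + 1) = s * Gamma s.
Proof.
move=> s1; have s0 : 0 < s by lra.
pose f x := s * gamma_density (s - 1) x - gamma_density s x.
have r0 : 0 <= s - 1 by lra.
have i1 := integrable_scale s (integrable_gamma_density r0).
have i2 := integrable_gamma_density (ltW s0).
have fi : mu.-integrable setT (EFin \o f) by exact: integrableB i1 i2.
have mf : measurable_fun setT f by exact: integrable_measurable fi.
have fE : \int[mu]_x f x = s * Gamma s - Gamma (s + 1).
  rewrite /f (RintegralB measurableT i1 i2) RintegralZl//; last exact: integrable_gamma_density.
  by rewrite !GammaE addrK.
apply/esym/eqP; rewrite -subr_eq0 -fE; apply/eqP.
pose F x := x `^ s * expR (- x).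
pose F' x := s * x `^ (s - 1) * expR (- x) - x `^ s * expR (- x).
have dF x : 0 < x -> is_derive x 1 F (F' x).
  move=> x0; have d1 : is_derive x (1 : R) (fun x : R => x `^ s) (s * x `^ (s - 1)).
    exact: is_derive1_powR.
  have d2 : is_derive x (1 : R) (fun x : R => expR (- 1 * x)) (- 1 * expR (- 1 * x)).
    exact: is_derive_expRM.
  have -> : F = (fun x : R => x `^ s) * (fun x => expR (- 1 * x)).
    apply/funext => y; transitivity (y `^ s * expR (- 1 * y)); last by [].
    by rewrite mulN1r.
  have := is_deriveM d1 d2; move/is_derive_eq; apply.
  by rewrite /GRing.scale/= /F' !mulN1r; ring.
have cF' x : 0 < x -> {for x, continuous F'}.
  move=> x0; have cp r : {for x, continuous (fun x : R => x `^ r)}.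
    have d1 : is_derive x (1 : R) (fun x : R => x `^ r) (r * x `^ (r - 1)).
      exact: is_derive1_powR.
    exact/differentiable_continuous/derivable1_diffP.
  have ce : {for x, continuous (fun x : R => expR (- x))}.
    by apply: continuous_comp; [exact: opp_continuous|exact: continuous_expR].
  apply: cvgB; last by apply: cvgM; [exact: cp|exact: ce].
  by apply: cvgM; [apply: cvgM; [exact: cvg_cst|exact: cp]|exact: ce].
have mF' : measurable_fun setT F'.
  have h1 : measurable_fun setT (fun x : R => expR (- x)) by meas.
  have h2 := @measurable_powR R s; have h3 := @measurable_powR R (s - 1).
  by rewrite /F'; meas.
have win n : \int[mu]_x ((n.+1%:R^-1 < x < n.+1%:R)%R%:R * f x) = F n.+1%:R - F n.+1%:R^-1.
  rewrite -(FTC_pos mF' dF cF')//.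
    rewrite -Rintegral_window; apply: eq_Rintegral => x _.
    rewrite /f /F' /gamma_density; case: (boolP (_ && _)) => [/andP[nx _]|_]; last by rewrite !mul0r.
    by rewrite (_ : 0 < x) ?(lt_trans _ nx)//= !mul1r; ring.
  by rewrite (@le_trans _ _ 1)// ?invf_le1// ler1n.
have cvF : (F n.+1%:R - F n.+1%:R^-1) @[n --> \oo] --> (0 : R).
  rewrite -(subrr 0); apply: cvgB.
    apply: (@squeeze_cvgr _ _ _ _ (cst 0) (fun n => (2 * s) `^ s * expR ((n + 1)%:R * - 2^-1))).
    - apply: nearW => n; rewrite mulr_ge0 ?powR_ge0 ?expR_ge0//= /F addn1.
      apply: (@le_trans _ _ ((2 * s) `^ s * expR (n.+1%:R / 2) * expR (- n.+1%:R))).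
        by apply: ler_wpM2r; [exact: expR_ge0|apply: powR_le_expR; rewrite ?ler0n ?ltW].
      rewrite -mulrA; apply: ler_wpM2l; first exact: powR_ge0.
      by rewrite -expRD ler_expR; lra.
    - exact: cvg_cst.
    - rewrite -(mulr0 ((2 * s) `^ s)); apply: cvgM; first exact: cvg_cst.
      by apply: expR_natmul_cvg0; rewrite oppr_lt0.
  apply: (@squeeze_cvgr _ _ _ _ (cst 0) (fun n => n.+1%:R^-1)).
  - apply: nearW => n; rewrite mulr_ge0 ?powR_ge0 ?expR_ge0//= /F.
    rewrite -[leRHS]mulr1 ler_pM ?powR_ge0 ?expR_ge0//.
      by apply: ge1r_powR; rewrite ?invr_gt0 ?ltr0Sn ?invf_le1 ?ler1n// ltW.
  - exact: cvg_cst.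
  - exact: cvg_harmonic.
have cvf : \int[mu]_x ((n.+1%:R^-1 < x < n.+1%:R)%R%:R * f x) @[n --> \oo] --> \int[mu]_x f x.
  apply: (@Rintegral_dominated _ _ _ mu _ _ (fun x => `|f x|)) => //.
  - by move=> n; meas.
  - apply: nearW => x; have [x0|x0] := ltP 0 x; last first.
      rewrite /f /gamma_density ltNge x0 /= !mul0r mulr0 subrr.
      by under eq_fun do rewrite mulr0; exact: cvg_cst.
    rewrite -[X in _ --> X]mul1r; apply: cvgM; last exact: cvg_cst.
    apply: cvg_near_cst; near=> n.
    rewrite (_ : n.+1%:R^-1 < x)/=; last by near: n; exact: near_infty_natSinv_lt (PosNum x0).
    rewrite (_ : x < n.+1%:R)//.
    near: n; exists (Num.truncn x).+1 => // n /= sn.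
    by rewrite (lt_le_trans (truncnS_gt x))// ler_nat (leq_trans sn).
  - by move=> n x; rewrite normrM ler_piMl// ger0_norm// lern1; case: (_ && _).
  - exact: integrable_norm.
move: cvf; under eq_fun do rewrite win.
by move=> cvf; exact: (cvg_unique _ cvf cvF).
Unshelve. all: by end_near.
Qed.

End gamma_function.


(** * The Bessel power series and its differential equation *)

Section bessel_series.
Context {R : realType}.
Implicit Types (c : R ^nat) (G x y z : R).

Lemma pseries_abs_cvg c G x : (forall k, `|c k| <= G / k`!%:R) -> cvgn (pseries c x).
Proof.
move=> cG; apply: normed_cvg.
have cv := @is_cvg_seriesZ _ _ G (is_cvg_series_exp_coeff `|x|).
apply: series_le_cvg cv => n /=.
- exact: normr_ge0.
- by apply: mulr_ge0; [have := cG 0; rewrite divr1; exact: le_trans|rewrite exp_coeff_ge0].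
- rewrite normrM normrX; apply: (@le_trans _ _ (G / n`!%:R * `|x| ^+ n)).
    by rewrite ler_wpM2r// exprn_ge0.
  by rewrite mulrAC -mulrA.
Qed.

Lemma pseries_sum_le c G x n : (forall k, `|c k| <= G / k`!%:R) ->
  `|pseries c x n| <= G * expR `|x|.
Proof.
move=> cG; have G0 : 0 <= G by have := cG 0; rewrite divr1; exact: le_trans.
rewrite /pseries /series /= (le_trans (ler_norm_sum _ _ _))//.
apply: (@le_trans _ _ (G * series (exp_coeff `|x|) n)).
  rewrite /series /= mulr_sumr; apply: ler_sum => k _.
  rewrite normrM normrX; apply: (@le_trans _ _ (G / k`!%:R * `|x| ^+ k)).
    by rewrite ler_wpM2r// exprn_ge0.
  by rewrite mulrAC -mulrA.
rewrite ler_wpM2l// /expR; apply: nondecreasing_cvgn_le; last exact: is_cvg_series_exp_coeff.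
apply/nondecreasing_seqP => m; rewrite /series /= big_nat_recr//= lerDl.
exact: exp_coeff_ge0.
Qed.

(** Domination by an exponential series is stable under formal differentiation, so one bound yields
    convergence of all derivatives. *)
Lemma pseries_diffs_fact c G : (forall k, `|c k| <= G / k`!%:R) ->
  forall k, `|pseries_diffs c k| <= G / k`!%:R.
Proof.
move=> cG k; rewrite /pseries_diffs normrM ger0_norm//.
apply: (@le_trans _ _ (k.+1%:R * (G / k.+1`!%:R))); first by rewrite ler_wpM2l.
rewrite le_eqVlt; apply/orP; left; apply/eqP.
by rewrite factS natrM invfM mulrCA [X in _ * X]mulrA divff ?mul1r// pnatr_eq0.
Qed.

Lemma is_derive_pseries c G x : (forall k, `|c k| <= G / k`!%:R) ->
  is_derive x (1 : R) (fun x => limn (pseries c x)) (limn (pseries (pseries_diffs c) x)).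
Proof.
move=> cG; apply: (@pseries_snd_diffs _ _ (`|x| + 1)).
- exact: pseries_abs_cvg cG.
- exact: pseries_abs_cvg (pseries_diffs_fact cG).
- exact: pseries_abs_cvg (pseries_diffs_fact (pseries_diffs_fact cG)).
- by rewrite [ltRHS]ger0_norm ?addr_ge0// ltrDl.
Qed.

Lemma pseries_lim_le c G x : (forall k, `|c k| <= G / k`!%:R) ->
  `|limn (pseries c x)| <= G * expR `|x|.
Proof.
move=> cG; have cv : `|pseries c x n| @[n --> \oo] --> `|limn (pseries c x)|.
  by apply: cvg_norm; exact: pseries_abs_cvg cG.
rewrite -(cvg_lim _ cv)//; apply: limr_le; first by apply/cvg_ex; eexists; exact: cv.
by apply: nearW => n; exact: pseries_sum_le.
Qed.

(** Chosen so that J_z(w) = (w/2)^z [bessel_fun z] (w^2): the series in w^2 is real for w^2 = kappa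
    of either sign. *)
Definition bessel_coef z (k : nat) : R := (- 4^-1) ^+ k / (k`!%:R * Gamma (k%:R + z + 1)).

Definition bessel_fun z y := limn (pseries (bessel_coef z) y).

Definition bessel_fun' z y := limn (pseries (pseries_diffs (bessel_coef z)) y).

Definition bessel_fun'' z y :=
  limn (pseries (pseries_diffs (pseries_diffs (bessel_coef z))) y).

Lemma Gamma_ge z k : 0 < z -> Gamma (z + 1) <= Gamma (k%:R + z + 1).
Proof.
move=> z0; elim: k => [|k IH]; first by rewrite add0r.
apply: le_trans IH _.
rewrite (_ : k.+1%:R + z + 1 = (k%:R + z + 1) + 1); last by rewrite -natr1; ring.
have k0 : 0 <= k%:R :> R by [].
rewrite (@GammaS _ (k%:R + z + 1)); last by lra.
by rewrite ler_peMl ?(ltW (Gamma_gt0 _))//; lra.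
Qed.

Lemma bessel_coef_le z k : 0 < z -> `|bessel_coef z k| <= (Gamma (z + 1))^-1 / k`!%:R.
Proof.
move=> z0; have G0 : 0 < Gamma (z + 1) by apply: Gamma_gt0; lra.
have Gk := lt_le_trans G0 (Gamma_ge k z0).
have k0 : 0 < k`!%:R :> R by rewrite ltr0n fact_gt0.
rewrite /bessel_coef normrM normfV (ger0_norm (mulr_ge0 (ltW k0) (ltW Gk))).
move: (Gamma (k%:R + z + 1)) (Gamma (z + 1)) (Gamma_ge k z0) G0 Gk => g h hg h0 g0.
rewrite -invfM -[leRHS]mul1r ler_pM ?invr_ge0 ?mulr_ge0 ?(ltW g0) ?(ltW k0)//.
  rewrite normrX exprn_ile1// normrN ger0_norm//.
  by rewrite invf_le1// ler1n.
by rewrite lef_pV2 ?posrE ?mulr_gt0// [leLHS]mulrC ler_pM2l.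
Qed.

Lemma bessel_coef_rec z k : 0 < z ->
  k.+1%:R * (k%:R + z + 1) * bessel_coef z k.+1 + bessel_coef z k / 4 = 0.
Proof.
move=> z0; have k0 : 0 <= k%:R :> R by [].
have Gk : 0 < Gamma (k%:R + z + 1) by apply: Gamma_gt0; lra.
rewrite /bessel_coef (_ : k.+1%:R + z + 1 = (k%:R + z + 1) + 1); last by rewrite -natr1; ring.
rewrite (@GammaS _ (k%:R + z + 1)); last by lra.
rewrite factS natrM exprS; field.
rewrite (gt_eqF Gk) !pnatr_eq0 /= -lt0n fact_gt0 gt_eqF//; lra.
Qed.

Lemma bessel_ode z y : 0 < z ->
  y * bessel_fun'' z y + (z + 1) * bessel_fun' z y + bessel_fun z y / 4 = 0.
Proof.
move=> z0; pose G := (Gamma (z + 1))^-1.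
have b0 k : `|bessel_coef z k| <= G / k`!%:R by exact: bessel_coef_le.
have b1 := pseries_diffs_fact b0.
have b2 := pseries_diffs_fact b1.
have c0 := @pseries_abs_cvg _ _ y b0.
have c1 := @pseries_abs_cvg _ _ y b1.
have c2 := @pseries_abs_cvg _ _ y b2.
pose s n := y * pseries (pseries_diffs (pseries_diffs (bessel_coef z))) y n +
  (z + 1) * pseries (pseries_diffs (bessel_coef z)) y n.+1 +
  pseries (bessel_coef z) y n.+1 / 4.
have sl : s n @[n --> \oo] -->
    y * bessel_fun'' z y + (z + 1) * bessel_fun' z y + bessel_fun z y / 4.
  apply: cvgD; [apply: cvgD|].
  - by apply: cvgM; [exact: cvg_cst|exact: c2].
  - apply: cvgM; first exact: cvg_cst.
    by apply: (cvg_trans _ c1); rewrite (cvg_shiftS (pseries _ y)).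
  - apply: cvgM; last exact: cvg_cst.
    by apply: (cvg_trans _ c0); rewrite (cvg_shiftS (pseries _ y)).
apply: (cvg_unique _ sl) => //.
rewrite (_ : s = cst 0); first exact: cvg_cst.
apply/funext => n; rewrite /s /pseries /series /=.
rewrite mulr_sumr.
(* Multiplying by y shifts the index by one; the new term i = 0 is zero, and n terms become n + 1,
   as in the other two sums. Then [bessel_coef_rec] cancels each power of y. *)
have -> : \sum_(0 <= i < n) (y * (pseries_diffs (pseries_diffs (bessel_coef z)) i * y ^+ i)) =
    \sum_(0 <= i < n.+1) (i%:R * i.+1%:R * bessel_coef z i.+1 * y ^+ i).
  rewrite big_nat_recl//= !mul0r add0r; apply: eq_bigr => i _.
  by rewrite /pseries_diffs exprS; ring.
rewrite mulr_sumr mulr_suml -!big_split /=; apply: big1 => i _.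
rewrite -[RHS](mul0r (y ^+ i)) -(bessel_coef_rec i z0) /pseries_diffs.
by move: (bessel_coef z i) (bessel_coef z i.+1) => b c; rewrite -natr1; ring.
Qed.

(** The constant term 1/Gamma(z+1) dominates: by the recursion the coefficients of positive index
    carry an extra factor 1/(z+1), so the remainder is at most e^{|x|} / ((z+1) Gamma(z+1)). *)
Lemma bessel_fun_neq0 x z : 0 < z -> expR `|x| < z + 1 -> bessel_fun z x != 0.
Proof.
move=> z0 xz; have G0 : 0 < Gamma (z + 1) by apply: Gamma_gt0; lra.
pose c k := if k is 0%N then 0 else bessel_coef z k.
have cG k : `|c k| <= ((z + 1)^-1 * (Gamma (z + 1))^-1) / k`!%:R.
  case: k => [|k]; first by rewrite /c normr0 !mulr_ge0// invr_ge0 ?(ltW G0)//; lra.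
  have k1 : 0 < k.+1%:R :> R by [].
  have k0 : 0 <= k%:R :> R by [].
  have zk : 0 < k%:R + z + 1 by lra.
  have e : k.+1%:R * (k%:R + z + 1) * `|bessel_coef z k.+1| = `|bessel_coef z k| / 4.
    rewrite -(gtr0_norm (mulr_gt0 k1 zk)) -normrM.
    rewrite -[4^-1]ger0_norm// -normrM -normrN; congr `|_|.
    by have /eqP := bessel_coef_rec k z0; rewrite addr_eq0 => /eqP ->; rewrite opprK.
  rewrite /c -(ler_pM2l (mulr_gt0 k1 zk)) e.
  apply: (@le_trans _ _ ((Gamma (z + 1))^-1 / k`!%:R)).
    apply: le_trans (bessel_coef_le k z0); rewrite ler_piMr//.
    by rewrite invf_le1// ler1n.
  have z1 : 0 < z + 1 by lra.
  have g0 : 0 <= (Gamma (z + 1))^-1 / k`!%:R by rewrite divr_ge0 ?invr_ge0 ?(ltW G0).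
  rewrite factS natrM invfM.
  rewrite [leRHS](_ : _ = (Gamma (z + 1))^-1 / k`!%:R * ((k%:R + z + 1) / (z + 1))).
    by rewrite ler_peMr// ler_pdivlMr//; lra.
  move: (Gamma (z + 1))^-1 (k`!%:R)^-1 => A B.
  by field; rewrite gt_eqF//= pnatr_eq0.
have c_cvg := @pseries_abs_cvg _ _ x cG.
have b0 k : `|bessel_coef z k| <= (Gamma (z + 1))^-1 / k`!%:R by exact: bessel_coef_le.
have b_cvg := @pseries_abs_cvg _ _ x b0.
have E : bessel_fun z x = (Gamma (z + 1))^-1 + limn (pseries c x).
  have cv1 : pseries (bessel_coef z) x n.+1 @[n --> \oo] --> bessel_fun z x.
    by apply: (cvg_trans _ b_cvg); rewrite (cvg_shiftS (pseries _ x)).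
  apply: (cvg_unique _ cv1) => //; have -> : (fun n => pseries (bessel_coef z) x n.+1) =
      (fun n => (Gamma (z + 1))^-1 + pseries c x n.+1).
    apply/funext => n; rewrite /pseries /series /= !big_nat_recl//= /c mul0r add0r.
    by rewrite /bessel_coef !expr0 fact0 !mul1r add0r mulr1.
  apply: cvgD; first exact: cvg_cst.
  by apply: (cvg_trans _ c_cvg); rewrite (cvg_shiftS (pseries _ x)).
have h := @pseries_lim_le _ _ x cG.
apply/negP => /eqP S0; move: h; rewrite E in S0.
have -> : limn (pseries c x) = - (Gamma (z + 1))^-1 by lra.
rewrite normrN gtr0_norm ?invr_gt0// leNgt => /negP; apply.
rewrite mulrAC -[ltRHS]mul1r ltr_pM2r ?invr_gt0//.
by rewrite mulrC ltr_pdivrMr ?mul1r//; lra.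
Qed.

End bessel_series.


(** * From complex Bessel functions to the real series *)

Section complex_bessel.
Context {R : realType}.
Implicit Types (nu x y e t z kappa : R) (w : R[i]).
Local Open Scope complex_scope.

Lemma cvg_real_complex (f : R ^nat) (l : R) : f n @[n --> \oo] --> l ->
  ((f n)%:C : R[i]^o) @[n --> \oo] --> (l%:C : R[i]^o).
Proof.
move=> fl; apply/cvgrPdist_lt => e e0.
have eE : e = (complex.Re e)%:C by apply/esym/RRe_real/gtr0_real.
have e0' : 0 < complex.Re e by rewrite -ltcR -eE.
move/cvgrPdist_lt : fl => /(_ _ e0'); apply: filterS => n.
by rewrite -rmorphB /= normc_def /= expr0n addr0 sqrtr_sqr eE ltcR.
Qed.

Lemma besselJ_series nu w y : 0 < nu -> w ^+ 2 = y%:C ->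
  besselJ nu w = cpow (w / 2) nu * (bessel_fun nu y)%:C.
Proof.
move=> nu0 wy; rewrite /besselJ; congr (_ * _).
have bG k := bessel_coef_le k nu0.
have cv := @pseries_abs_cvg _ _ _ y bG.
apply: (@cvg_lim R[i]^o); first exact: norm_hausdorff.
rewrite (_ : series _ = fun n => ((pseries (bessel_coef nu) y n)%:C : R[i]^o)).
  exact: cvg_real_complex cv.
apply/funext => n; rewrite /pseries /series /= rmorph_sum /=; apply: eq_bigr => k _.
rewrite exprM expr_div_n wy -natrX /bessel_coef.
rewrite !(rmorphM, fmorphV, rmorphXn, rmorphN, rmorph_nat) /=.
rewrite exprMn [in RHS]exprNn.
by rewrite -!mulrA; congr (_ * _); rewrite [RHS]mulrCA; congr (_ * _); rewrite mulrC.
Qed.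

Lemma normc_scale w e : 0 < e ->
  ComplexField.Normc.normc (w * e%:C) = ComplexField.Normc.normc w * e.
Proof.
move=> e0; case: w => a b /=; rewrite !mulr0 subr0 add0r.
rewrite !exprMn -mulrDl sqrtrM ?addr_ge0 ?sqr_ge0//.
by rewrite sqrtr_sqr gtr0_norm.
Qed.

Lemma normc_gt0 w : w != 0 -> 0 < ComplexField.Normc.normc w.
Proof.
move=> w0; rewrite lt_neqAle; apply/andP; split; last first.
  by case: w {w0} => a b; rewrite /= sqrtr_ge0.
by apply: contra_neq w0 => /esym/ComplexField.Normc.eq0_normc.
Qed.

Lemma cpow_scale w e nu : w != 0 -> 0 < e ->
  cpow (w * e%:C) nu = cpow w nu * (e `^ nu)%:C.
Proof.
move=> w0 e0; have nw := normc_gt0 w0.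
have cE : carg (w * e%:C) = carg w.
  rewrite /carg normc_scale//.
  have -> : complex.Re (w * e%:C) = complex.Re w * e.
    by case: w {w0 nw} => a b /=; rewrite mulr0 subr0.
  have -> : complex.Im (w * e%:C) = complex.Im w * e.
    by case: w {w0 nw} => a b /=; rewrite mulr0 add0r.
  rewrite -mulf_div divff ?gt_eqF// mulr1.
  by rewrite pmulr_lge0.
rewrite /cpow cE normc_scale// powRM ?(ltW nw) ?(ltW e0)//.
by rewrite rmorphM /= mulrAC.
Qed.

Lemma cpow_neq0 w nu : w != 0 -> cpow w nu != 0.
Proof.
move=> w0; rewrite /cpow mulf_neq0//.
  by rewrite fmorph_eq0 gt_eqF// powR_gt0// normc_gt0.
rewrite eq_complex /= negb_and; case: eqVneq => //= c0; apply/eqP => s0.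
have := cos2Dsin2 (nu * carg w); rewrite c0 s0 !expr0n /= addr0 => /esym/eqP.
by rewrite oner_eq0.
Qed.

(** The two powers (w/2)^z differ by a positive scaling, which leaves the argument unchanged, so
    their quotient is the real number e^{-zt}. This puts both signs of kappa, and kappa = 0, under
    one formula. *)
Lemma u_bessel z t kappa : 0 < z -> bessel_fun z kappa != 0 ->
  u z t kappa = expR (- (z * t)) * (bessel_fun z (kappa * expR (- (2 * t))) / bessel_fun z kappa).
Proof.
move=> z0 S0; rewrite /u; have [k0|k0] := eqVneq kappa 0.
  by rewrite k0 mul0r divff ?mulr1//; rewrite k0 in S0.
pose w := sqrtC kappa%:C.
have w2 : w ^+ 2 = kappa%:C by rewrite sqrtCK.
have w0 : w != 0 by rewrite sqrtC_eq0 fmorph_eq0.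
have e0 : 0 < expR (- t) by exact: expR_gt0.
rewrite -/w (besselJ_series z0 w2).
have wt2 : (w * (expR (- t))%:C) ^+ 2 = (kappa * expR (- (2 * t)))%:C.
  rewrite exprMn w2 -rmorphXn -rmorphM /=; congr ((_ * _)%:C).
  by rewrite -expRM_natl; congr expR; ring.
rewrite (besselJ_series z0 wt2) [w * _ / 2]mulrAC cpow_scale//; last by rewrite mulf_neq0.
have c0 : cpow (w / 2) z != 0 by rewrite cpow_neq0// mulf_neq0.
rewrite -[X in X / _]mulrA -mulf_div divff// mul1r.
rewrite -rmorphM -fmorphV -rmorphM /=.
by rewrite -expRM mulrA; congr (expR _ * _ / _); ring.
Qed.

End complex_bessel.


(** * The function u solves the equation for V_kappa *)

Section exponential_potential.
Context {R : realType}.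
Notation mu := (@lebesgue_measure R).
Implicit Types (kappa t y z : R) (S : R -> R).

Lemma V_inA1 kappa : inA1 (V kappa).
Proof.
have oD : open (`]0%R, +oo[%classic : set R) by exact: interval_open.
have iV : mu.-integrable `]0%R, +oo[ (EFin \o V kappa).
  rewrite integrable_mkcond//.
  pose f x := - kappa * ((0 < x)%R%:R * expR (- 2 * x)).
  have me : measurable_fun setT (fun x : R => (0 < x)%R%:R * expR (- 2 * x)) by meas.
  have e0 x : 0 <= (0 < x)%R%:R * expR (- 2 * x) by rewrite mulr_ge0 ?expR_ge0.
  have ie : mu.-integrable setT (EFin \o (fun x : R => (0 < x)%R%:R * expR (- 2 * x))).
    apply: (@integrable_boundT _ _ _ mu _ 2^-1) => //.
    rewrite -(@integral_exp_halfline R 2)// le_eqVlt; apply/orP; left; apply/eqP.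
    by apply: eq_integral => x _; rewrite ger0_norm.
  have := integrable_scale (- kappa) ie.
  apply: eq_integrable => // x _ /=.
  rewrite patchE mem_setE in_itv/= andbT indicator_patch /V.
  by case: ifP => _; rewrite ?mulr0// mulNr.
split; first exact: open_integrable_locally.
have /integrableP[mV] := iV; apply: le_lt_trans.
apply: ge_ereal_sup => _ [x + <-]; rewrite /= in_itv/= andbT => x0.
apply: ge0_subset_integral => //.
  apply/measurable_EFinP/measurableT_comp => //; apply: measurable_funTS.
  by rewrite /V; meas.
by move=> y; rewrite /= !in_itv/= andbT => /andP[xy _]; exact: lt_trans xy.
Qed.

(** A family closed under differentiation in t: differentiating the inner exponential replaces S by
    its derivative and z by z + 2. *)
Definition damped kappa z S t := expR (- z * t) * S (kappa * expR (- 2 * t)).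

Lemma is_derive_damped kappa z S S' t : (forall y : R, is_derive y 1 S (S' y)) ->
  is_derive t 1 (damped kappa z S)
    (- z * damped kappa z S t - 2 * kappa * damped kappa (z + 2) S' t).
Proof.
move=> dS; have d1 : is_derive t (1 : R) (fun t => expR (- z * t)) (- z * expR (- z * t)).
  exact: is_derive_expRM.
have d2 : is_derive t (1 : R) (fun t => kappa * expR (- 2 * t)) (kappa * (- 2 * expR (- 2 * t))).
  exact: (is_deriveZ kappa (is_derive_expRM (- 2) t)).
have d3 := dS (kappa * expR (- 2 * t)).
have d4 : is_derive t (1 : R) (S \o (fun t => kappa * expR (- 2 * t)))
    (S' (kappa * expR (- 2 * t)) * (kappa * (- 2 * expR (- 2 * t)))).
  exact: is_derive1_comp.
have : is_derive t (1 : R) (damped kappa z S) _ := is_deriveM d1 d4.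
move/is_derive_eq; apply.
rewrite /GRing.scale/= /damped.
rewrite (_ : expR (- (z + 2) * t) = expR (- z * t) * expR (- 2 * t)).
  by ring.
by rewrite -expRD; congr expR; ring.
Qed.

Lemma continuous_damped kappa z S S' : (forall y : R, is_derive y 1 S (S' y)) ->
  continuous (damped kappa z S).
Proof.
move=> dS t; have := is_derive_damped kappa z t dS => d.
exact/differentiable_continuous/derivable1_diffP.
Qed.

Theorem u_L2_solution kappa z : 0 < z -> expR `|kappa| < z + 1 ->
  exists u', L2_solution (V kappa) (- z ^+ 2) (fun t => u z t kappa) u'.
Proof.
move=> z0 kz; have S0 := bessel_fun_neq0 z0 kz.
pose s := (bessel_fun z kappa)^-1.
have uE t : u z t kappa = s * damped kappa z (bessel_fun z) t.
  rewrite (u_bessel t z0 S0) /damped /s.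
  rewrite -!mulNr; move: (bessel_fun z (kappa * _)) (bessel_fun z kappa)^-1 => x y.
  by ring.
have b0 k : `|bessel_coef z k| <= (Gamma (z + 1))^-1 / k`!%:R by exact: bessel_coef_le.
have b1 := pseries_diffs_fact b0.
have b2 := pseries_diffs_fact b1.
have dS0 y : is_derive y (1 : R) (bessel_fun z) (bessel_fun' z y) by exact: is_derive_pseries b0.
have dS1 y : is_derive y (1 : R) (bessel_fun' z) (bessel_fun'' z y) by exact: is_derive_pseries b1.
have dS2 y : is_derive y (1 : R) (bessel_fun'' z) _ := is_derive_pseries y b2.
pose D0 := damped kappa z (bessel_fun z).
pose D1 := damped kappa (z + 2) (bessel_fun' z).
pose D2 := damped kappa (z + 2 + 2) (bessel_fun'' z).
have c0 : continuous D0 by exact: continuous_damped dS0.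
have c1 : continuous D1 by exact: continuous_damped dS1.
have c2 : continuous D2 by exact: continuous_damped dS2.
pose u' t := s * (- z * D0 t - 2 * kappa * D1 t).
pose u'' t := s * (- z * (- z * D0 t - 2 * kappa * D1 t) -
  2 * kappa * (- (z + 2) * D1 t - 2 * kappa * D2 t)).
have cC (c : R) (f : R -> R) : continuous f -> continuous (fun t => c * f t).
  by move=> cf t; apply: cvgM; [exact: cvg_cst|exact: cf].
have cB (f g : R -> R) : continuous f -> continuous g -> continuous (fun t => f t - g t).
  by move=> cf cg t; apply: cvgB; [exact: cf|exact: cg].
have d0 t : is_derive t (1 : R) D0 (- z * D0 t - 2 * kappa * D1 t).
  exact: is_derive_damped dS0.
have d1 t : is_derive t (1 : R) D1 (- (z + 2) * D1 t - 2 * kappa * D2 t).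
  exact: is_derive_damped dS1.
have -> : (fun t => u z t kappa) = fun t => s * D0 t by apply/funext => t; rewrite uE.
exists u'; split.
- exists u''; split.
  + apply: smooth_loc_abs_primitive; last by apply/cC/cB; apply/cC.
  + apply: smooth_loc_abs_primitive.
    by apply/cC/cB; apply/cC/cB; apply/cC.
  + apply: aeW => t _; rewrite /u'' /D0 /D1 /D2 /damped /V.
    set X := expR (- z * t); set W := expR (- 2 * t).
    have -> : expR (- (2 * t)) = W by congr expR; ring.
    have -> : expR (- (z + 2) * t) = X * W by rewrite -expRD; congr expR; ring.
    have -> : expR (- (z + 2 + 2) * t) = X * W * W by rewrite -!expRD; congr expR; ring.
    have := bessel_ode (kappa * W) z0.
    move: (bessel_fun z (kappa * W)) (bessel_fun' z (kappa * W)) (bessel_fun'' z (kappa * W)).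
    move=> S T U ode.
    (* The series equation at y = kappa e^{-2t} eliminates [S]; the Schroedinger equation becomes a
       polynomial identity. *)
    have -> : S = - 4 * (kappa * W * U + (z + 1) * T) by move: ode; lra.
    by ring.
- by rewrite /s /D0 /damped !mulr0 expR0 mulr1 mul1r mulVf.
- pose C := (`|s| * ((Gamma (z + 1))^-1 * expR `|kappa|)) ^+ 2.
  have C0 : 0 <= C by exact: sqr_ge0.
  have z20 : 0 < 2 * z by rewrite mulr_gt0.
  have mD : measurable_fun setT (fun x => (s * D0 x) ^+ 2).
    by apply: measurable_funX; apply: continuous_measurable_fun; exact: cC.
  rewrite integral_mkcond; apply: (@le_lt_trans _ _ (C * (2 * z)^-1)%:E); last exact: ltry.
  have me : measurable_fun setT (fun x : R => (0 < x)%R%:R * expR (- (2 * z) * x)) by meas.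
  have ge0e x : 0 <= (0 < x)%R%:R * expR (- (2 * z) * x) by rewrite mulr_ge0 ?expR_ge0.
  rewrite EFinM -(integral_exp_halfline z20) -(@ge0_integral_scale _ _ _ mu _ _ C0 me ge0e).
  rewrite (_ : (_ \_ _)%E = fun x => ((0 < x)%R%:R * (s * D0 x) ^+ 2)%:E); last first.
    apply/funext => x; rewrite patchE mem_setE in_itv/= andbT indicator_patch.
    by case: ifP.
  apply: le_integral_bound => //; [by meas|by meas|by move=> x; rewrite mulr_ge0 ?sqr_ge0|].
  move=> x; case: ltP => [x0|_]; last by rewrite !mul0r mulr0.
  rewrite !mul1r (_ : expR _ = expR (- z * x) ^+ 2); last first.
    by rewrite expr2 -expRD; congr expR; ring.
  rewrite /C -exprMn -[leLHS]real_normK ?num_real// lerXn2r ?nnegrE ?mulr_ge0 ?expR_ge0//.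
    by rewrite invr_ge0 ltW// Gamma_gt0//; lra.
  rewrite normrM -mulrA ler_wpM2l// /D0 /damped normrM (gtr0_norm (expR_gt0 _)) mulrC.
  rewrite ler_wpM2r ?expR_ge0//.
  apply: le_trans (pseries_lim_le _ b0) _.
  rewrite ler_wpM2l ?invr_ge0 ?(ltW (Gamma_gt0 _))//; first by lra.
  rewrite ler_expR normrM (gtr0_norm (expR_gt0 _)) ler_piMr// -[leRHS]expR0 ler_expR.
  by rewrite mulNr oppr_le0 mulr_ge0// ltW.
Qed.

End exponential_potential.


(** * Inverting the Volterra operators *)

Section volterra_gronwall.
Context {R : realType}.
Notation mu := (@lebesgue_measure R).
Implicit Types (M a z t s : R) (K L : R * R -> R) (D B G : R -> R).

Lemma exp_kernel_norm M K : exp_kernel M K -> exp_kernel M (fun x => `|K x|).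
Proof.
move=> [mK Kle K0]; split.
- exact: measurableT_comp.
- by move=> t r; rewrite normr_id.
- by move=> t r r0; rewrite K0// normr0.
Qed.

Lemma measurable_volterra_term D K : measurable_fun setT D -> measurable_fun setT K ->
  measurable_fun setT (fun s => \int[mu]_t (D t * K (t, s - t))).
Proof.
move=> mD mK; apply: (@measurable_Rintegral2 _ _ _ _ _ mu
  (fun x : R * R => D x.2 * K (x.2, x.1 - x.2))).
have mK' : measurable_fun setT (fun x : R * R => K (x.2, x.1 - x.2)).
  apply: (measurableT_comp mK).
  by apply: measurable_fun_pair; [exact: measurable_snd|exact: measurable_funB].
by apply: measurable_funM => //; exact: measurableT_comp.
Qed.

Lemma integrable_exp_weight D z : 0 <= z -> mu.-integrable setT (EFin \o D) ->
  (forall t, t <= 0 -> D t = 0) ->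
  mu.-integrable setT (EFin \o (fun s => expR (- (2 * z) * s) * D s)).
Proof.
move=> z0 iD D0; have mD := integrable_measurable iD.
apply: (@integrable_leT _ _ _ mu _ (fun s => `|D s|)).
- have me : measurable_fun setT (fun s : R => expR (- (2 * z) * s)) by meas.
  by meas.
- move=> s; have [s0|s0] := leP s 0; first by rewrite D0// mulr0 normr0.
  rewrite normrM ger0_norm ?expR_ge0// ler_piMl// -[leRHS]expR0 ler_expR.
  by rewrite mulNr oppr_le0; apply: mulr_ge0 (ltW s0); rewrite mulr_ge0.
- exact: integrable_norm.
Qed.

(** The rate 3M corresponds to z = 3M/2, where [laplace_le] applied to |K| gives M / (3M - M) =
    1/2. *)
Lemma volterra_term_le M K D : exp_kernel M K -> 0 < M ->
  mu.-integrable setT (EFin \o D) -> (forall t, t <= 0 -> D t = 0) ->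
  (\int[mu]_s (expR (- (3 * M) * s) * `|\int[mu]_t (D t * K (t, s - t))|)%:E <=
   (\int[mu]_s (expR (- (3 * M) * s) * `|D s|) / 2)%:E)%E.
Proof.
move=> KM M0 iD D0.
pose z := 3 * M / 2.
have zE : 3 * M = 2 * z by rewrite [RHS]mulrC divfK.
have hM : M / (3 * M - M) <= 2^-1 by rewrite ler_pdivrMr; lra.
rewrite zE in hM.
rewrite zE.
have z0 : 0 <= z by rewrite /z divr_ge0// mulr_ge0// ltW.
have Mz : M < 2 * z by rewrite -zE; lra.
have mD := integrable_measurable iD.
have KN := exp_kernel_norm KM.
have [mK _ _] := KM; have [mKN _ _] := KN.
have iG : mu.-integrable setT (EFin \o (fun s => `|D s|)) by exact: integrable_norm.
have mG := integrable_measurable iG.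
have G0 t : t <= 0 -> `|D t| = 0 by move=> t0; rewrite D0// normr0.
have iGe := integrable_exp_weight z0 iG G0.
have [i1 E1] := laplace_volterra KN (ltW M0) Mz mG G0 iGe.
have me : measurable_fun setT (fun s : R => expR (- (2 * z) * s)) by meas.
have mT := measurable_volterra_term mD mK.
have mTN := measurable_volterra_term mG mKN.
apply: (@le_trans _ _ (\int[mu]_s (expR (- (2 * z) * s) * \int[mu]_t (`|D t| * `|K (t, s - t)|)))%:E).
  rewrite (Rintegral_EFin i1); apply: le_integral_bound; [by meas|by meas|by move=> s; rewrite mulr_ge0 ?expR_ge0|].
  move=> s; rewrite ler_wpM2l ?expR_ge0//.
  apply: Rintegral_norm_le.
  - have mKs : measurable_fun setT (fun t => K (t, s - t)).
      apply: (measurableT_comp mK).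
      apply: measurable_fun_pair; first exact: measurable_id.
      by apply: measurable_funB => //; exact: measurable_cst.
    by meas.
  - by move=> t; rewrite normrM.
  - exact: volterra_integrable KN (ltW M0) z0 mG G0 iGe.
rewrite lee_fin E1.
have mL := measurable_laplace z mKN.
have L2 t : laplace (fun x => `|K x|) z t <= 2^-1.
  apply: le_trans (ler_norm _) _; apply: le_trans (laplace_le _ KN (ltW M0) Mz) _.
  exact: hM.
have L0 t : 0 <= laplace (fun x => `|K x|) z t.
  by apply: Rintegral_ge0 => r _; rewrite mulr_ge0 ?expR_ge0.
apply: le_trans (ler_norm _) _.
rewrite -RintegralZr//.
apply: Rintegral_norm_le.
- by meas.
- move=> t; rewrite normrM (ger0_norm (L0 t)) ler_pM// normrM normr_id.
  by rewrite (gtr0_norm (expR_gt0 _)).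
- have := integrable_scale 2^-1 iGe.
  by apply: eq_integrable; [by []|move=> t _; rewrite /= mulrC].
Qed.

(** For the weighted norms x of D and y of B, solving the identity for D gives x <= y + y/2 + x/2,
    hence x <= 3y. As D vanishes beyond a, removing the weight costs the factor e^{3Ma}. *)
Lemma volterra_gronwall M K L D B a : exp_kernel M K -> exp_kernel M L -> 0 < M -> 0 < a ->
  mu.-integrable setT (EFin \o D) -> mu.-integrable setT (EFin \o B) ->
  (forall t, t <= 0 -> D t = 0) -> (forall t, t <= 0 -> B t = 0) ->
  (forall t, a <= t -> D t = 0) ->
  {ae mu, forall s, s < a -> volterra K D s = volterra L B s} ->
  \int[mu]_s `|D s| <= 3 * expR (3 * M * a) * \int[mu]_s `|B s|.
Proof.
move=> KM LM M0 a0 iD iB D0 B0 Da DB.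
have M30 : 0 <= 3 * M / 2 by rewrite divr_ge0// mulr_ge0// ltW.
have wE s : expR (- (3 * M) * s) = expR (- (2 * (3 * M / 2)) * s).
  by rewrite [2 * _]mulrC divfK.
have iDn : mu.-integrable setT (EFin \o (fun s => `|D s|)) by exact: integrable_norm.
have iBn : mu.-integrable setT (EFin \o (fun s => `|B s|)) by exact: integrable_norm.
have Dn0 t : t <= 0 -> `|D t| = 0 by move=> t0; rewrite D0// normr0.
have Bn0 t : t <= 0 -> `|B t| = 0 by move=> t0; rewrite B0// normr0.
have iDw : mu.-integrable setT (EFin \o (fun s => expR (- (3 * M) * s) * `|D s|)).
  have := integrable_exp_weight M30 iDn Dn0.
  by apply: eq_integrable; [by []|move=> s _; rewrite /= wE].
have iBw : mu.-integrable setT (EFin \o (fun s => expR (- (3 * M) * s) * `|B s|)).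
  have := integrable_exp_weight M30 iBn Bn0.
  by apply: eq_integrable; [by []|move=> s _; rewrite /= wE].
have tD := volterra_term_le KM M0 iD D0.
have tB := volterra_term_le LM M0 iB B0.
have mD := integrable_measurable iD.
have mB := integrable_measurable iB.
have [mK _ _] := KM; have [mL _ _] := LM.
have mtD := measurable_volterra_term mD mK.
have mtB := measurable_volterra_term mB mL.
have me : measurable_fun setT (fun s : R => expR (- (3 * M) * s)) by meas.
pose x := \int[mu]_s (expR (- (3 * M) * s) * `|D s|).
pose y := \int[mu]_s (expR (- (3 * M) * s) * `|B s|).
have xy : x <= y + (y / 2 + x / 2).
  rewrite -lee_fin /x (Rintegral_EFin iDw).
  pose f1 s := (expR (- (3 * M) * s) * `|B s|)%:E.
  pose f2 s := (expR (- (3 * M) * s) * `|\int[mu]_t (B t * L (t, s - t))|)%:E.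
  pose f3 s := (expR (- (3 * M) * s) * `|\int[mu]_t (D t * K (t, s - t))|)%:E.
  have m1 : measurable_fun setT f1 by apply/measurable_EFinP; meas.
  have m2 : measurable_fun setT f2 by apply/measurable_EFinP; meas.
  have m3 : measurable_fun setT f3 by apply/measurable_EFinP; meas.
  have p1 s : (0 <= f1 s)%E by rewrite lee_fin mulr_ge0 ?expR_ge0.
  have p2 s : (0 <= f2 s)%E by rewrite lee_fin mulr_ge0 ?expR_ge0.
  have p3 s : (0 <= f3 s)%E by rewrite lee_fin mulr_ge0 ?expR_ge0.
  apply: (@le_trans _ _ (\int[mu]_s (f1 s + (f2 s + f3 s)))%E).
    apply: ae_ge0_le_integral; [exact: measurableT|
      by move=> s _; rewrite lee_fin mulr_ge0 ?expR_ge0|by apply/measurable_EFinP; meas|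
      by move=> s _; rewrite !adde_ge0|
      by apply: emeasurable_funD; [exact: m1|exact: emeasurable_funD]|].
    move: DB; apply: filterS; first exact: (ae_filter_ringOfSetsType mu).
    move=> s sDB _; rewrite -!EFinD lee_fin -!mulrDr ler_wpM2l ?expR_ge0//.
    have [sa|sa] := ltP s a; last by rewrite Da// normr0 !addr_ge0.
    have := sDB sa; rewrite /volterra => /(canRL (addrK _)) ->.
    rewrite -addrA (le_trans (ler_normD _ _))// lerD2l.
    exact: ler_normB.
  rewrite ge0_integralD//; last 2 first.
  - by move=> s _; rewrite adde_ge0.
  - exact: emeasurable_funD.
  rewrite ge0_integralD// !EFinD; apply: leeD; last by apply: leeD.
  by rewrite /y (Rintegral_EFin iBw).
have x3y : x <= 3 * y by move: xy; lra.
have yB : y <= \int[mu]_s `|B s|.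
  rewrite -lee_fin /y (Rintegral_EFin iBw) (Rintegral_EFin iBn).
  apply: le_integral_bound; [by meas|by meas|by move=> s; rewrite mulr_ge0 ?expR_ge0|].
  move=> s; have [s0|s0] := leP s 0; first by rewrite Bn0// mulr0.
  rewrite ler_piMl// -[leRHS]expR0 ler_expR.
  by rewrite mulNr oppr_le0; apply: mulr_ge0 (ltW s0); rewrite mulr_ge0// ltW.
have Dx : expR (- (3 * M * a)) * \int[mu]_s `|D s| <= x.
  rewrite -RintegralZl// -lee_fin /x (Rintegral_EFin iDw).
  rewrite (Rintegral_EFin (integrable_scale _ iDn)).
  apply: le_integral_bound; [by meas|by meas|by move=> s; rewrite mulr_ge0 ?expR_ge0|].
  move=> s; have [sa|sa] := ltP s a; last by rewrite Da// normr0 !mulr0.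
  rewrite ler_wpM2r// ler_expR mulNr lerN2 ler_pM2l ?(ltW sa)//.
  by rewrite mulr_gt0.
have e0 := expR_gt0 (3 * M * a).
rewrite -(ler_pM2l (expR_gt0 (- (3 * M * a)))).
rewrite expRN mulrA [X in _ <= X * _]mulrCA mulVf ?gt_eqF// mulr1 -expRN.
by apply: le_trans Dx _; move: x3y yB; lra.
Qed.

End volterra_gronwall.


(** * Amplitudes in L^1_s and the tail beyond a *)

Section amplitude_volterra.
Context {R : realType}.
Notation mu := (@lebesgue_measure R).
Implicit Types (Q A w : R -> R) (a z t s sigma K N kappa : R).

Lemma exp_mean_leW Q K K' : K <= K' -> exp_mean_le Q K -> exp_mean_le Q K'.
Proof. by move=> KK' QK t; apply: le_trans (QK t) _; rewrite lee_fin. Qed.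

Lemma inA1_integrable_cutoff Q a : inA1 Q -> mu.-integrable setT (EFin \o cutoff a Q).
Proof.
move=> QA; have mQ := measurable_cutoff a QA; have mq := inA1_measurable QA.
have [K K0 QK] := inA1_weight QA.
have m1 : measurable_fun setT (fun s => (0 < s)%R%:R * (expR (- `|0 - s|) * `|Q s|)).
  rewrite (_ : (fun s => _) = (fun s => expR (- `|0 - s|) * `|(0 < s)%R%:R * Q s|)).
    by meas.
  by apply/funext => s; rewrite normrM ger0_norm//; ring.
apply: (@integrable_boundT _ _ _ mu _ (expR a * K)) => //.
rewrite EFinM; apply: le_trans (lee_wpmul2l _ (QK 0)); last by rewrite lee_fin expR_ge0.
rewrite -(@ge0_integral_scale _ _ _ mu _ _ (expR_ge0 a) m1); last first.
  by move=> s; rewrite !mulr_ge0 ?expR_ge0.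
apply: le_integral_bound; [by apply: measurableT_comp|by meas|by []|].
move=> s; rewrite /cutoff; case: (ltP 0 s) => [s0|_] /=; last by rewrite !mul0r normr0 mulr0.
case: ltP => [sa|_]; last by rewrite mul0r normr0 !mulr_ge0 ?expR_ge0.
rewrite !mul1r mulrA -expRD ler_peMl// -[leLHS]expR0 ler_expR.
by rewrite sub0r normrN gtr0_norm//; lra.
Qed.

Lemma truncated_kernel_exists Q a N : inA1 Q -> 0 < N ->
  (\int[mu]_s `|cutoff a Q s|%:E <= N%:E)%E -> exists k, truncated_kernel Q a N k.
Proof.
move=> QA N0 QN.
have [k kN kE] := kernel_exists (measurable_cutoff a QA) N0 QN (@cutoff_le0 _ a Q).
by exists k.
Qed.

Definition exp_damped sigma A t := (0 < t)%R%:R * (expR (- (2 * sigma) * t) * A t).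

Lemma L1s_integrable s sigma A : L1s s A -> s <= sigma ->
  mu.-integrable setT (EFin \o exp_damped sigma A).
Proof.
move=> [[mA _ _] Afin] ss.
have mA' : measurable_fun setT (fun t => (0 < t)%R%:R * A t).
  have := (measurable_restrictT _ (measurable_itv `]0%R, +oo[)).1 mA.
  apply: eq_measurable_fun => t _.
  by rewrite patchE mem_setE in_itv/= andbT indicator_patch.
have dE c t : exp_damped c A t = expR (- (2 * c) * t) * ((0 < t)%R%:R * A t).
  by rewrite /exp_damped; ring.
have md c : measurable_fun setT (exp_damped c A).
  rewrite (_ : exp_damped c A = fun t => expR (- (2 * c) * t) * ((0 < t)%R%:R * A t)).
    have me : measurable_fun setT (fun s : R => expR (- (2 * c) * s)) by meas.
    by meas.
  by apply/funext => t; exact: dE.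
have isA : mu.-integrable setT (EFin \o exp_damped s A).
  apply/integrableP; split; first by apply/measurable_EFinP; exact: md.
  apply: le_lt_trans Afin; rewrite [leRHS]integral_mkcond le_eqVlt; apply/orP; left; apply/eqP.
  apply: eq_integral => t _; rewrite patchE mem_setE in_itv/= andbT /exp_damped.
  case: ifP => _; last by rewrite mul0r normr0.
  by rewrite mul1r normrM ger0_norm ?expR_ge0// mulrC mulNr.
apply: (@integrable_leT _ _ _ mu _ (fun t => `|exp_damped s A t|)); first exact: md.
  move=> t; rewrite /exp_damped; case: (ltP 0 t) => t0; last by rewrite !mul0r.
  rewrite !mul1r !normrM ler_wpM2r// !ger0_norm ?expR_ge0// ler_expR.
  by rewrite !mulNr lerN2 ler_pM2r// ler_pM2l.
exact: integrable_norm.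
Qed.

Lemma integrable_cutoff_damped sigma A a : 0 <= sigma ->
  mu.-integrable setT (EFin \o exp_damped sigma A) ->
  mu.-integrable setT (EFin \o cutoff a A).
Proof.
move=> s0 iA; have mA := integrable_measurable iA.
have cE t : cutoff a A t = (0 < t < a)%R%:R * expR (2 * sigma * t) * exp_damped sigma A t.
  rewrite /cutoff /exp_damped; case: (boolP (_ && _)) => [/andP[t0 _]|_]; last by rewrite !mul0r.
  by rewrite t0 !mul1r mulrA -expRD mulNr addrN expR0 mul1r.
apply: (@integrable_leT _ _ _ mu _ (fun t => expR (2 * sigma * a) * `|exp_damped sigma A t|)).
- rewrite (_ : cutoff a A = fun t => (0 < t < a)%R%:R * expR (2 * sigma * t) * exp_damped sigma A t).
    have me : measurable_fun setT (fun s : R => expR (2 * sigma * s)) by meas.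
    by meas.
  by apply/funext => t; exact: cE.
- move=> t; rewrite cE normrM ler_wpM2r//.
  case: (boolP (_ && _)) => [/andP[t0 ta]|_]; last by rewrite mul0r normr0 expR_ge0.
  by rewrite mul1r ger0_norm ?expR_ge0// ler_expR ler_wpM2l ?mulr_ge0// ltW.
- exact/integrable_scale/integrable_norm.
Qed.

(** Since w^2 <= 16 e^{2t} e^{-2zt}, the integrand is at most 16 e^{-2(z-1-sigma)t} times the
    integrable function |[exp_damped sigma A]|, and beyond a the exponential is largest at t = a. *)
Lemma damped_square_tail sigma A w z a : 0 <= sigma -> 1 + sigma <= z ->
  mu.-integrable setT (EFin \o exp_damped sigma A) ->
  measurable_fun setT (fun t => (0 < t)%R%:R * w t) ->
  (forall t, 0 <= t -> `|expR (z * t) * w t| <= 4 * expR t) ->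
  mu.-integrable setT (EFin \o (fun t => (0 < t)%R%:R * (A t * w t ^+ 2))) /\
  `|\int[mu]_t ((0 < t)%R%:R * (A t * w t ^+ 2)) -
    \int[mu]_t cutoff a (fun t => A t * (w t * w t)) t| <=
  16 * expR (2 * (1 + sigma) * a) * (\int[mu]_t `|exp_damped sigma A t|) * expR (- (2 * z) * a).
Proof.
move=> s0 sz iA mw wle; have mA := integrable_measurable iA.
have me : measurable_fun setT (fun s : R => expR (2 * sigma * s)) by meas.
pose f t := (0 < t)%R%:R * (A t * w t ^+ 2).
have fE t : f t = expR (2 * sigma * t) * exp_damped sigma A t * ((0 < t)%R%:R * w t) ^+ 2.
  rewrite /f /exp_damped; case: (ltP 0 t) => _; last by rewrite !mul0r mulr0 mul0r.
  by rewrite !mul1r mulrA -expRD mulNr addrN expR0 mul1r.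
have mf : measurable_fun setT f.
  rewrite (_ : f = fun t => expR (2 * sigma * t) * exp_damped sigma A t * ((0 < t)%R%:R * w t) ^+ 2).
    by apply: measurable_funM; [meas|exact: measurable_funX].
  by apply/funext => t; exact: fE.
have fle t : `|f t| <= 16 * expR (- (2 * (z - 1 - sigma)) * t) * `|exp_damped sigma A t|.
  have [t0|t0] := leP t 0; first by rewrite /f ltNge t0 mul0r normr0 !mulr_ge0 ?expR_ge0.
  rewrite fE t0 mul1r normrM normrM (gtr0_norm (expR_gt0 _)) normrX.
  have wt : `|w t| <= 4 * expR t * expR (- z * t).
    have := wle t (ltW t0); rewrite normrM (gtr0_norm (expR_gt0 _)).
    by rewrite mulNr expRN -ler_pdivlMl ?expR_gt0// mulrC.
  have wt2 : `|w t| ^+ 2 <= (4 * expR t * expR (- z * t)) ^+ 2.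
    by rewrite lerXn2r ?nnegrE// !mulr_ge0 ?expR_ge0.
  rewrite mulrAC ler_wpM2r//.
  apply: (@le_trans _ _ (expR (2 * sigma * t) * (4 * expR t * expR (- z * t)) ^+ 2)).
    by rewrite ler_wpM2l ?expR_ge0.
  rewrite (_ : expR (- (2 * (z - 1 - sigma)) * t) =
    expR (2 * sigma * t) * (expR t * expR (- z * t)) ^+ 2).
    by rewrite le_eqVlt; apply/orP; left; apply/eqP; ring.
  by rewrite expr2 -!expRD; congr expR; ring.
have fi : mu.-integrable setT (EFin \o f).
  apply: (@integrable_leT _ _ _ mu _ (fun t => 16 * `|exp_damped sigma A t|)) => //.
    move=> t; have [t0|t0] := leP t 0; first by rewrite /f ltNge t0 mul0r normr0 mulr_ge0.
    apply: le_trans (fle t) _; rewrite ler_wpM2r// ler_piMr// -[leRHS]expR0 ler_expR.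
    by rewrite mulNr oppr_le0; apply: mulr_ge0 (ltW t0); rewrite mulr_ge0// subr_ge0; lra.
  exact/integrable_scale/integrable_norm.
split; first exact: fi.
have ci : mu.-integrable setT (EFin \o (fun t => f t * (t < a)%R%:R)).
  apply: (@integrable_leT _ _ _ mu _ (fun t => `|f t|)).
  - by meas.
  - by move=> t; rewrite normrM ler_piMr// ger0_norm// lern1; case: ltP.
  - exact: integrable_norm.
have -> : \int[mu]_t cutoff a (fun t => A t * (w t * w t)) t = \int[mu]_t (f t * (t < a)%R%:R).
  apply: eq_Rintegral => t _; rewrite /cutoff /f expr2.
  by case: (0 < t); case: (t < a); rewrite /= ?(mul1r, mul0r, mulr1, mulr0).
rewrite -(RintegralB measurableT fi ci).
rewrite [leRHS](_ : _ = 16 * expR (- (2 * (z - 1 - sigma)) * a) * \int[mu]_t `|exp_damped sigma A t|); last first.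
  rewrite (_ : expR (- (2 * (z - 1 - sigma)) * a) =
    expR (2 * (1 + sigma) * a) * expR (- (2 * z) * a)); first by ring.
  by rewrite -expRD; congr expR; ring.
have iN : mu.-integrable setT (EFin \o (fun t => `|exp_damped sigma A t|)) by exact: integrable_norm.
rewrite -RintegralZl//; apply: Rintegral_norm_le; [by meas| |exact: integrable_scale].
move=> t; have [ta|ta] := ltP t a.
  by rewrite mulr1 subrr normr0 !mulr_ge0 ?expR_ge0.
rewrite mulr0 subr0; apply: le_trans (fle t) _.
rewrite ler_wpM2r// ler_wpM2l// ler_expR !mulNr lerN2 ler_wpM2l// mulr_ge0// subr_ge0; lra.
Qed.

End amplitude_volterra.


(** * The Volterra identity between potentials and amplitudes *)

Section transformation.
Context {R : realType}.
Notation mu := (@lebesgue_measure R).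
Implicit Types (Q A w : R -> R) (a b z t s sigma K N M kappa : R) (k : R * R -> R).

Lemma volterra_le0 M k (D : R -> R) s : exp_kernel M k -> (forall t, t <= 0 -> D t = 0) ->
  s <= 0 -> volterra k D s = 0.
Proof.
move=> [_ _ k0] D0 s0; rewrite /volterra D0// add0r.
rewrite (@eq_Rintegral _ _ _ mu setT (cst 0)) ?Rintegral_cst ?mul0r// => t _.
have [t0|t0] := leP t 0; first by rewrite D0// mul0r.
by rewrite k0 ?mulr0// subr_le0 (le_trans s0)// ltW.
Qed.

Lemma ae_lt_sup (F : R -> R) a : (forall b, b < a -> {ae mu, forall s, s < b -> F s = 0}) ->
  {ae mu, forall s, s < a -> F s = 0}.
Proof.
move=> H; pose E n : set (measurableTypeR R) := ~` [set s | s < a - n.+1%:R^-1 -> F s = 0].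
have nE : mu.-negligible (\bigcup_n E n).
  by apply: negligible_bigcup => n; apply: H; rewrite ltrBlDr ltrDl invr_gt0.
have sE : ~` [set s | s < a -> F s = 0] `<=` \bigcup_n E n.
  move=> s /= /not_implyP[sa Fs].
  have as0 : 0 < a - s by rewrite subr_gt0.
  have [n _ hn] := near_infty_natSinv_lt (PosNum as0).
  exists n => //=; apply/not_implyP; split => //.
  by rewrite ltrBrDl -ltrBrDr; exact: hn n (leqnn n).
by case: nE => N [mN N0 EN]; exists N; split => //; exact: subset_trans sE EN.
Qed.

(** Absorbs the factor z of the Wronskian error at the price of an arbitrarily small loss from a to
    b. *)
Lemma mul_expR_le z a b : 0 <= z -> b < a ->
  z * expR (- (2 * z) * a) <= (a - b)^-1 * expR (- (2 * z) * b).
Proof.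
move=> z0 ba; have ab : 0 < a - b by rewrite subr_gt0.
rewrite -(ler_pM2l ab) [leRHS]mulrA divff ?gt_eqF// mul1r mulrA -ler_pdivlMr ?expR_gt0//.
rewrite -expRN -expRD; apply: le_trans (expR_ge1Dx _).
by nra.
Qed.

(** Bookkeeping for the comparison: P and P' are the integrals over (0,a) of (Q1 - Q2) v1 v2 and (A1
    - A2) u^2, I and J their Laplace representations, X the second integral over the whole
    half-line, W the Wronskian at a and d the difference of the Weyl functions. *)
Lemma wronskian_error (I J P P' X W d e1 e2 e3 e4 : R) :
  `|P - I| <= e1 -> `|P' - J| <= e2 -> `|X - P'| <= e3 -> `|W| <= e4 ->
  P = W - d -> d = - X -> `|I - J| <= e1 + e2 + e3 + e4.
Proof.
move=> h1 h2 h3 h4 PE dE.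
rewrite (_ : I - J = - (P - I) + (P' - J) + (X - P') + W); last by rewrite PE dE; ring.
rewrite (le_trans (ler_normD _ _))// lerD// (le_trans (ler_normD _ _))// lerD//.
by rewrite (le_trans (ler_normD _ _))// lerD// normrN.
Qed.

(* Both Volterra expressions represent int_0^a (Q1 - Q2) v1 v2 = int_0^a (A1 - A2) u^2, up to
   errors O(z e^(-2za)): the Wronskian at a, the tail of the amplitudes beyond a, and the
   influence of the potentials beyond a. *)
Lemma amplitude_volterra kappa a N Q1 Q2 A1 A2 : 0 < a -> 0 < N ->
  (\int[mu]_s `|cutoff a (V kappa) s|%:E <= N%:E)%E ->
  inA1 Q1 -> inA1 Q2 -> is_amplitude kappa Q1 A1 -> is_amplitude kappa Q2 A2 ->
  (\int[mu]_s `|cutoff a Q1 s|%:E <= N%:E)%E ->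
  (\int[mu]_s `|cutoff a Q2 s|%:E <= N%:E)%E ->
  exists K L : R * R -> R, [/\ exp_kernel (4 * ((2 * N) ^+ 2 + 2 * N + 1)) K,
    exp_kernel (4 * ((2 * N) ^+ 2 + 2 * N + 1)) L,
    mu.-integrable setT (EFin \o cutoff a (fun t => A1 t - A2 t)) &
    {ae mu, forall s, s < a -> volterra K (cutoff a (fun t => Q1 t - Q2 t)) s =
                               volterra L (cutoff a (fun t => A1 t - A2 t)) s}].
Proof.
move=> a0 N0 VN QA1 QA2 [[s1 s10 A1s] amp1] [[s2 s20 A2s] amp2] QN1 QN2.
have VA := V_inA1 kappa.
have [k1 tk1] := truncated_kernel_exists QA1 N0 QN1.
have [k2 tk2] := truncated_kernel_exists QA2 N0 QN2.
have [kV tkV] := truncated_kernel_exists VA N0 VN.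
have [K1 K10 QK1] := inA1_weight QA1.
have [K2 K20 QK2] := inA1_weight QA2.
have [K3 K30 VK] := inA1_weight VA.
pose K := K1 + K2 + K3.
have {}QK1 : exp_mean_le Q1 K by apply: exp_mean_leW QK1; rewrite /K; lra.
have {}QK2 : exp_mean_le Q2 K by apply: exp_mean_leW QK2; rewrite /K; lra.
have {}VK : exp_mean_le (V kappa) K by apply: exp_mean_leW VK; rewrite /K; lra.
have K0 : 0 < K by rewrite /K !addr_gt0.
clearbody K.
pose sigma := s1 + s2.
have sg0 : 0 <= sigma by rewrite addr_ge0.
have iA1 := L1s_integrable A1s (_ : s1 <= sigma).
have iA2 := L1s_integrable A2s (_ : s2 <= sigma).
have {}iA1 := iA1 (ler_wpDr s20 (lexx s1)).
have {}iA2 := iA2 (ler_wpDl s10 (lexx s2)).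
clearbody sigma.
pose D t := Q1 t - Q2 t; pose B t := A1 t - A2 t.
have iD : mu.-integrable setT (EFin \o cutoff a D).
  have := integrableB measurableT (inA1_integrable_cutoff a QA1) (inA1_integrable_cutoff a QA2).
  by apply: eq_integrable; [by []|move=> s _; rewrite /= /cutoff /D mulrBr].
have iBw : mu.-integrable setT (EFin \o exp_damped sigma B).
  have := integrableB measurableT iA1 iA2.
  by apply: eq_integrable; [by []|move=> s _; rewrite /= /exp_damped /B !mulrBr].
have iB := integrable_cutoff_damped a sg0 iBw.
have mD := integrable_measurable iD.
have mB := integrable_measurable iB.
have fin (f : R -> R) : mu.-integrable setT (EFin \o f) ->
    (\int[mu]_s `|f s|%:E <= (\int[mu]_s `|f s|)%:E)%E.
  by move=> fi; rewrite (Rintegral_EFin (integrable_norm fi)).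
have DN := fin _ iD; have BN := fin _ iB.
set ND := \int[mu]_s `|cutoff a D s| in DN; set NB := \int[mu]_s `|cutoff a B s| in BN.
pose NT := \int[mu]_s `|exp_damped sigma B s|.
have NT0 : 0 <= NT by apply: Rintegral_ge0 => s _.
have ND0 : 0 <= ND by apply: Rintegral_ge0 => s _.
have NB0 : 0 <= NB by apply: Rintegral_ge0 => s _.
have N20 : 0 <= 2 * N by rewrite mulr_ge0// ltW.
set M := 4 * ((2 * N) ^+ 2 + 2 * N + 1).
have M0 : 0 < M by rewrite mulr_gt0// ltr_wpDl// addr_ge0// sqr_ge0.
have [kN1 _] := tk1; have [kN2 _] := tk2; have [kNV _] := tkV.
have KM : exp_kernel M (kernel_prod k1 k2) := kernel_prod_exp N20 kN1 kN2.
have LM : exp_kernel M (kernel_prod kV kV) := kernel_prod_exp N20 kNV kNV.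
exists (kernel_prod k1 k2), (kernel_prod kV kV); split => //.
have D0 t : t <= 0 -> cutoff a D t = 0 by exact: cutoff_le0.
have B0 t : t <= 0 -> cutoff a B t = 0 by exact: cutoff_le0.
pose F s := volterra (kernel_prod k1 k2) (cutoff a D) s - volterra (kernel_prod kV kV) (cutoff a B) s.
suff : {ae mu, forall s, s < a -> F s = 0}.
  apply: filterS; first exact: (ae_filter_ringOfSetsType mu).
  by move=> s Fs sa; apply/eqP; rewrite -subr_eq0; apply/eqP; exact: Fs.
have mF : measurable_fun setT F.
  have [mK _ _] := KM; have [mL _ _] := LM.
  apply: measurable_funB; apply: measurable_funD => //; exact: measurable_volterra_term.
have F0 s : s <= 0 -> F s = 0.
  by move=> sle0; rewrite /F (volterra_le0 KM D0 sle0) (volterra_le0 LM B0 sle0) subrr.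
pose E := 24 * expR (2 * a) * (4 * expR a + 2).
have E0 : 0 <= E by rewrite /E !mulr_ge0 ?addr_ge0 ?expR_ge0.
pose C := ND * E + NB * E + 16 * expR (2 * (1 + sigma) * a) * NT.
have C0 : 0 <= C by rewrite /C !addr_ge0// !mulr_ge0// expR_ge0.
pose c := 224 * expR (2 * a).
have c0 : 0 <= c by apply: mulr_ge0; [exact: ler0n|exact: expR_ge0].
have estimate : \forall z \near +oo,
    mu.-integrable setT (EFin \o (fun s => expR (- (2 * z) * s) * F s)) /\
    `|\int[mu]_s (expR (- (2 * z) * s) * F s)| <=
      (C + c * z) * expR (- (2 * z) * a).
  near=> z.
  have z3 : 2 <= z by near: z; apply: nbhs_pinfty_ge; exact: num_real.
  have z4 : 2 * K <= z by near: z; apply: nbhs_pinfty_ge; exact: num_real.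
  have z5 : 2 * N <= z by near: z; apply: nbhs_pinfty_ge; exact: num_real.
  have z6 : M < 2 * z.
    by rewrite mulrC -ltr_pdivrMr//; near: z; apply: nbhs_pinfty_gt; exact: num_real.
  have z7 : 1 + sigma <= z by near: z; apply: nbhs_pinfty_ge; exact: num_real.
  have z8 : expR `|kappa| < z + 1.
    by rewrite -ltrBlDr; near: z; apply: nbhs_pinfty_gt; exact: num_real.
  have za : 1 <= z * a.
    by rewrite -ler_pdivrMr// mul1r; near: z; apply: nbhs_pinfty_ge; exact: num_real.
  have zp : 0 < z by rewrite (lt_le_trans _ z3).
  have [m1 [mV1 [wt1 wV1 e1]]] : exists m mV : R, [/\ weyl_titchmarsh Q1 (- z ^+ 2) m,
        weyl_titchmarsh (V kappa) (- z ^+ 2) mV &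
        m - mV = - \int[mu]_(t in `]0, +oo[) (A1 t * u z t kappa ^+ 2)] by near: z.
  have [m2 [mV2 [wt2 wV2 e2]]] : exists m mV : R, [/\ weyl_titchmarsh Q2 (- z ^+ 2) m,
        weyl_titchmarsh (V kappa) (- z ^+ 2) mV &
        m - mV = - \int[mu]_(t in `]0, +oo[) (A2 t * u z t kappa ^+ 2)] by near: z.
  have [u' us] := u_L2_solution zp z8.
  (* Each amplitude comes with its own value of m_V; both equal the derivative at 0 of the explicit
     solution u. *)
  have mV12 : mV1 = mV2.
    rewrite (weyl_titchmarsh_solution VA VK z3 z4 wV1 us).
    by rewrite (weyl_titchmarsh_solution VA VK z3 z4 wV2 us).
  have [v1 [v1' [vs1 _ mE1]]] := wt1.
  have [v2 [v2' [vs2 _ mE2]]] := wt2.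
  pose w t := u z t kappa.
  have mw : measurable_fun setT (fun t => (0 < t)%R%:R * w t) := measurable_solution VA us.
  have wle t : 0 <= t -> `|expR (z * t) * w t| <= 4 * expR t.
    by move=> t0; exact: (solution_bound VA VK us z3 z4 t0).
  have [jA1 _] := damped_square_tail a sg0 z7 iA1 mw wle.
  have [jA2 _] := damped_square_tail a sg0 z7 iA2 mw wle.
  have [jB tail] := damped_square_tail a sg0 z7 iBw mw wle.
  have half (A : R -> R) : \int[mu]_(t in `]0, +oo[) (A t * w t ^+ 2) =
      \int[mu]_t ((0 < t)%R%:R * (A t * w t ^+ 2)).
    rewrite [LHS]Rintegral_mkcond; apply: eq_Rintegral => t _.
    by rewrite indicator_patch patchE mem_setE in_itv/= andbT.
  have mm : v1' 0 - v2' 0 = - \int[mu]_t ((0 < t)%R%:R * (B t * w t ^+ 2)).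
    rewrite -mE1 -mE2.
    have -> : \int[mu]_t ((0 < t)%R%:R * (B t * w t ^+ 2)) =
        \int[mu]_t ((0 < t)%R%:R * (A1 t * w t ^+ 2)) -
        \int[mu]_t ((0 < t)%R%:R * (A2 t * w t ^+ 2)).
      rewrite -(RintegralB measurableT jA1 jA2); apply: eq_Rintegral => t _.
      by rewrite /B; ring.
    rewrite mV12 in e1; rewrite -!half (_ : m1 - m2 = (m1 - mV2) - (m2 - mV2)); last by ring.
    by rewrite e1 e2 opprB opprK addrC.
  have [_ W] := solutions_wronskian QA1 QA2 vs1 vs2 a0.
  have We := solutions_wronskian_end QA1 QA2 QK1 QK2 vs1 vs2 z3 z4 a0 za.
  have [i1 p1] := solution_product_laplace QA1 QA2 QK1 QK2 tk1 tk2 QN1 QN2 N0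
    vs1 vs2 z3 z4 z5 z6 a0 za mD DN.
  have [i2 p2] := solution_product_laplace VA VA VK VK tkV tkV VN VN N0
    us us z3 z4 z5 z6 a0 za mB BN.
  have FE s : expR (- (2 * z) * s) * F s =
      expR (- (2 * z) * s) * volterra (kernel_prod k1 k2) (cutoff a D) s -
      expR (- (2 * z) * s) * volterra (kernel_prod kV kV) (cutoff a B) s.
    by rewrite -mulrBr.
  split.
    have := integrableB measurableT i1 i2.
    by apply: eq_integrable; [by []|move=> s _; rewrite /= FE].
  under eq_Rintegral do rewrite FE.
  rewrite (RintegralB measurableT i1 i2).
  apply: le_trans (wronskian_error p1 p2 tail We W mm) _.
  rewrite -/E -/NT /C /c le_eqVlt; apply/orP; left; apply/eqP.
  by move: (expR _) => e; ring.
(* The error carries a factor z, so [laplace_unique] is applied at every b < a, and [ae_lt_sup]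
   collects these b. *)
apply: ae_lt_sup => b ba.
case: estimate => Z [_ hZ].
have z00 : 0 < Num.max 1 (Z + 1) by rewrite lt_max ltr01.
have zZ z : Num.max 1 (Z + 1) <= z -> 0 <= z /\ Z < z.
  by rewrite ge_max => /andP[z1 zZ]; split; [exact: le_trans z1|apply: lt_le_trans zZ; rewrite ltrDl].
have ab0 : 0 <= (a - b)^-1 by rewrite invr_ge0 subr_ge0 ltW.
clearbody c C.
have C'0 : 0 <= C + c * (a - b)^-1 by rewrite addr_ge0// mulr_ge0.
apply: (laplace_unique mF F0 z00 C'0) => z /zZ[zp zZ']; first by have [] := hZ z zZ'.
have [_ h] := hZ z zZ'; apply: le_trans h _.
have h1 : C * expR (- (2 * z) * a) <= C * expR (- (2 * z) * b).
  by apply: ler_wpM2l => //; rewrite ler_expR !mulNr lerN2 ler_wpM2l ?mulr_ge0 ?(ltW ba).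
have h2 := ler_wpM2l c0 (mul_expR_le zp ba).
rewrite [leLHS]mulrDl [leRHS]mulrDl; apply: lerD; first exact: h1.
by rewrite -[leLHS]mulrA -[leRHS]mulrA.
Unshelve. all: by end_near.
Qed.

End transformation.


(** * Two-sided Lipschitz estimates and the conclusion *)

Section lipschitz.
Context {R : realType}.
Notation mu := (@lebesgue_measure R).
Implicit Types (Q A f g : R -> R) (a kappa N M : R).

Lemma L1_distE a f g :
  L1_dist a f g = \int[mu]_t `|cutoff a (fun t => f t - g t) t|.
Proof.
rewrite /L1_dist -Rintegral_cutoff; apply: eq_Rintegral => t _.
by rewrite /cutoff normrM ger0_norm.
Qed.

(** Integrability guards the converse: [L1_dist] is a real number, and an infinite distance would be
    recorded as 0. *)
Lemma ae_eq_on_L1_dist a f g :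
  mu.-integrable setT (EFin \o cutoff a (fun t => f t - g t)) ->
  (ae_eq_on a f g <-> L1_dist a f g = 0).
Proof.
move=> ifg; have m := measurable_int _ ifg.
have [h1 h2] := @ae_eq_integral_abs _ _ _ mu _ measurableT _ m.
have E : (L1_dist a f g)%:E = (\int[mu]_t `|(EFin \o cutoff a (fun t => (f t - g t)%R)) t|)%E.
  by rewrite L1_distE (Rintegral_EFin (integrable_norm ifg)).
split=> [fg|fg0].
  apply/EFin_inj; rewrite E; apply: h2.
  move: fg; apply: filterS; first exact: (ae_filter_ringOfSetsType mu).
  move=> t fgt _; rewrite /= /cutoff; case: (boolP (_ && _)) => [/fgt ->|_].
    by rewrite subrr mulr0.
  by rewrite mul0r.
have /h1 : (\int[mu]_t `|(EFin \o cutoff a (fun t => (f t - g t)%R)) t|)%E = 0.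
  by rewrite -E fg0.
rewrite /ae_eq /ae_eq_on; apply: filterS.
move=> t ft t0a; have [] : (cutoff a (fun t => f t - g t) t)%:E = 0%:E by exact: ft.
by rewrite /cutoff t0a mul1r => /eqP; rewrite subr_eq0 => /eqP.
Qed.

Lemma integrable_cutoffB a f g : mu.-integrable setT (EFin \o cutoff a f) ->
  mu.-integrable setT (EFin \o cutoff a g) ->
  mu.-integrable setT (EFin \o cutoff a (fun t => f t - g t)).
Proof.
move=> fi gi; have := integrableB measurableT fi gi.
by apply: eq_integrable; [by []|move=> s _; rewrite /= /cutoff mulrBr].
Qed.

(** The identity of [amplitude_volterra] is symmetric in form, so [volterra_gronwall] applies in
    both directions with the same constant; the constant is fixed before the potentials are. *)
Lemma amplitude_lipschitz kappa a N : 0 < a -> 0 < N ->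
  (\int[mu]_s `|cutoff a (V kappa) s|%:E <= N%:E)%E ->
  exists2 C : R, 0 < C & forall Q1 Q2 A1 A2,
  inA1 Q1 -> inA1 Q2 -> is_amplitude kappa Q1 A1 -> is_amplitude kappa Q2 A2 ->
  (\int[mu]_s `|cutoff a Q1 s|%:E <= N%:E)%E ->
  (\int[mu]_s `|cutoff a Q2 s|%:E <= N%:E)%E ->
  [/\ mu.-integrable setT (EFin \o cutoff a (fun t => A1 t - A2 t)),
      L1_dist a Q1 Q2 <= C * L1_dist a A1 A2 &
      L1_dist a A1 A2 <= C * L1_dist a Q1 Q2].
Proof.
move=> a0 N0 VN; set M := 4 * ((2 * N) ^+ 2 + 2 * N + 1).
have M0 : 0 < M by rewrite mulr_gt0// ltr_wpDl// addr_ge0 ?sqr_ge0// mulr_ge0// ltW.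
exists (3 * expR (3 * M * a)); first by rewrite mulr_gt0// expR_gt0.
move=> Q1 Q2 A1 A2 QA1 QA2 amp1 amp2 QN1 QN2.
have [K [L [KM LM iB KL]]] := amplitude_volterra a0 N0 VN QA1 QA2 amp1 amp2 QN1 QN2.
have iD := integrable_cutoffB (inA1_integrable_cutoff a QA1) (inA1_integrable_cutoff a QA2).
have cge f s : a <= s -> cutoff a f s = 0.
  by move=> as'; rewrite /cutoff [s < a]ltNge as' andbF mul0r.
split => //; rewrite !L1_distE.
  apply: (volterra_gronwall KM LM M0 a0 iD iB) => //.
  - exact: cutoff_le0.
  - exact: cutoff_le0.
  - by move=> t; exact: cge.
apply: (volterra_gronwall LM KM M0 a0 iB iD) => //.
- exact: cutoff_le0.
- exact: cutoff_le0.
- by move=> t; exact: cge.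
- move: KL; apply: filterS; first exact: (ae_filter_ringOfSetsType mu).
  by move=> s h /h.
Qed.

Lemma lebesgue_measure_oo a : 0 < a -> mu `]0, a[%classic = a%:E.
Proof.
by move=> a0; rewrite lebesgue_measure_itv/= lte_fin a0 -EFinD subr0.
Qed.

(** For finite p use |x| <= 1 + |x|^p on (0,a), so N = a + M^p; for p = oo take N = M a. *)
Lemma Lp_norm_L1 (p : \bar R) a M : (1 < p)%E -> 0 < a -> 0 < M ->
  exists2 N, 0 < N & forall Q, inA1 Q -> (Lp_norm p a Q < M%:E)%E ->
    (\int[mu]_s `|cutoff a Q s|%:E <= N%:E)%E.
Proof.
move=> p1 a0 M0.
have fE Q : (EFin \o Q) \_ `]0, a[ = EFin \o cutoff a Q.
  by apply/funext => s; rewrite patchE mem_setE in_itv/= /cutoff indicator_patch; case: ifP.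
have i1 c : mu.-integrable setT (EFin \o (fun s => (0 < s < a)%R%:R * c)).
  by apply/integrable_window/continuous_integrable_oo; exact: cst_continuous.
have win c : (\int[mu]_s ((0 < s < a)%R%:R * c)%:E)%E = (c * a)%:E.
  rewrite -(Rintegral_EFin (i1 c)) Rintegral_window Rintegral_cst//.
  by rewrite [X in fine X](lebesgue_measure_oo a0).
case: p p1 => [r|_|//].
- rewrite lte_fin => r1; have r0 : 0 < r by exact: lt_trans r1.
  exists (a + M `^ r) => [|Q QA]; first by rewrite ltr_pwDl// powR_ge0.
  have mQ := measurable_cutoff a QA.
  rewrite /Lp_norm fE => QM.
  have mp : measurable_fun setT (fun s => `|cutoff a Q s| `^ r).
    have mN : measurable_fun setT (fun s => `|cutoff a Q s|) by exact: measurableT_comp.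
    exact: (measurableT_comp (measurable_powR r) mN).
  have Qp : (\int[mu]_s (`|cutoff a Q s| `^ r)%:E <= (M `^ r)%:E)%E.
    rewrite [leLHS](_ : _ = 'N[mu]_r%:E[EFin \o cutoff a Q] `^ r)%E; last first.
      by rewrite poweR_Lnorm ?gt_eqF//; apply: eq_integral => s _; rewrite /= -poweR_EFin.
    rewrite -poweR_EFin; apply: gt0_ler_poweR; [exact: ltW| | |exact: ltW].
      by rewrite in_itv/= Lnorm_ge0 leey.
    by rewrite in_itv/= lee_fin (ltW M0) leey.
  apply: (@le_trans _ _ (\int[mu]_s ((0 < s < a)%R%:R * 1)%:E +
      \int[mu]_s (`|cutoff a Q s| `^ r)%:E)%E); last first.
    by rewrite win mul1r EFinD leeD2l.
  have mw : measurable_fun setT (fun s : R => (0 < s < a)%R%:R * (1 : R)) by meas.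
  rewrite -ge0_integralD; [|exact: measurableT|by move=> s _; rewrite lee_fin mulr1|
    exact/measurable_EFinP|by move=> s _; rewrite lee_fin powR_ge0|exact/measurable_EFinP].
  apply: (@le_integral_bound _ _ _ mu (fun s => `|cutoff a Q s|)
      (fun s => (0 < s < a)%R%:R * 1 + `|cutoff a Q s| `^ r)).
  + exact: measurableT_comp.
  + exact: measurable_funD.
  + by [].
  move=> s; rewrite /cutoff; case: (boolP (_ && _)) => _; last first.
    by rewrite mul0r normr0 mul0r add0r powR_ge0.
  rewrite !mul1r; have [Q1|Q1] := leP `|Q s| 1.
    by rewrite (le_trans Q1)// lerDl powR_ge0.
  by rewrite -[leLHS]add0r lerD// le1r_powR// ltW.
- exists (M * a) => [|Q QA]; first by rewrite mulr_gt0.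
  have mQ := measurable_cutoff a QA.
  have mu0 : (0 < mu setT)%E.
    apply: (@lt_le_trans _ _ (mu `]0%R, a[%classic)).
      by rewrite lebesgue_measure_oo// lte_fin.
    by apply: le_measure; rewrite ?inE.
  rewrite /Lp_norm fE unlock /= ifT// => QM.
  have h := ess_sup_ge mu (abse \o (EFin \o cutoff a Q)).
  rewrite -win; apply: ae_ge0_le_integral; [exact: measurableT|by []|
    by apply/measurable_EFinP/measurableT_comp|
    by move=> s _; rewrite lee_fin mulr_ge0 ?(ltW M0)|by apply/measurable_EFinP; meas|].
  move: h; apply: filterS.
  move=> s hs _; have : (`|cutoff a Q s|%:E <= M%:E)%E by apply: le_trans hs (ltW QM).
  rewrite !lee_fin /cutoff; case: (boolP (_ && _)) => _; first by rewrite !mul1r.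
  by rewrite !mul0r normr0.
Qed.

Lemma hoelder_exponent (p : \bar R) (x : R) : (1 < p)%E -> 0 <= x -> x < 1 ->
  x <= x `^ (1 / (fine (hoelder_conjugate p) + 1)).
Proof.
move=> p1 x0 x1; have q0 : 0 <= fine (hoelder_conjugate p).
  by apply: fine_ge0; apply: le_trans (hoelder_conj_ge1 (ltW p1)).
have [->|xn0] := eqVneq x 0; first by rewrite powR_ge0.
apply: ger1_powR; first by rewrite lt_neqAle eq_sym xn0 x0 ltW.
by rewrite ler_pdivrMr ?mul1r ?ltr_wpDl// lerDr.
Qed.

End lipschitz.

Theorem theorem4p5 (R : realType) (kappa a : R) (ha : 0 < a) :
  (forall Q1 Q2 A1 A2 : R -> R,
     inA1 Q1 -> inA1 Q2 ->
     is_amplitude kappa Q1 A1 -> is_amplitude kappa Q2 A2 ->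
     (ae_eq_on a A1 A2 <-> ae_eq_on a Q1 Q2))
  /\
  (forall p : \bar R, (1 < p)%E ->
   exists2 eps : R, 0 < eps &
   forall M : R, 0 < M ->
   exists2 C1 : R, 0 < C1 &
   forall Q1 Q2 A1 A2 : R -> R,
     inA1 Q1 -> inA1 Q2 ->
     is_amplitude kappa Q1 A1 -> is_amplitude kappa Q2 A2 ->
     (Lp_norm p a Q1 < M%:E)%E -> (Lp_norm p a Q2 < M%:E)%E ->
     L1_dist a A1 A2 < eps ->
     L1_dist a Q1 Q2 <=
       C1 * (L1_dist a A1 A2) `^ (1 / (fine (hoelder_conjugate p) + 1))).
Proof.
have nrm (f : R -> R) : lebesgue_measure.-integrable setT (EFin \o f) ->
    (\int[lebesgue_measure]_s `|f s|%:E = (\int[lebesgue_measure]_s `|f s|)%:E)%E.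
  by move=> fi; rewrite (Rintegral_EFin (integrable_norm fi)).
have nrm0 (f : R -> R) : 0 <= \int[@lebesgue_measure R]_s `|f s|.
  by apply: Rintegral_ge0 => s _.
have dist0 (f g : R -> R) : 0 <= L1_dist a f g by rewrite L1_distE.
pose nV := \int[@lebesgue_measure R]_s `|cutoff a (V kappa) s|.
have iV := inA1_integrable_cutoff a (V_inA1 kappa).
split=> [Q1 Q2 A1 A2 QA1 QA2 amp1 amp2|p p1].
  have i1 := inA1_integrable_cutoff a QA1; have i2 := inA1_integrable_cutoff a QA2.
  pose n1 := \int[@lebesgue_measure R]_s `|cutoff a Q1 s|.
  pose n2 := \int[@lebesgue_measure R]_s `|cutoff a Q2 s|.
  have n10 : 0 <= n1 by exact: nrm0.
  have n20 : 0 <= n2 by exact: nrm0.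
  have nV0 : 0 <= nV by exact: nrm0.
  (* One common bound for the L^1 norms of both potentials and of V_kappa; the 1 makes it
     positive. *)
  have N0 : 0 < n1 + n2 + nV + 1 by rewrite ltr_wpDl// !addr_ge0.
  have [|C C0 lip] := @amplitude_lipschitz R kappa a (n1 + n2 + nV + 1) ha N0.
    by rewrite nrm// lee_fin -/nV; lra.
  have [||iB DB BD] := lip Q1 Q2 A1 A2 QA1 QA2 amp1 amp2.
  - by rewrite nrm// lee_fin -/n1; lra.
  - by rewrite nrm// lee_fin -/n2; lra.
  rewrite (ae_eq_on_L1_dist iB) (ae_eq_on_L1_dist (integrable_cutoffB i1 i2)).
  split=> [B0|D0]; apply/eqP; rewrite eq_le dist0 andbT.
    by rewrite (le_trans DB)// B0 mulr0.
  by rewrite (le_trans BD)// D0 mulr0.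
(* The linear estimate holds at every distance; distances below 1 are those where x <=
   x^{1/(p'+1)}. *)
exists 1 => // M M0.
have [N N0 LpN] := Lp_norm_L1 p1 ha M0.
have nV0 : 0 <= nV by exact: nrm0.
have N'0 : 0 < N + nV by rewrite ltr_pwDl.
have [|C C0 lip] := @amplitude_lipschitz R kappa a (N + nV) ha N'0.
  by rewrite nrm// lee_fin -/nV lerDr ltW.
exists C => // Q1 Q2 A1 A2 QA1 QA2 amp1 amp2 QM1 QM2 A_lt1.
have NN : (N%:E <= (N + nV)%:E)%E by rewrite lee_fin lerDl.
have [_ DB _] := lip Q1 Q2 A1 A2 QA1 QA2 amp1 amp2
  (le_trans (LpN _ QA1 QM1) NN) (le_trans (LpN _ QA2 QM2) NN).
by apply: le_trans DB _; rewrite ler_wpM2l ?(ltW C0)// hoelder_exponent.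
Qed.
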